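(* Let $M^5\subset\mathbb{C}^3$ be a local real analytic hypersurface passing through the origin, $0\in M^5$, which belongs to the General Class $\mathsf{IV}_{\mathsf 1}$, namely such that, for any two local generators $\{\mathcal{L}_1,\mathcal{L}_2\}$ for $T^{1,0}M$, the five fields $$\Big\{\mathcal{L}_1,\ \mathcal{L}_2,\ \overline{\mathcal{L}}_1,\ \overline{\mathcal{L}}_2,\ [\mathcal{L}_1,\overline{\mathcal{L}}_1]\Big\}$$ constitute a frame for $\mathbb{C}\otimes_{\mathbb{R}}TM$, and such that in addition the Levi form of $M$ at $p$ is of rank $2$ at every point $p\in M$. Then $M$ may always be represented, in suitable local holomorphic coordinates $(z_1,z_2,w)\in\mathbb{C}^3$ with $w=u+\sqrt{-1}\,v$, by a specific real analytic equation of the form $$v=z_1\overline{z}_1\pm z_2\overline{z}_2+\mathrm{O}_3(z_1,z_2,\overline{z}_1,\overline{z}_2,u),$$ with remainder $R(z_1,z_2,\overline{z}_1,\overline{z}_2,u)=\mathrm{O}_3(z_1,z_2,\overline{z}_1,\overline{z}_2,u)$ satisfying $$0\equiv R(0,0,\overline{z}_1,\overline{z}_2,u)\equiv R(z_1,z_2,0,0,u).$$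
   Context: $T^{1,0}M$ denotes the bundle $T^{1,0}\mathbb{C}^3|_M\cap(\mathbb{C}\otimes_{\mathbb{R}}TM)$, here of complex rank $2$; two local generators for it are two local sections forming a local frame of it. Bars denote conjugation and $[\cdot,\cdot]$ the Lie bracket. ''Frame'' means a basis of the fiber at every point of the (local) manifold $M$. Levi form: let $\rho_0$ be a nowhere zero real $1$-form on $M$ whose kernel in $\mathbb{C}\otimes_{\mathbb{R}}TM$ is $T^{1,0}M\oplus\overline{T^{1,0}M}$. The Levi form at $p$ is the Hermitian form on $T^{1,0}_pM$ given, for local sections $\mathcal{L},\mathcal{L}'$ of $T^{1,0}M$, by $(\mathcal{L}|_p,\mathcal{L}'|_p)\mapsto\rho_0\big(\sqrt{-1}\,[\mathcal{L},\overline{\mathcal{L}'}]\big)(p)$; its rank does not depend on the choice of $\rho_0$. Remainder notation: $\mathrm{O}_3(t_1,\dots,t_N)$ denotes an unspecified convergent power series (with complex coefficients) in $t_1,\dots,t_N$ all of whose monomials have total degree $\geqslant 3$. The right-hand side of the graphing equation is real-valued. The sign $\pm$ means one of the two choices of sign. In the identities for $R$, the variables $z_j$ and $\overline{z}_j$ are treated as independent variables of the power series $R$. *)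

(* Defs.v *)
From HB Require Import structures.
From mathcomp Require Import all_boot all_order all_algebra complex.
From mathcomp Require Import all_classical all_reals all_analysis.
Export numFieldNormedType.Exports.

Set Implicit Arguments.
Unset Strict Implicit.
Unset Printing Implicit Defensive.

Import Order.TTheory GRing.Theory Num.Theory.
Local Open Scope classical_set_scope.
Local Open Scope ring_scope.

(* The topology of R[i] is the one given by its modulus; 'rV[R[i]]_n then gets
   the sup norm. *)
#[warnings="-redundant-canonical-projection"]
HB.instance Definition _ (R : rcfType) := NormedModule.copy R[i] R[i]^o.

Section PowerSeries.
Variable R : realType.
Implicit Types n : nat.

Definition degree n (a : {ffun 'I_n -> nat}) : nat := (\sum_i a i)%N.

Definition monomial n (a : {ffun 'I_n -> nat}) (x : 'rV[R[i]]_n) : R[i] :=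
  \prod_i x 0 i ^+ a i.

(* The sum of the terms all of whose exponents are < N. *)
Definition partial_sum n (c : {ffun 'I_n -> nat} -> R[i]) (x : 'rV[R[i]]_n)
    (N : nat) : R[i] :=
  \sum_(a : {ffun 'I_n -> 'I_N})
     let b := [ffun i => nat_of_ord (a i)] in c b * monomial b x.

Definition abs_summable_at n (c : {ffun 'I_n -> nat} -> R[i]) (r : R) : bool :=
  summable [set: {ffun 'I_n -> nat}]
    (fun a => (complex.Re `|c a| * r ^+ degree a)%:E).

Definition polydisc n (r : R) : set 'rV[R[i]]_n :=
  [set x | forall i, `|x 0 i| < (r%:C)%C].

(* Absolute summability makes the limit of the partial sums over cubes of
   exponents the unordered sum of the series. *)
Definition is_sum_on n (c : {ffun 'I_n -> nat} -> R[i]) (r : R)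
    (F : 'rV[R[i]]_n -> R[i]) : Prop :=
  [/\ 0 < r, abs_summable_at c r &
    forall x, polydisc r x -> partial_sum c x @ \oo --> F x].

Definition holomorphic_at n (f : 'rV[R[i]]_n -> R[i]) (p : 'rV[R[i]]_n) : Prop :=
  exists c r, is_sum_on c r (fun x => f (p + x)).

Definition conj_mx m n (A : 'M[R[i]]_(m, n)) : 'M[R[i]]_(m, n) :=
  map_mx Num.conj A.

(* Real analyticity on C^n = R^(2n): f (p + x) is a convergent power series in
   x and its conjugate, i.e. in the real and imaginary parts of x. *)
Definition real_analytic_at n (f : 'rV[R[i]]_n -> R[i]) (p : 'rV[R[i]]_n) :
    Prop :=
  exists c r F, is_sum_on c r F /\
    forall x, polydisc r x -> f (p + x) = F (row_mx x (conj_mx x)).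

Definition holomorphic_map_on n m (U : set 'rV[R[i]]_n)
    (f : 'rV[R[i]]_n -> 'rV[R[i]]_m) : Prop :=
  forall k p, U p -> holomorphic_at (fun q => f q 0 k) p.

Definition biholomorphism n (U V : set 'rV[R[i]]_n)
    (Phi : 'rV[R[i]]_n -> 'rV[R[i]]_n) : Prop :=
  [/\ open U, open V, holomorphic_map_on U Phi,
      (forall p, U p -> V (Phi p)) &
      exists Psi : 'rV[R[i]]_n -> 'rV[R[i]]_n,
        [/\ holomorphic_map_on V Psi,
            (forall q, V q -> U (Psi q)),
            (forall p, U p -> Psi (Phi p) = p) &
            (forall q, V q -> Phi (Psi q) = q)]].

End PowerSeries.

Section VectorFields.
Variable R : realType.

Notation C3 := 'rV[R[i]]_3.
(* A vector (a, b) stands for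
     \sum_j a_j d/dz_j + \sum_j b_j d/dzbar_j. *)
Notation CT := 'rV[R[i]]_(3 + 3).

(* Derivative at p of the complex-valued function f along the real direction
   v. *)
Definition real_derivative (f : C3 -> R[i]) (v p : C3) : R[i] :=
  Complex
    (derive1 (fun t : R => complex.Re (f (p + (t%:C)%C *: v))) 0)
    (derive1 (fun t : R => complex.Im (f (p + (t%:C)%C *: v))) 0).

Definition d_z (j : 'I_3) (f : C3 -> R[i]) (p : C3) : R[i] :=
  2^-1 * (real_derivative f (delta_mx 0 j) p
          - 'i * real_derivative f ('i *: delta_mx 0 j) p).

Definition d_zbar (j : 'I_3) (f : C3 -> R[i]) (p : C3) : R[i] :=
  2^-1 * (real_derivative f (delta_mx 0 j) p
          + 'i * real_derivative f ('i *: delta_mx 0 j) p).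

Definition differential (f : C3 -> R[i]) (p : C3) : 'cV[R[i]]_(3 + 3) :=
  col_mx (\col_j d_z j f p) (\col_j d_zbar j f p).

Definition pairing (X : CT) (omega : 'cV[R[i]]_(3 + 3)) : R[i] :=
  (X *m omega) 0 0.

Definition lie_bracket (X Y : C3 -> CT) (p : C3) : CT :=
  \row_k (pairing (X p) (differential (fun q => Y q 0 k) p)
          - pairing (Y p) (differential (fun q => X q 0 k) p)).

Definition conj_vector (X : CT) : CT :=
  row_mx (conj_mx (rsubmx X)) (conj_mx (lsubmx X)).

Definition conj_field (X : C3 -> CT) (p : C3) : CT := conj_vector (X p).

Definition T10_ambient : {vspace CT} :=
  lker (linfun (@rsubmx R[i] 1 3 3)).

Definition hypersurface (U : set C3) (rho : C3 -> R) : set C3 :=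
  U `&` [set p | rho p = 0].

Definition to_complex (rho : C3 -> R) : C3 -> R[i] := fun p => ((rho p)%:C)%C.

Definition local_hypersurface (U : set C3) (rho : C3 -> R) : Prop :=
  [/\ open U, hypersurface U rho 0,
      (forall p, U p -> real_analytic_at (to_complex rho) p) &
      (forall p, hypersurface U rho p ->
         differential (to_complex rho) p != 0)].

(* C (x) T_pM is the kernel of the differential of rho at p, for p in M. *)
Definition CTM (rho : C3 -> R) (p : C3) : {vspace CT} :=
  lker (linfun (mulmxr (differential (to_complex rho) p))).

Definition T10M (rho : C3 -> R) (p : C3) : {vspace CT} :=
  (T10_ambient :&: CTM rho p)%VS.

(* Sections over M are given by real analytic extensions to U, tangent to M
   along M; the restrictions of their brackets to M do not depend on the
   extensions. *)
Definition local_generators (U : set C3) (rho : C3 -> R) (L1 L2 : C3 -> CT) :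
    Prop :=
  (forall k p, U p -> real_analytic_at (fun q => L1 q 0 k) p /\
                      real_analytic_at (fun q => L2 q 0 k) p) /\
  (forall p, hypersurface U rho p ->
     basis_of (T10M rho p) [:: L1 p; L2 p]).

(* A condition on one pair of generators, weaker than asking it of all pairs:
   the latter excludes Levi signature (1, 1), where [L1, conj L1] is tangent to
   T10M + T01M when L1 is isotropic. *)
Definition five_frame (U : set C3) (rho : C3 -> R) (L1 L2 : C3 -> CT) : Prop :=
  forall p, hypersurface U rho p ->
    basis_of (CTM rho p)
      [:: L1 p; L2 p; conj_field L1 p; conj_field L2 p;
          lie_bracket L1 (conj_field L1) p].

(* A nowhere zero real 1-form on M, extended arbitrarily to ambient covectors,
   whose kernel is the direct sum of T10M and its conjugate. *)
Definition levi_one_form (U : set C3) (rho : C3 -> R)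
    (rho0 : C3 -> 'cV[R[i]]_(3 + 3)) : Prop :=
  forall p, hypersurface U rho p ->
    [/\ (forall X, X \in CTM rho p ->
           pairing (conj_vector X) (rho0 p) = (pairing X (rho0 p))^*),
        (exists2 X, X \in CTM rho p & pairing X (rho0 p) != 0) &
        (forall X, X \in CTM rho p ->
           pairing X (rho0 p) = 0 <->
           exists A B, [/\ A \in T10M rho p, B \in T10M rho p &
                           X = A + conj_vector B])].

Definition levi_form (rho0 : C3 -> 'cV[R[i]]_(3 + 3)) (L L' : C3 -> CT)
    (p : C3) : R[i] :=
  pairing ('i *: lie_bracket L (conj_field L') p) (rho0 p).

(* Gram matrix of the Levi form in the basis (L1 p, L2 p) of T10M rho p; its
   rank is the rank of the Levi form at p. *)
Definition levi_matrix (rho0 : C3 -> 'cV[R[i]]_(3 + 3)) (L1 L2 : C3 -> CT)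
    (p : C3) : 'M[R[i]]_2 :=
  \matrix_(j, k)
    levi_form rho0 (tnth [tuple L1; L2] j) (tnth [tuple L1; L2] k) p.

End VectorFields.

Section Remainders.
Variable R : realType.

Definition vec5 (a b c d e : R[i]) : 'rV[R[i]]_5 :=
  \row_k [:: a; b; c; d; e]`_k.

(* F is, on the polydisc of radius r, the sum of a convergent power series all
   of whose monomials have total degree >= 3. *)
Definition is_O3 n (F : 'rV[R[i]]_n -> R[i]) (r : R) : Prop :=
  exists c, is_sum_on c r F /\ forall a, c a != 0 -> (3 <= degree a)%N.

End Remainders.

(* Main.v *)
Require Import Defs.
From HB Require Import structures.
From mathcomp Require Import all_boot all_order all_algebra complex.
From mathcomp Require Import all_classical all_reals all_analysis.
From mathcomp Require Import ring lra zify.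
Import Order.TTheory GRing.Theory Num.Theory.
Local Open Scope classical_set_scope.
Local Open Scope ring_scope.

Set Implicit Arguments.
Unset Strict Implicit.
Unset Printing Implicit Defensive.

(** The conjugate coordinates are replaced by independent variables: near 0 the
    defining function is the restriction to conjugate points of a germ
    P (z, w, zeta, omega) in six variables, which can be taken Hermitian, i.e.
    compatible with conjugation ([hermitian_extension]).

    Linear normalization.  For sections L, L' of the bundle of (1, 0)-vectors,
    the part of [L, conj L'] transversal to M is given by the mixed second
    derivatives of P, because the functions expressing that L and L' are tangent
    to M vanish on M, and so do their tangential derivatives ([levi_bracket],
    [tangential_derivative]).  A Levi form of rank 2 thus means that the mixed
    second derivatives are nondegenerate on the complex tangent plane at 0
    ([levi_nondegenerate]).  A basis of this plane that
    is orthogonal with squared lengths 1 or -1 ([orthonormal_pair]), completed by a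
    transversal vector, gives linear coordinates in which the equation becomes,
    up to sign, (i/2) (w - omega) + z_1 zeta_1 + eps z_2 zeta_2 + ..., eps being 1
    or -1 and the omitted terms of degree 2 being pure, i.e. in z alone or in
    zeta alone, or involving w or omega ([straightened_linear],
    [straightened_quadratic]).

    Nonlinear normalization ([normal_form]).  M meets the line z = 0 in a real
    curve w = t + i psi t ([axis]).  The Segre varieties of the points of this
    curve, given by the equation with zeta = 0 and omega = t - i psi t, form a
    family of complex hypersurfaces w = W (z, t), and their parameter t is taken
    as new transversal coordinate ([segre_solution], [segre_coordinate]).  In this
    coordinate M is v = phi (z, zeta, u) with zeta = conj z
    ([defining_function], [graph_equation]).  A point of the curve and a point of
    its Segre variety solve the complexified equation, so phi vanishes for
    zeta = 0, and by conjugation for z = 0 ([phi_pure], [phi_pure_conj]).  Hence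
    the terms of phi of degree at most 2 are multiples of the z_j zeta_k, and
    their coefficients are those of the complexified equation
    ([phi_second_order], [remainder_order3]).

    Everything is carried out with power series bounded by the weighted l1 norm of
    their coefficients on a closed polydisc.  Products, substitutions and limits
    of such series all reduce to sums of normally summable families ([ps_family]),
    hence to Fubini for unordered sums ([usum_slices]); the implicit function
    theorem is the contraction principle for this norm ([implicit_function]). *)

(** * Moduli of complex numbers *)

Section Modulus.
Variable R : realType.
Implicit Types z w : R[i].

(** The norm of R[i] takes its values in R[i]; estimates need them in R. *)
Definition md (z : R[i]) : R := complex.Re `|z|.

Lemma mdE z : ((md z)%:C)%C = `|z|.
Proof. by rewrite /md normc_def. Qed.

Lemma md_ge0 z : 0 <= md z.
Proof. by rewrite -ler0c mdE. Qed.

Lemma mdM z w : md (z * w) = md z * md w.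
Proof. by apply: complexI; rewrite rmorphM /= !mdE normrM. Qed.

Lemma md0 : md 0 = 0.
Proof. by rewrite /md normr0. Qed.

Lemma md1 : md 1 = 1.
Proof. by rewrite /md normr1. Qed.

Lemma mdN z : md (- z) = md z.
Proof. by rewrite /md normrN. Qed.

Lemma mdB z w : md (z - w) = md (w - z).
Proof. by rewrite /md distrC. Qed.

Lemma md_eq0 z : (md z == 0) = (z == 0).
Proof. by rewrite -(inj_eq (@complexI _)) mdE normr_eq0. Qed.

Lemma mdD z w : md (z + w) <= md z + md w.
Proof. by rewrite -lecR rmorphD /= !mdE ler_normD. Qed.

Lemma md_trans u z w : md (z - w) <= md (z - u) + md (u - w).
Proof. by rewrite (le_trans _ (mdD _ _))// subrKA. Qed.

Lemma mdX z n : md (z ^+ n) = md z ^+ n.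
Proof. by apply: complexI; rewrite rmorphXn /= !mdE normrX. Qed.

Lemma mdV z : md z^-1 = (md z)^-1.
Proof. by apply: complexI; rewrite fmorphV /= !mdE normfV. Qed.

Lemma md_conj z : md z^* = md z.
Proof. by rewrite /md norm_conjC. Qed.

Lemma md_real (x : R) : md (x%:C)%C = `|x|.
Proof. by rewrite /md normc_def /= expr0n /= addr0 sqrtr_sqr. Qed.

Lemma md_i : md 'i = 1.
Proof. by rewrite /md normCi. Qed.

Lemma md_sum (I : Type) (s : seq I) (P : pred I) (F : I -> R[i]) :
  md (\sum_(i <- s | P i) F i) <= \sum_(i <- s | P i) md (F i).
Proof.
elim/big_rec2: _ => [|i y1 y2 _ le12]; first by rewrite md0.
by rewrite (le_trans (mdD _ _))// lerD2l.
Qed.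

Lemma md_prod (I : Type) (s : seq I) (P : pred I) (F : I -> R[i]) :
  md (\prod_(i <- s | P i) F i) = \prod_(i <- s | P i) md (F i).
Proof.
elim/big_rec2: _ => [|i y1 y2 _ <-]; first by rewrite md1.
by rewrite mdM.
Qed.

Lemma ltc_md z r : (`|z| < (r%:C)%C) = (md z < r).
Proof. by rewrite -mdE ltcR. Qed.

Lemma md_Re z : `|complex.Re z| <= md z.
Proof. by rewrite -lecR mdE normc_ge_Re. Qed.

Lemma md_Im z : `|complex.Im z| <= md z.
Proof.
have -> : md z = md (- 'i * z) by rewrite mdM mdN md_i mul1r.
apply: le_trans (md_Re _); case: z => a b /=.
by rewrite le_eqVlt; apply/orP; left; apply/eqP; congr `|_|; rewrite /=; ring.
Qed.

Lemma md_small z : (forall e : R, 0 < e -> md z <= e) -> z = 0.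
Proof.
move=> h; apply/eqP; rewrite -md_eq0; apply: contraT => z0.
have zp : 0 < md z by rewrite lt_neqAle eq_sym z0 md_ge0.
have := h (md z / 2); rewrite divr_gt0 ?ltr0n// => /(_ isT); lra.
Qed.

End Modulus.

(** * Unordered sums *)

Section UnorderedSums.
Variable R : realType.

Lemma sum_subset (I : eqType) (V : nmodType) (t : I -> V) s0 s :
  uniq s0 -> uniq s -> {subset s0 <= s} ->
  \sum_(i <- s) t i = \sum_(i <- s0) t i + \sum_(i <- s | i \notin s0) t i.
Proof.
move=> us0 us sub; rewrite (bigID (mem s0)) /=; congr (_ + _).
rewrite -big_filter; apply: perm_big; apply: uniq_perm; rewrite ?filter_uniq// => x.
by rewrite mem_filter /=; case: (boolP (x \in s0)) => // /sub ->.
Qed.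

(** Summability is measured on the finite subfamilies, given as duplicate-free
    sequences: bsum bounds a family of nonnegative reals, usum is the limit along
    the directed set of finite subfamilies. *)
Definition bsum (I : eqType) (p : I -> R) (B : R) : Prop :=
  forall s, uniq s -> \sum_(i <- s) p i <= B.

Definition usum (I : eqType) (t : I -> R[i]) (l : R[i]) : Prop :=
  forall e : R, 0 < e -> exists s0 : seq I, forall s, uniq s -> {subset s0 <= s} ->
    md (\sum_(i <- s) t i - l) <= e.

Lemma bsum_le (I : eqType) (p q : I -> R) B : (forall i, p i <= q i) ->
  bsum q B -> bsum p B.
Proof. by move=> le_pq qB s us; apply: le_trans (qB s us); apply: ler_sum. Qed.

Lemma bsum_ge0 (I : eqType) (p : I -> R) B : bsum p B -> 0 <= B.
Proof. by move=> /(_ [::] isT); rewrite big_nil. Qed.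

Lemma bsum1 (I : eqType) (p : I -> R) B i : bsum p B -> p i <= B.
Proof. by move=> /(_ [:: i] isT); rewrite big_seq1. Qed.

Lemma usum_add (I : eqType) (t t' : I -> R[i]) l l' :
  usum t l -> usum t' l' -> usum (fun i => t i + t' i) (l + l').
Proof.
move=> tl tl' e e0; have e2 : 0 < e / 2 by rewrite divr_gt0.
have [s1 h1] := tl _ e2; have [s2 h2] := tl' _ e2.
exists (s1 ++ s2) => s us sub; rewrite big_split /= opprD addrACA.
apply: (le_trans (mdD _ _)).
have h1s : md (\sum_(i <- s) t i - l) <= e / 2.
  by apply: h1 => // x xs; apply: sub; rewrite mem_cat xs.
have h2s : md (\sum_(i <- s) t' i - l') <= e / 2.
  by apply: h2 => // x xs; apply: sub; rewrite mem_cat xs orbT.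
lra.
Qed.

Lemma usum_scale (I : eqType) (t : I -> R[i]) l k :
  usum t l -> usum (fun i => k * t i) (k * l).
Proof.
move=> tl e e0; have k0 := md_ge0 k.
have k1 : 0 < md k + 1 by lra.
have [s0 h0] := tl (e / (md k + 1)) (divr_gt0 e0 k1).
exists s0 => s us sub; rewrite -mulr_sumr -mulrBr mdM.
have h := h0 s us sub; apply: (@le_trans _ _ ((md k + 1) * (e / (md k + 1)))).
  by apply: ler_pM => //; [exact: md_ge0 | lra].
by rewrite mulrC divfK // gt_eqF.
Qed.

Lemma usum_unique (I : eqType) (t : I -> R[i]) l l' :
  usum t l -> usum t l' -> l = l'.
Proof.
move=> tl tl'; apply/eqP; rewrite -subr_eq0; apply/eqP/md_small => e e0.
have e2 : 0 < e / 2 by rewrite divr_gt0.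
have [s1 h1] := tl _ e2; have [s2 h2] := tl' _ e2.
pose s := undup (s1 ++ s2).
have h1s : md (\sum_(i <- s) t i - l) <= e / 2.
  by apply: h1; rewrite ?undup_uniq// => x xs; rewrite mem_undup mem_cat xs.
have h2s : md (\sum_(i <- s) t i - l') <= e / 2.
  by apply: h2; rewrite ?undup_uniq// => x xs; rewrite mem_undup mem_cat xs orbT.
apply: (le_trans (md_trans (\sum_(i <- s) t i) _ _)).
by rewrite mdB; lra.
Qed.

Lemma usum_ext (I : eqType) (t t' : I -> R[i]) l : t =1 t' ->
  usum t l -> usum t' l.
Proof.
move=> tt' tl e e0; have [s0 h0] := tl e e0; exists s0 => s us sub.
by under eq_bigr do rewrite -tt'; exact: h0.
Qed.

Lemma usum_md (I : eqType) (t : I -> R[i]) l B :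
  bsum (fun i => md (t i)) B -> usum t l -> md l <= B.
Proof.
move=> tB tl; rewrite -subr_le0; apply/ler_addgt0Pr => e e0.
have [s0 h0] := tl e e0.
have hs : md (\sum_(i <- undup s0) t i - l) <= e.
  by apply: h0; rewrite ?undup_uniq// => x xs; rewrite mem_undup.
have := md_trans (\sum_(i <- undup s0) t i) l 0.
rewrite !subr0 mdB => h.
have := le_trans (md_sum _ _ _) (tB (undup s0) (undup_uniq _)).
by move: hs h; move: (md _) (md _) (md _) => a b c; lra.
Qed.

Lemma usum_conj (I : eqType) (t : I -> R[i]) l : usum t l ->
  usum (fun i => (t i)^*) l^*.
Proof.
move=> tl e e0; have [s0 h0] := tl e e0; exists s0 => s us sub.
by rewrite -rmorph_sum -rmorphB md_conj; exact: h0.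
Qed.

Lemma usum0 (I : eqType) (t : I -> R[i]) : (forall i, t i = 0) -> usum t 0.
Proof.
by move=> t0 e e0; exists [::] => s _ _; rewrite big1// subrr md0 ltW.
Qed.

Lemma usum_single (I : eqType) (t : I -> R[i]) i0 :
  (forall i, i != i0 -> t i = 0) -> usum t (t i0).
Proof.
move=> t0 e e0; exists [:: i0] => s us sub.
have i0s : i0 \in s by apply: sub; rewrite mem_seq1.
by rewrite (bigD1_seq i0)//= big1 ?addr0 ?subrr ?md0 ?ltW.
Qed.

Lemma bsum_single (I : eqType) (p : I -> R) i0 B : 0 <= B -> p i0 <= B ->
  (forall i, i != i0 -> p i = 0) -> bsum p B.
Proof.
move=> B0 pB p0 s us; have [i0s|i0s] := boolP (i0 \in s).
  by rewrite (bigD1_seq i0)//= big1 ?addr0.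
rewrite big_seq big1 // => i is_; apply: p0.
by apply: contraNneq i0s => <-.
Qed.

Lemma usum_nonneg (I : eqType) (p : I -> R) B : (forall i, 0 <= p i) ->
  bsum p B -> exists l : R, usum (fun i => ((p i)%:C)%C) (l%:C)%C.
Proof.
move=> p0 pB; pose S := [set x : R | exists2 s, uniq s & x = \sum_(i <- s) p i].
have supS : has_sup S.
  split; first by exists 0, [::]; rewrite ?big_nil.
  by exists B => _ [s us ->]; exact: pB.
exists (sup S) => e e0; have [_ [s0 us0 ->] hs0] := sup_adherent e0 supS.
exists s0 => s us sub; rewrite -rmorph_sum -rmorphB /= md_real.
have le_sup : \sum_(i <- s) p i <= sup S.
  by apply: (ub_le_sup supS.2); exists s.
have le_s : \sum_(i <- s0) p i <= \sum_(i <- s) p i.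
  by rewrite (sum_subset _ us0 us sub) lerDl sumr_ge0.
by rewrite ler_norml; apply/andP; split; lra.
Qed.

(** A complex family is a combination of four nonnegative ones, the positive and
    negative parts of its real and imaginary parts. *)
Lemma usum_exists (I : eqType) (t : I -> R[i]) B :
  bsum (fun i => md (t i)) B -> exists l, usum t l.
Proof.
move=> tB.
have pos (f : R[i] -> R) : (forall z, `|f z| <= md z) ->
    exists l : R, usum (fun i => (((`|f (t i)| + f (t i)) / 2)%:C)%C) (l%:C)%C.
  move=> fm; apply: (@usum_nonneg _ _ B).
    by move=> i; have := ler_norm (- f (t i)); rewrite normrN; lra.
  apply: bsum_le tB => i; have := fm (t i).
  have := ler_norm (f (t i)); lra.
have mRe (z : R[i]) : `|- complex.Re z| <= md z by rewrite normrN md_Re.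
have mIm (z : R[i]) : `|- complex.Im z| <= md z by rewrite normrN md_Im.
have [l1 h1] := pos _ (@md_Re R); have [l2 h2] := pos _ mRe.
have [l3 h3] := pos _ (@md_Im R); have [l4 h4] := pos _ mIm.
have hr := usum_add h1 (usum_scale (-1) h2).
have hi := usum_scale 'i (usum_add h3 (usum_scale (-1) h4)).
exists (l1%:C%C + -1 * l2%:C%C + 'i * (l3%:C%C + -1 * l4%:C%C)).
apply: usum_ext (usum_add hr hi) => i /=; rewrite !normrN.
case: (t i) => a b /=; apply/eqP; rewrite eq_complex /=; apply/andP.
by split; apply/eqP; field.
Qed.

(** Fubini: the sum over a product is obtained by summing the slices. *)
Lemma usum_slices (I J : eqType) (t : I * J -> R[i]) (l : I -> R[i]) L :
  (forall i, usum (fun j => t (i, j)) (l i)) -> usum t L -> usum l L.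
Proof.
move=> tl tL e e0; have e2 : 0 < e / 2 by rewrite divr_gt0.
have [s0 h0] := tL _ e2; exists (map fst s0) => s us sub.
pose d := e / (2 * (size s).+1%:R).
have d0 : 0 < d by rewrite divr_gt0// mulr_gt0.
have [g hg] := choice (fun i => tl i d d0).
pose u i := undup (g i ++ [seq x.2 | x <- s0]).
pose big := [seq (i, j) | i <- s, j <- u i].
have ubig : uniq big.
  apply: allpairs_uniq_dep => //; first by move=> i _; exact: undup_uniq.
  by move=> [i j] [i' j'] _ _ /= [-> ->].
have h1 : md (\sum_(x <- big) t x - L) <= e / 2.
  apply: h0 => // -[i j] ij0; apply/allpairsPdep; exists i, j; split=> //.
    by apply: sub; apply/mapP; exists (i, j).
  by rewrite mem_undup mem_cat; apply/orP; right; apply/mapP; exists (i, j).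
rewrite (le_trans (md_trans (\sum_(x <- big) t x) _ _))//.
suff : md (\sum_(i <- s) l i - \sum_(x <- big) t x) <= e / 2 by lra.
rewrite big_allpairs_dep -sumrB (le_trans (md_sum _ _ _))//.
apply: (@le_trans _ _ (\sum_(i <- s) d)).
  apply: ler_sum => i _; rewrite mdB; apply: hg; rewrite ?undup_uniq// => x xg.
  by rewrite mem_undup mem_cat xg.
rewrite big_const_seq count_predT iter_addr addr0 /d.
rewrite -[_ *+ _]mulr_natr mulrAC ler_pdivrMr ?mulr_gt0//.
rewrite [X in _ <= X](_ : _ = e * (size s).+1%:R); last by field.
by rewrite ler_pM2l// ler_nat.
Qed.

(** Reindexing along an injection h with partial inverse g, the family vanishing
    off the image of h. *)
Section Reindex.
Variables (I J : eqType) (h : J -> I) (g : I -> J) (P : pred I).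
Hypotheses (gK : forall j, g (h j) = j) (hP : forall j, P (h j))
  (hK : forall i, P i -> h (g i) = i).

Lemma big_reindex (V : nmodType) (t : I -> V) s :
  (forall i, ~~ P i -> t i = 0) -> uniq s ->
  exists s', [/\ uniq s', \sum_(i <- s) t i = \sum_(j <- s') t (h j) &
    forall j, h j \in s -> j \in s'].
Proof.
move=> t0 us; exists (map g [seq x <- s | P x]); split.
- rewrite map_inj_in_uniq ?filter_uniq// => x y.
  by rewrite !mem_filter => /andP[Px _] /andP[Py _] /(congr1 h); rewrite !hK.
- rewrite big_map big_filter (bigID P) /= [X in _ + X]big1 ?addr0//.
  by apply: eq_bigr => i Pi; rewrite hK.
- by move=> j js; apply/mapP; exists (h j); rewrite ?gK// mem_filter hP.
Qed.

Lemma usum_reindex (t : I -> R[i]) l : (forall i, ~~ P i -> t i = 0) ->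
  usum (fun j => t (h j)) l -> usum t l.
Proof.
move=> t0 tl e e0; have [s0 h0] := tl e e0; exists (map h s0) => s us sub.
have [s' [us' -> s's]] := big_reindex t0 us; apply: h0 => // j js.
by apply/s's/sub/map_f.
Qed.

Lemma usum_reindexV (t : I -> R[i]) l : (forall i, ~~ P i -> t i = 0) ->
  usum t l -> usum (fun j => t (h j)) l.
Proof.
move=> t0 tl e e0; have [s0 h0] := tl e e0.
exists (map g s0) => s us sub.
have uh : uniq (map h s) by rewrite map_inj_uniq//; exact: can_inj gK.
have := h0 (undup (map h s ++ s0)) (undup_uniq _).
rewrite (@sum_subset _ _ _ (map h s)) ?undup_uniq//; last first.
  by move=> x xs; rewrite mem_undup mem_cat xs.
set rest := (\sum_(i <- undup _ | _) t i).
suff -> : rest = 0.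
  by rewrite addr0 big_map; apply=> x xs; rewrite mem_undup mem_cat xs orbT.
rewrite /rest big1_seq//= => i /andP[/= ins]; rewrite mem_undup mem_cat (negbTE ins)/= => is0.
apply: t0; apply: contra ins => Pi; apply/mapP; exists (g i); rewrite ?hK//.
exact/sub/map_f.
Qed.

Lemma bsum_reindex (p : I -> R) B : (forall i, ~~ P i -> p i = 0) ->
  bsum (fun j => p (h j)) B -> bsum p B.
Proof.
by move=> p0 pB s us; have [s' [us' -> _]] := big_reindex p0 us; exact: pB.
Qed.

Lemma bsum_reindexV (p : I -> R) B : bsum p B -> bsum (fun j => p (h j)) B.
Proof.
move=> pB s us; rewrite -(big_map h predT); apply: pB.
by rewrite map_inj_uniq//; exact: can_inj gK.
Qed.
End Reindex.
End UnorderedSums.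

Section FiniteFamilies.
Variable R : realType.

Lemma usum_fin (I : finType) (t : I -> R[i]) : usum t (\sum_i t i).
Proof.
move=> e e0; exists (enum I) => s us sub.
rewrite (perm_big (enum I)) /=; last first.
  by apply: uniq_perm; rewrite ?enum_uniq// => x; rewrite mem_enum sub ?mem_enum.
by rewrite big_enum subrr md0 ltW.
Qed.

Lemma bsum_fin (I : finType) (p : I -> R) : (forall i, 0 <= p i) ->
  bsum p (\sum_i p i).
Proof.
move=> p0 s us.
have -> : \sum_i p i = \sum_(i <- enum I) p i by rewrite big_enum.
rewrite (@sum_subset _ _ p s (enum I)) ?enum_uniq//; first by rewrite lerDl sumr_ge0.
by move=> x _; rewrite mem_enum.
Qed.

Lemma usum_big (I : eqType) (J : Type) (s : seq J) (t : J -> I -> R[i]) (l : J -> R[i]) :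
  (forall j, usum (t j) (l j)) ->
  usum (fun i => \sum_(j <- s) t j i) (\sum_(j <- s) l j).
Proof.
move=> tl; elim: s => [|j s IH].
  rewrite big_nil => e e0; exists [::] => s _ _.
  by rewrite big1 ?subrr ?md0 ?ltW// => i _; rewrite big_nil.
rewrite big_cons; apply: usum_ext (usum_add (tl j) IH) => i.
by rewrite big_cons.
Qed.

(** Converse direction of Fubini for nonnegative families: a finite set of pairs
    is cut into its slices. *)
Lemma bsum_pairs (I J : eqType) (p : I * J -> R) (b : I -> R) B :
  (forall x, 0 <= p x) -> (forall i, bsum (fun j => p (i, j)) (b i)) ->
  bsum b B -> bsum p B.
Proof.
move=> p0 pb bB s us; pose I0 := undup (map fst s).
apply: le_trans (bB I0 (undup_uniq _)).
have -> : \sum_(x <- s) p x = \sum_(x <- s) \sum_(i <- I0 | i == x.1) p x.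
  rewrite big_seq [RHS]big_seq; apply: eq_bigr => x xs.
  rewrite -big_filter filter_pred1_uniq ?undup_uniq ?big_seq1//.
  by rewrite mem_undup; apply/mapP; exists x.
under eq_bigr do rewrite big_mkcond.
rewrite exchange_big; apply: ler_sum => i _.
rewrite -big_mkcond -big_filter.
have -> : \sum_(x <- [seq x <- s | i == x.1]) p x =
    \sum_(j <- [seq x.2 | x <- s & i == x.1]) p (i, j).
  rewrite big_map big_seq [RHS]big_seq; apply: eq_bigr => -[i' j].
  by rewrite mem_filter /= => /andP[/eqP -> _].
apply: pb; rewrite map_inj_in_uniq ?filter_uniq// => -[a b'] [c d'].
by rewrite !mem_filter /= => /andP[/eqP <- _] /andP[/eqP <- _] ->.
Qed.

Lemma bsum_scale (I : eqType) (p : I -> R) B k : 0 <= k -> bsum p B ->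
  bsum (fun i => k * p i) (k * B).
Proof.
by move=> k0 pB s us; rewrite -mulr_sumr ler_wpM2l//; exact: pB.
Qed.

End FiniteFamilies.

(** * Power series on closed polydiscs *)

Section PowerSeriesNorm.
Variable R : realType.
Local Notation C := R[i].

Definition cball n (r : R) (x : 'rV[C]_n) : Prop := forall i, md (x 0 i) <= r.

(** f is the sum, on the closed polydisc of radius r, of a power series with
    monomials of degree at least d only, whose coefficients have weighted l1 norm
    at most B.  Keeping the bound B explicit makes products and substitutions
    estimable, and the order d is what the remainder estimates are about. *)
Definition ps n (d : nat) (r B : R) (f : 'rV[C]_n -> C) : Prop :=
  0 < r /\ exists c : {ffun 'I_n -> nat} -> C,
  [/\ bsum (fun a => md (c a) * r ^+ degree a) B,
      (forall a, c a != 0 -> (d <= degree a)%N) &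
      forall x, cball r x -> usum (fun a => c a * monomial a x) (f x)].

Lemma md_monomial n (a : {ffun 'I_n -> nat}) r (x : 'rV[C]_n) :
  cball r x -> md (monomial a x) <= r ^+ degree a.
Proof.
move=> xr; rewrite /monomial md_prod /degree -prodrXr; apply: ler_prod => i _.
by rewrite mdX exprn_ge0 ?md_ge0//= lerXn2r ?nnegrE ?md_ge0 ?(le_trans _ (xr i)) ?md_ge0.
Qed.

Lemma cballW n r r' (x : 'rV[C]_n) : r <= r' -> cball r x -> cball r' x.
Proof. by move=> rr xr i; exact: le_trans (xr i) rr. Qed.

Lemma ps_bound n d r B f (x : 'rV[C]_n) : ps d r B f -> cball r x -> md (f x) <= B.
Proof.
move=> [r0 [c [cB _ cf]]] xr; apply: usum_md (cf x xr).
apply: bsum_le cB => a; rewrite mdM ler_wpM2l ?md_ge0//; exact: md_monomial.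
Qed.

Lemma ps_ge0 n d r B f : @ps n d r B f -> 0 <= B.
Proof. by case=> _ [c [/bsum_ge0]]. Qed.

Lemma ps_gt0 n d r B f : @ps n d r B f -> 0 < r.
Proof. by case. Qed.

Lemma ps_ext n d r B f g : (forall x, cball r x -> f x = g x) ->
  @ps n d r B f -> ps d r B g.
Proof.
move=> fg [r0 [c [cB cd cf]]]; split=> //; exists c; split=> // x xr.
by rewrite -fg//; exact: cf.
Qed.

Lemma ps_weak n d d' r B B' f : (d' <= d)%N -> B <= B' ->
  @ps n d r B f -> ps d' r B' f.
Proof.
move=> dd BB [r0 [c [cB cd cf]]]; split=> //; exists c; split=> //.
- by move=> s us; apply: le_trans (cB s us) BB.
- by move=> a /cd; exact: leq_trans.
Qed.

(** Shrinking the radius gains the factor given by the order of vanishing. *)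
Lemma ps_shrink n d r r' B f : 0 < r' -> r' <= r ->
  @ps n d r B f -> ps d r' ((r' / r) ^+ d * B) f.
Proof.
move=> r'0 r'r [r0 [c [cB cd cf]]]; split=> //; exists c; split=> //; last first.
  by move=> x xr; apply/cf/(cballW r'r).
have q0 : 0 <= r' / r by rewrite divr_ge0// ltW.
have q1 : r' / r <= 1 by rewrite ler_pdivrMr// mul1r.
apply: bsum_le (bsum_scale (exprn_ge0 d q0) cB) => a.
have [->|/cd da] := eqVneq (c a) 0; first by rewrite md0 !mul0r mulr0.
rewrite mulrCA ler_wpM2l ?md_ge0//.
have -> : r' ^+ degree a = (r' / r) ^+ degree a * r ^+ degree a.
  by rewrite -exprMn divfK// gt_eqF.
by rewrite ler_wpM2r ?exprn_ge0 ?(ltW r0)//; exact: ler_wiXn2l.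
Qed.

Lemma ps_radius n d r r' B f : 0 < r' -> r' <= r ->
  @ps n d r B f -> ps d r' B f.
Proof.
move=> r'0 r'r pf; have := ps_shrink r'0 r'r pf.
apply: ps_weak => //; have B0 := ps_ge0 pf; have r0 := ps_gt0 pf.
rewrite ler_piMl// exprn_ile1//; first by rewrite divr_ge0 ?ltW.
by rewrite ler_pdivrMr// mul1r.
Qed.

(** A normally summable family of power series sums to a power series: the
    coefficients add up by Fubini. *)
Lemma ps_family n (I : eqType) d r (b : I -> R) B (f : I -> 'rV[C]_n -> C) F :
  0 < r -> (forall i, ps d r (b i) (f i)) -> bsum b B ->
  (forall x, cball r x -> usum (fun i => f i x) (F x)) -> ps d r B F.
Proof.
move=> r0 pf bB fF; split=> //.
have [c hc] := choice (fun i => (pf i).2).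
have coefB a : bsum (fun i => md (c i a)) (B / r ^+ degree a).
  move=> s us; rewrite ler_pdivlMr ?exprn_gt0// mulr_suml.
  apply: le_trans (bB s us); apply: ler_sum => i _.
  by have [cB _ _] := hc i; exact: bsum1 cB.
have [k hk] := choice (fun a => usum_exists (coefB a)).
exists k; split.
(* Unimodular factors u a turn the finite sum of the moduli of the coefficients
   into the modulus of one unordered sum over I, bounded termwise. *)
- move=> s us.
  pose u a : C := (md (k a))%:C%C / k a.
  have uk a : u a * k a = (md (k a))%:C%C.
    rewrite /u; have [->|k0] := eqVneq (k a) 0; first by rewrite md0 mulr0.
    by rewrite divfK.
  have u1 a : md (u a) <= 1.
    rewrite /u mdM mdV md_real ger0_norm ?md_ge0//.
    have [->|k0] := eqVneq (md (k a)) 0; first by rewrite mul0r.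
    by rewrite divff.
  clearbody u; have us_ := @usum_big R I _ s (fun a i => u a * (r ^+ degree a)%:C%C * c i a) _
    (fun a => usum_scale (u a * (r ^+ degree a)%:C%C) (hk a)).
  have := usum_md (B := B) _ us_.
  rewrite (_ : \sum_(j <- s) _ = (\sum_(a <- s) md (k a) * r ^+ degree a)%:C%C).
    rewrite md_real; move=> H; apply: le_trans (ler_norm _) (H _) => {H}.
    apply: bsum_le bB => i; have [cB _ _] := hc i.
    apply: le_trans (cB s us); apply: le_trans (md_sum _ _ _) _.
    apply: ler_sum => a _; rewrite !mdM md_real ger0_norm ?exprn_ge0 ?(ltW r0)//.
    have rp : 0 <= r ^+ degree a by rewrite exprn_ge0 ?ltW.
    by rewrite mulrC ler_wpM2l ?md_ge0// ler_piMl.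
  rewrite rmorph_sum /=; apply: eq_bigr => a _.
  by rewrite rmorphM /= -uk mulrAC.
- move=> a; apply: contraNT => ad; apply/eqP/(usum_unique (hk a)).
  apply: usum0 => i; have [_ cd _] := hc i; apply/eqP.
  by apply: contraNT ad => /cd.
- move=> x xr; pose T (y : I * {ffun 'I_n -> nat}) := c y.1 y.2 * monomial y.2 x.
  have TB : bsum (fun y => md (T y)) B.
    apply: bsum_pairs bB => [y|i]; first exact: md_ge0.
    have [cB _ _] := hc i; apply: bsum_le cB => a.
    by rewrite /T mdM ler_wpM2l ?md_ge0//; exact: md_monomial.
  have [L TL] := usum_exists TB.
  have <- : L = F x.
    apply: usum_unique (fF x xr); apply: usum_slices TL => i.
    by have [_ _] := hc i; exact.
  pose T' (y : {ffun 'I_n -> nat} * I) := T (y.2, y.1).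
  apply: (@usum_slices _ _ _ T'); last first.
    pose sw (y : {ffun 'I_n -> nat} * I) := (y.2, y.1).
    pose ws (y : I * {ffun 'I_n -> nat}) := (y.2, y.1).
    by apply: (usum_reindexV (h := sw) (g := ws) (P := predT) _ _ _ TL) => // -[].
  move=> a; rewrite mulrC.
  apply: usum_ext (usum_scale (monomial a x) (hk a)) => i.
  by rewrite mulrC.
Qed.
End PowerSeriesNorm.

Section PowerSeriesAlgebra.
Variable R : realType.
Local Notation C := R[i].
Implicit Types n d : nat.

Lemma ps_zero n d r : 0 < r -> ps d r 0 (fun _ : 'rV[C]_n => 0).
Proof.
move=> r0; split=> //; exists (fun=> 0); split.
- by move=> s us; rewrite big1// => a _; rewrite md0 mul0r.
- by move=> a; rewrite eqxx.
- by move=> x _; apply: usum0 => a; rewrite mul0r.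
Qed.

Lemma ps_const n r (k : C) : 0 < r -> ps 0 r (md k) (fun _ : 'rV[C]_n => k).
Proof.
move=> r0; pose o : {ffun 'I_n -> nat} := [ffun=> 0%N].
have o0 : degree o = 0%N by rewrite /degree big1// => i _; rewrite ffunE.
split=> //; exists (fun a => if a == o then k else 0); split=> //.
- apply: (@bsum_single _ _ _ o); first exact: md_ge0.
    by rewrite eqxx o0 expr0 mulr1.
  by move=> a /negbTE ->; rewrite md0 mul0r.
- move=> x _; have := @usum_single R _
    (fun a => (if a == o then k else 0) * monomial a x) o.
  rewrite eqxx (_ : monomial o x = 1) ?mulr1; last first.
    by rewrite /monomial big1// => i _; rewrite ffunE expr0.
  by apply=> a /negbTE ->; rewrite mul0r.
Qed.

Lemma ps_scale n d r B f k : @ps R n d r B f -> ps d r (md k * B) (fun x => k * f x).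
Proof.
move=> [r0 [c [cB cd cf]]]; split=> //; exists (fun a => k * c a); split.
- apply: bsum_le (bsum_scale (md_ge0 k) cB) => a.
  by rewrite mdM mulrA.
- by move=> a kc; apply: cd; apply: contraNneq kc => ->; rewrite mulr0.
- move=> x /cf /(usum_scale k); apply: usum_ext => a; by rewrite mulrA.
Qed.

Lemma ps_sum n (I : finType) d r (b : I -> R) (f : I -> 'rV[C]_n -> C) : 0 < r ->
  (forall i, ps d r (b i) (f i)) -> ps d r (\sum_i b i) (fun x => \sum_i f i x).
Proof.
move=> r0 pf; apply: (ps_family r0 pf); last by move=> x _; exact: usum_fin.
by apply: bsum_fin => i; exact: ps_ge0 (pf i).
Qed.

Lemma ps_add n d r B B' f g : @ps R n d r B f -> ps d r B' g ->
  ps d r (B + B') (fun x => f x + g x).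
Proof.
move=> pf pg; have r0 := ps_gt0 pf.
have := @ps_sum n bool d r (fun b => if b then B else B')
  (fun b => if b then f else g) r0.
by rewrite big_bool /= => h; apply: ps_ext (h _) => [x _|[]//]; rewrite big_bool.
Qed.

Section Shift.
Variables (n : nat) (i : 'I_n).
Definition up1 (a : {ffun 'I_n -> nat}) : {ffun 'I_n -> nat} :=
  [ffun j => (a j + (j == i))%N].
Definition down1 (a : {ffun 'I_n -> nat}) : {ffun 'I_n -> nat} :=
  [ffun j => (a j - (j == i))%N].

Lemma up1K : cancel up1 down1.
Proof. by move=> a; apply/ffunP => j; rewrite !ffunE addnK. Qed.

Lemma up1_gt0 a : (0 < up1 a i)%N.
Proof. by rewrite ffunE eqxx addn1. Qed.

Lemma down1K (a : {ffun 'I_n -> nat}) : (0 < a i)%N -> up1 (down1 a) = a.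
Proof.
move=> a0; apply/ffunP => j; rewrite !ffunE subnK//.
by case: eqP => // ->.
Qed.

Lemma degree_up1 a : degree (up1 a) = (degree a).+1.
Proof.
rewrite /degree -addn1; under eq_bigr do rewrite ffunE.
rewrite big_split /=; congr (_ + _)%N; rewrite (bigD1 i)//= eqxx big1// => j.
by move=> /negbTE ->.
Qed.

Lemma monomial_up1 a (x : 'rV[C]_n) : monomial (up1 a) x = x 0 i * monomial a x.
Proof.
rewrite /monomial (bigD1 i)//= [in RHS](bigD1 i)//= ffunE eqxx addn1 exprS -mulrA.
by congr (_ * (_ * _)); apply: eq_bigr => j /negbTE ji; rewrite ffunE ji addn0.
Qed.
End Shift.

Lemma ps_mulX n d r B f (i : 'I_n) : @ps R n d r B f ->
  ps d.+1 r (r * B) (fun x => x 0 i * f x).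
Proof.
move=> [r0 [c [cB cd cf]]]; split=> //.
pose P (a : {ffun 'I_n -> nat}) := (0 < a i)%N.
pose k a := if P a then c (down1 i a) else 0.
have kup a : k (up1 i a) = c a by rewrite /k /P up1_gt0 up1K.
exists k; split.
- apply: (bsum_reindex (h := up1 i) (g := down1 i) (P := P)) => //.
  + exact: up1K.
  + exact: up1_gt0.
  + exact: down1K.
  + by move=> a /negbTE nPa; rewrite /k nPa md0 mul0r.
  + apply: bsum_le (bsum_scale (ltW r0) cB) => a.
    by rewrite kup degree_up1 exprS mulrCA.
- move=> a; rewrite /k; case: ifP => // Pa; last by rewrite eqxx.
  by rewrite -{2}(down1K Pa) degree_up1 ltnS => /cd.
- move=> x xr; apply: (usum_reindex (h := up1 i) (g := down1 i) (P := P)) => //.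
  + exact: up1K.
  + exact: up1_gt0.
  + exact: down1K.
  + by move=> a /negbTE nPa; rewrite /k nPa mul0r.
  + apply: usum_ext (usum_scale (x 0 i) (cf x xr)) => a.
    by rewrite kup monomial_up1 mulrCA.
Qed.

Lemma ps_mulXn n d r B f (i : 'I_n) k : @ps R n d r B f ->
  ps (k + d) r (r ^+ k * B) (fun x => x 0 i ^+ k * f x).
Proof.
move=> pf; elim: k => [|k IH].
  rewrite expr0 mul1r; apply: ps_ext pf => x _; by rewrite expr0 mul1r.
rewrite exprS -mulrA; apply: ps_ext (ps_mulX i IH) => x _.
by rewrite exprS mulrA.
Qed.

Lemma ps_mul_monomial n d r B f a : @ps R n d r B f ->
  ps (degree a + d) r (r ^+ degree a * B) (fun x => monomial a x * f x).
Proof.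
move=> pf; rewrite /degree /monomial; elim: (index_enum _) => [|i s IH].
  rewrite !big_nil mul1r; apply: ps_ext pf => x _; by rewrite big_nil mul1r.
rewrite !big_cons -addnA exprD -mulrA.
by apply: ps_ext (ps_mulXn i (a i) IH) => x _; rewrite big_cons mulrA.
Qed.

(** Multiplying one series by the monomials of the other reduces products to
    normally summable families. *)
Lemma ps_mul n d d' r B B' f g : @ps R n d r B f -> ps d' r B' g ->
  ps (d + d') r (B * B') (fun x => f x * g x).
Proof.
move=> [r0 [c [cB cd cf]]] pg; have B'0 := ps_ge0 pg.
apply: (ps_family (I := {ffun 'I_n -> nat})
  (b := fun a => B' * (md (c a) * r ^+ degree a))
  (f := fun a x => c a * (monomial a x * g x))) => //.
- move=> a; have [ca|ca] := eqVneq (c a) 0.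
    rewrite ca md0 mul0r mulr0; apply: ps_ext (ps_zero _ _ r0) => x _.
    by rewrite mul0r.
  have h := ps_scale (c a) (ps_mul_monomial a pg).
  apply: ps_weak h; first by rewrite leq_add2r cd.
  by rewrite mulrA mulrC.
- by rewrite mulrC; exact: bsum_scale.
- move=> x xr; rewrite mulrC; apply: usum_ext (usum_scale (g x) (cf x xr)) => a.
  by rewrite mulrC mulrA.
Qed.

Lemma ps_exp n d r B f k : @ps R n d r B f ->
  ps (k * d) r (B ^+ k) (fun x => f x ^+ k).
Proof.
move=> pf; elim: k => [|k IH].
  have := ps_const n 1 (ps_gt0 pf); rewrite md1; apply: ps_ext => x _.
  by rewrite expr0.
by rewrite exprS mulSn; apply: ps_ext (ps_mul pf IH) => x _; rewrite exprS.
Qed.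

(** Substitution: the powers of the inner series have norms dominated by the
    powers of the outer radius. *)
Lemma ps_comp m n d e r r' B f (g : 'rV[C]_m -> 'rV[C]_n) : 0 < r' ->
  ps d r B f -> (forall i, ps e r' r (fun x => g x 0 i)) ->
  ps (e * d) r' B (fun x => f (g x)).
Proof.
move=> r'0 [r0 [c [cB cd cf]]] pg.
have pm a : ps (e * degree a) r' (r ^+ degree a) (fun x => monomial a (g x)).
  rewrite /degree /monomial; elim: (index_enum _) => [|i s IH].
    rewrite !big_nil muln0 expr0; have := ps_const m 1 r'0; rewrite md1.
    by apply: ps_ext => x _; rewrite big_nil.
  rewrite !big_cons mulnDr exprD [(e * a i)%N]mulnC.
  by apply: ps_ext (ps_mul (ps_exp (a i) (pg i)) IH) => x _; rewrite big_cons.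
apply: (ps_family (I := {ffun 'I_n -> nat})
  (b := fun a => md (c a) * r ^+ degree a)
  (f := fun a x => c a * monomial a (g x))) => //.
- move=> a; have [ca|ca] := eqVneq (c a) 0.
    rewrite ca md0 mul0r; apply: ps_ext (ps_zero _ _ r'0) => x _.
    by rewrite mul0r.
  apply: ps_weak (ps_scale (c a) (pm a)) => //.
  by rewrite leq_mul2l cd// orbT.
- by move=> x xr; apply: cf => i; exact: ps_bound (pg i) xr.
Qed.

Definition zero_at n (i : 'I_n) (x : 'rV[C]_n) : 'rV[C]_n :=
  \row_j (if j == i then 0 else x 0 j).

(** f x - f (zero_at i x) collects the terms of f in which the variable i
    occurs, so it is divisible by that variable. *)
Lemma ps_div n d r B f (i : 'I_n) : @ps R n d.+1 r B f ->
  exists2 g, ps d r (B / r) g &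
    forall x, cball r x -> f x - f (zero_at i x) = x 0 i * g x.
Proof.
move=> [r0 [c [cB cd cf]]].
pose P (a : {ffun 'I_n -> nat}) := (0 < a i)%N.
have rn0 : r != 0 by rewrite gt_eqF.
have kB : bsum (fun a => md (c (up1 i a)) * r ^+ degree a) (B / r).
  have h : bsum (fun a => md (c (up1 i a)) * r ^+ degree (up1 i a)) B.
    by apply: (bsum_reindexV (h := up1 i) (g := down1 i) _ cB); exact: up1K.
  rewrite mulrC; apply: bsum_le (bsum_scale _ h); last by rewrite invr_ge0 ltW.
  by move=> a; rewrite degree_up1 exprS mulrCA mulKf.
have gx x : exists y, cball r x -> usum (fun a => c (up1 i a) * monomial a x) y.
  have [xr|nxr] := pselect (cball r x); last by exists 0.
  have [|y hy] := @usum_exists R _ (fun a => c (up1 i a) * monomial a x) (B / r).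
    apply: bsum_le kB => a; rewrite mdM ler_wpM2l ?md_ge0//; exact: md_monomial.
  by exists y.
have [g hg] := choice gx.
exists g.
  split=> //; exists (fun a => c (up1 i a)); split=> // a /cd.
  by rewrite degree_up1.
move=> x xr; have x0r : cball r (zero_at i x).
  by move=> j; rewrite mxE; case: eqP => _ //; rewrite md0 ltW.
apply: usum_unique (usum_scale (x 0 i) (hg x xr)).
have h0 := usum_add (cf x xr) (usum_scale (-1) (cf _ x0r)).
rewrite mulN1r in h0.
pose t a := c a * monomial a x + -1 * (c a * monomial a (zero_at i x)).
have tP a : P a -> t a = c a * monomial a x.
  rewrite /P /t /monomial => Pa; rewrite (bigD1 i _ (F := fun j => zero_at i x 0 j ^+ _))//=.
  by rewrite mxE eqxx expr0n eqn0Ngt Pa !mul0r !mulr0 addr0.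
have t0 a : ~~ P a -> t a = 0.
  rewrite /P -eqn0Ngt /t => /eqP a0; rewrite mulN1r; apply/eqP; rewrite subr_eq0; apply/eqP.
  congr (_ * _); apply: eq_bigr => j _; rewrite mxE.
  by case: eqP => // ->; rewrite a0 !expr0.
have := usum_reindexV (h := up1 i) (g := down1 i) (P := P) (@up1K _ i) (@down1K _ i) t0 h0.
apply: usum_ext => a; rewrite tP ?/P ?up1_gt0// monomial_up1.
by rewrite mulrCA.
Qed.

Lemma ps_conj n d r B f : @ps R n d r B f ->
  ps d r B (fun x => (f (conj_mx x))^*).
Proof.
move=> [r0 [c [cB cd cf]]]; split=> //; exists (fun a => (c a)^*); split.
- by apply: bsum_le cB => a; rewrite md_conj.
- by move=> a; rewrite conjC_eq0; exact: cd.
- move=> x xr; have xr' : cball r (conj_mx x).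
    by move=> i; rewrite mxE md_conj.
  apply: usum_ext (usum_conj (cf _ xr')) => a.
  rewrite rmorphM /monomial rmorph_prod; congr (_ * _); apply: eq_bigr => i _.
  by rewrite rmorphXn mxE /= conjCK.
Qed.

Lemma ps_coord n r (i : 'I_n) : 0 < r -> ps 1 r r (fun x : 'rV[C]_n => x 0 i).
Proof.
move=> r0; have := ps_mulX i (ps_const n 1 r0); rewrite md1 mulr1.
by apply: ps_ext => x _; rewrite mulr1.
Qed.

(** The coordinates of p + x have norm at most |p_i| + s, hence at most r. *)
Lemma ps_recenter n d r s B f (p : 'rV[C]_n) : @ps R n d r B f ->
  0 < s -> cball (r - s) p -> ps 0 s B (fun x => f (p + x)).
Proof.
move=> pf s0 pr; apply: (@ps_comp _ _ d 0 r) => // i.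
have h : ps 0 s (md (p 0 i) + s) (fun x : 'rV[C]_n => p 0 i + x 0 i).
  apply: ps_add; first exact: ps_const.
  exact: ps_weak (ps_coord i s0).
apply: ps_weak (leqnn 0) _ (ps_ext _ h) => [|x _]; last by rewrite mxE.
by have := pr i; lra.
Qed.

(** Removing the constant term from a series does not increase its norm. *)
Lemma ps_sub0 n r B f : @ps R n 0 r B f -> ps 1 r B (fun x => f x - f 0).
Proof.
move=> [r0 [c [cB cd cf]]]; split=> //.
pose k (a : {ffun 'I_n -> nat}) := if degree a == 0%N then 0 else c a.
exists k; split.
- apply: bsum_le cB => a; rewrite /k; case: ifP => // _.
  by rewrite md0 mul0r mulr_ge0 ?md_ge0 ?exprn_ge0 ?ltW.
- by move=> a; rewrite /k lt0n; case: (degree a == 0%N); rewrite ?eqxx.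
- move=> x xr; have zr : cball r (0 : 'rV[C]_n) by move=> i; rewrite mxE md0 ltW.
  have := usum_add (cf x xr) (usum_scale (-1) (cf _ zr)); rewrite mulN1r.
  apply: usum_ext => a; rewrite /k; have [a0|a0] := eqVneq (degree a) 0%N.
    have {}a0 i : a i = 0%N.
      by apply/eqP; move/eqP: a0; rewrite /degree sum_nat_eq0 => /forallP/(_ i).
    rewrite mul0r mulN1r; apply/eqP; rewrite subr_eq0; apply/eqP; congr (_ * _).
    by apply: eq_bigr => i _; rewrite a0 !expr0.
  have [i ai] : exists i, a i != 0%N.
    apply/existsP; move: a0; apply: contraNT; rewrite negb_exists => /forallP h.
    by rewrite /degree sum_nat_eq0; apply/forallP => i; move: (h i); rewrite negbK.
  rewrite [monomial a 0](bigD1 i)//= mxE expr0n (negbTE ai) mul0r !mulr0.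
  by rewrite addr0.
Qed.
End PowerSeriesAlgebra.

(** * Germs at 0 and the implicit function theorem *)

Section Germs.
Variable R : realType.
Local Notation C := R[i].
Implicit Types n d : nat.

(** The neighbourhoods of 0, described by closed polydiscs, on which the series
    are controlled. *)
Definition nb0 n : set_system 'rV[C]_n :=
  [set P | exists r : R, 0 < r /\ forall x, cball r x -> P x].
Arguments nb0 : clear implicits.

#[global] Instance nb0_filter n : ProperFilter (nb0 n).
Proof.
split; first by move=> [r [r0 /(_ 0)]]; apply=> i; rewrite mxE md0 ltW.
split.
- by exists 1; split.
- move=> P Q [r [r0 hP]] [s [s0 hQ]]; exists (Num.min r s); split.
    by rewrite lt_min r0.
  by move=> x xr; split; [apply: hP|apply: hQ];
    apply: cballW xr; rewrite ge_min lexx ?orbT.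
- by move=> P Q PQ [r [r0 hP]]; exists r; split=> // x /hP /PQ.
Qed.

(** Germs at 0 of order at least d: the radius and the norm are forgotten, so that
    germs form a filtered algebra closed under substitution of germs of order 1. *)
Definition an n d (f : 'rV[C]_n -> C) : Prop := exists r B, ps d r B f.

Lemma ps_an n d r B f : @ps R n d r B f -> an d f.
Proof. by exists r, B. Qed.

Lemma an_ext n d f g : @an n d f -> (\forall x \near nb0 n, f x = g x) -> an d g.
Proof.
move=> [r [B pf]] [s [s0 fg]]; have r0 := ps_gt0 pf.
exists (Num.min r s), B; apply: ps_ext (ps_radius _ _ pf).
- by move=> x xr; apply: fg; apply: cballW xr; rewrite ge_min lexx orbT.
- by rewrite lt_min r0.
- by rewrite ge_min lexx.
Qed.

Lemma an_eq n d f g : f =1 g -> @an n d f -> an d g.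
Proof. by move=> fg [r [B pf]]; exists r, B; apply: ps_ext pf. Qed.

Lemma an_weak n d d' f : (d' <= d)%N -> @an n d f -> an d' f.
Proof. by move=> dd [r [B pf]]; exists r, B; exact: ps_weak dd _ pf. Qed.

Lemma an_ps_common n d d' f g : @an n d f -> @an n d' g ->
  exists r B B', ps d r B f /\ ps d' r B' g.
Proof.
move=> [r [B pf]] [s [B' pg]]; have r0 := ps_gt0 pf; have s0 := ps_gt0 pg.
have m0 : 0 < Num.min r s by rewrite lt_min r0.
exists (Num.min r s), B, B'; split.
  by apply: ps_radius pf => //; rewrite ge_min lexx.
by apply: ps_radius pg => //; rewrite ge_min lexx orbT.
Qed.

Lemma an_add n d f g : @an n d f -> an d g -> an d (fun x => f x + g x).
Proof.
move=> af ag; have [r [B [B' [pf pg]]]] := an_ps_common af ag.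
by exists r, (B + B'); exact: ps_add.
Qed.

Lemma an_mul n d d' f g : @an n d f -> @an n d' g -> an (d + d') (fun x => f x * g x).
Proof.
move=> af ag; have [r [B [B' [pf pg]]]] := an_ps_common af ag.
by exists r, (B * B'); exact: ps_mul.
Qed.

Lemma an_scale n d f k : @an n d f -> an d (fun x => k * f x).
Proof. by move=> [r [B pf]]; exists r, (md k * B); exact: ps_scale. Qed.

Lemma an_opp n d f : @an n d f -> an d (fun x => - f x).
Proof. by move=> /(an_scale (-1)); apply: an_eq => x; rewrite mulN1r. Qed.

Lemma an_sub n d f g : @an n d f -> an d g -> an d (fun x => f x - g x).
Proof. by move=> af /an_opp; exact: an_add. Qed.

Lemma an_zero n d : an d (fun _ : 'rV[C]_n => 0).
Proof. by exists 1, 0; exact: ps_zero. Qed.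

Lemma an_const n k : an 0 (fun _ : 'rV[C]_n => k).
Proof. by exists 1, (md k); exact: ps_const. Qed.

Lemma an_coord n (i : 'I_n) : an 1 (fun x : 'rV[C]_n => x 0 i).
Proof. by exists 1, 1; exact: ps_coord. Qed.

Lemma an_sum n d (I : Type) (s : seq I) (P : pred I) (f : I -> 'rV[C]_n -> C) :
  (forall i, P i -> an d (f i)) -> an d (fun x => \sum_(i <- s | P i) f i x).
Proof.
move=> af; elim: s => [|i s IH].
  by apply: an_eq (an_zero n d) => x; rewrite big_nil.
have [Pi|nPi] := boolP (P i); last first.
  by apply: an_eq IH => x; rewrite big_cons (negbTE nPi).
by apply: an_eq (an_add (af i Pi) IH) => x; rewrite big_cons Pi.
Qed.

Lemma an_conj n d f : @an n d f -> an d (fun x => (f (conj_mx x))^*).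
Proof. by move=> [r [B pf]]; exists r, B; exact: ps_conj. Qed.

Lemma an_sub0 n f : @an n 0 f -> an 1 (fun x => f x - f 0).
Proof. by move=> [r [B pf]]; exists r, B; exact: ps_sub0. Qed.

Lemma an_div n d f (i : 'I_n) : @an n d.+1 f -> exists2 g, an d g &
  \forall x \near nb0 n, f x - f (zero_at i x) = x 0 i * g x.
Proof.
move=> [r [B pf]]; have [g pg fg] := ps_div i pf.
by exists g; [exact: ps_an pg | exists r; split=> //; exact: ps_gt0 pf].
Qed.

(** By order 1, shrinking the radius from s to r multiplies the norm by r / s. *)
Lemma an_small n f e : @an n 1 f -> 0 < e ->
  exists r0, 0 < r0 /\ forall r, 0 < r -> r <= r0 -> ps 1 r e f.
Proof.
move=> [s [B pf]] e0; have s0 := ps_gt0 pf; have B0 := ps_ge0 pf.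
have B1 : 0 < B + 1 by lra.
pose r0 := Num.min s (e * s / (B + 1)).
have r00 : 0 < r0 by rewrite lt_min s0 /= !(divr_gt0, mulr_gt0).
exists r0; split=> // r rp rr.
have rs : r <= s by rewrite (le_trans rr)// ge_min lexx.
apply: ps_weak (leqnn _) _ (ps_shrink rp rs pf); rewrite expr1.
have : r <= e * s / (B + 1) by rewrite (le_trans rr)// ge_min lexx orbT.
rewrite ler_pdivlMr// => h; rewrite mulrAC ler_pdivrMr//.
by apply: le_trans h; rewrite ler_wpM2l ?(ltW rp)//; lra.
Qed.

Lemma fin_radius (I : finType) (Q : I -> R -> Prop) :
  (forall i, exists r0, 0 < r0 /\ forall r, 0 < r -> r <= r0 -> Q i r) ->
  exists r0, 0 < r0 /\ forall r, 0 < r -> r <= r0 -> forall i, Q i r.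
Proof.
move=> /choice[s hs]; exists (\big[Num.min/1]_i s i); split.
  by apply: lt_bigmin => // i _; case: (hs i).
move=> r r0 rs i; case: (hs i) => _; apply=> //.
by apply: le_trans rs _; exact: bigmin_le.
Qed.

Lemma an_comp m n d f (g : 'rV[C]_m -> 'rV[C]_n) : an d f ->
  (forall i, an 1 (fun x => g x 0 i)) -> an d (fun x => f (g x)).
Proof.
move=> [r [B pf]] ag.
have [s [s0 hs]] := fin_radius (fun i => an_small (ag i) (ps_gt0 pf)).
exists s, B; rewrite -[d]mul1n; apply: ps_comp pf _ => // i.
exact: hs.
Qed.

Lemma near_comp m n (P : set 'rV[C]_n) (g : 'rV[C]_m -> 'rV[C]_n) :
  (forall i, an 1 (fun x => g x 0 i)) -> (\forall x \near nb0 n, P x) ->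
  \forall x \near nb0 m, P (g x).
Proof.
move=> ag [r [r0 hP]].
have [s [s0 hs]] := fin_radius (fun i => an_small (ag i) r0).
exists s; split=> // x xs; apply: hP => i; exact: ps_bound (hs s s0 _ i) xs.
Qed.

Lemma an_near n f e : @an n 1 f -> 0 < e -> \forall x \near nb0 n, md (f x) <= e.
Proof.
move=> af e0; have [s [s0 hs]] := an_small af e0.
by exists s; split=> // x xs; exact: ps_bound (hs s s0 _) xs.
Qed.

Lemma an_bound n d f : @an n d f -> exists K r, [/\ 0 <= K, 0 < r &
  forall s x, 0 < s -> s <= r -> cball s x -> md (f x) <= K * s ^+ d].
Proof.
move=> [r [B pf]]; have r0 := ps_gt0 pf; have B0 := ps_ge0 pf.
exists (B / r ^+ d), r; split=> //; first by rewrite divr_ge0// exprn_ge0 ?ltW.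
move=> s x s0 sr xs; apply: le_trans (ps_bound (ps_shrink s0 sr pf) xs) _.
by rewrite expr_div_n mulrC mulrAC mulrA.
Qed.

Lemma an_at0 n d f : @an n d.+1 f -> f 0 = 0.
Proof.
move=> /(an_weak (ltn0Sn d)) af; apply: md_small => e e0.
have [r [r0]] := an_near af e0; apply=> i; by rewrite mxE md0 ltW.
Qed.

(** Coordinatewise properties, such as being a germ of a given order, pass to
    concatenated rows. *)
Lemma row_mxP k m n (Q : ('rV[C]_k -> C) -> Prop)
    (f : 'rV[C]_k -> 'rV[C]_m) (g : 'rV[C]_k -> 'rV[C]_n) :
  (forall i, Q (fun x => f x 0 i)) -> (forall i, Q (fun x => g x 0 i)) ->
  forall i, Q (fun x => row_mx (f x) (g x) 0 i).
Proof.
move=> hf hg i; case: (split_ordP i) => j ->.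
  by have := hf j; congr Q; apply: funext => x; rewrite row_mxEl.
by have := hg j; congr Q; apply: funext => x; rewrite row_mxEr.
Qed.

Lemma const_mxP k n (Q : ('rV[C]_k -> C) -> Prop) (f : 'rV[C]_k -> C) :
  Q f -> forall i : 'I_n, Q (fun x => (const_mx (f x) : 'rV[C]_n) 0 i).
Proof. by move=> h i; move: h; congr Q; apply: funext => x; rewrite mxE. Qed.

Lemma lsubmxP k m n (Q : ('rV[C]_k -> C) -> Prop) (f : 'rV[C]_k -> 'rV[C]_(m + n)) :
  (forall i, Q (fun x => f x 0 i)) -> forall i, Q (fun x => lsubmx (f x) 0 i).
Proof. by move=> h i; move: (h (lshift n i)); congr Q; apply: funext => x; rewrite mxE. Qed.

Lemma rsubmxP k m n (Q : ('rV[C]_k -> C) -> Prop) (f : 'rV[C]_k -> 'rV[C]_(m + n)) :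
  (forall i, Q (fun x => f x 0 i)) -> forall i, Q (fun x => rsubmx (f x) 0 i).
Proof. by move=> h i; move: (h (rshift m i)); congr Q; apply: funext => x; rewrite mxE. Qed.

Definition snoc n (x : 'rV[C]_n) (y : C) : 'rV[C]_(n + 1) := row_mx x (const_mx y).

Lemma cball_snoc n r (x : 'rV[C]_n) y : cball r x -> md y <= r -> cball r (snoc x y).
Proof.
move=> xr yr i; case: (split_ordP i) => j ->; first by rewrite row_mxEl.
by rewrite row_mxEr mxE.
Qed.

Lemma zero_at_snoc n (x : 'rV[C]_n) y :
  zero_at (rshift n 0) (snoc x y) = snoc x 0.
Proof.
apply/rowP => i; rewrite mxE; case: (split_ordP i) => j ->.
  by rewrite eq_lrshift !row_mxEl.
by rewrite (ord1 j) eqxx row_mxEr mxE.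
Qed.

(** As a germ in (x, y, t), the value E (x, y + t) can be divided with respect to
    t. *)
Lemma an_increment n (E : 'rV[C]_(n + 1) -> C) : an 2 E ->
  exists2 D : 'rV[C]_(n + 1 + 1) -> C, an 1 D &
  exists r : R, 0 < r /\ forall x y t, cball r x -> md y <= r -> md t <= r ->
    E (snoc x (y + t)) - E (snoc x y) = t * D (snoc (snoc x y) t).
Proof.
move=> aE.
pose H (Z : 'rV[C]_(n + 1 + 1)) :=
  E (snoc (lsubmx (lsubmx Z)) (rsubmx (lsubmx Z) 0 0 + rsubmx Z 0 0)).
have aid : forall i, an 1 (fun Z : 'rV[C]_(n + 1 + 1) => Z 0 i) by exact: an_coord.
have aH : an 2 H.
  apply: an_comp aE _; apply: row_mxP.
    exact/(@lsubmxP _ _ _ (an 1))/(@lsubmxP _ _ _ (an 1)).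
  apply: const_mxP; apply: an_add.
    exact/(@rsubmxP _ _ _ (an 1))/(@lsubmxP _ _ _ (an 1)).
  exact/(@rsubmxP _ _ _ (an 1)).
have [D aD [r [r0 hD]]] := an_div (rshift (n + 1) 0) aH.
exists D => //; exists r; split=> // x y t xr yr tr.
have := hD (snoc (snoc x y) t) (cball_snoc (cball_snoc xr yr) tr).
by rewrite zero_at_snoc /H !(row_mxKl, row_mxKr) [in snoc _ _ 0 _]row_mxEr !mxE addr0.
Qed.

Section ImplicitFunction.
Variables (n : nat) (lam : C) (L : 'rV[C]_n -> C) (E : 'rV[C]_(n + 1) -> C).
Hypotheses (lam0 : lam != 0) (aL : an 1 L) (aE : an 2 E).

Let G (x : 'rV[C]_n) (y : C) : C := - lam^-1 * (L x + E (snoc x y)).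

Let iterate (k : nat) (x : 'rV[C]_n) : C := iter k (G x) 0.

(** The solution is the limit of the Picard iterates of y = G x y.  Increments
    of G in y carry a factor that vanishes at 0, hence has small norm on a small
    polydisc, so the iterates converge geometrically. *)
Lemma implicit_function : exists g : 'rV[C]_n -> C,
  [/\ an 1 g, an 2 (fun x => g x + lam^-1 * L x) &
  exists s : R, 0 < s /\ \forall x \near nb0 n,
    lam * g x + L x + E (snoc x (g x)) = 0 /\
    forall y, md y <= s -> lam * y + L x + E (snoc x y) = 0 -> y = g x].
Proof.
have [D aD [r1 [r10 hD]]] := an_increment aE.
have lp : 0 < md lam by rewrite lt_neqAle eq_sym md_eq0 lam0 md_ge0.
(* On the polydisc of radius rho the divided increment D has norm at most half of
   the modulus of lam, so G contracts by 1/2 in y; on the smaller radius s the first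
   iterate is at most rho / 4, so all iterates stay below rho / 2. *)
have [r2 [r20 hr2]] := an_small aD (divr_gt0 lp (ltr0n R 2)).
pose rho := Num.min r1 r2.
have rho0 : 0 < rho by rewrite lt_min r10.
have rho1 : rho <= r1 by rewrite ge_min lexx.
have pD : ps 1 rho (md lam / 2) D by apply: hr2 => //; rewrite ge_min lexx orbT.
have asnoc (h : 'rV[C]_n -> C) : an 1 h -> an 2 (fun x => E (snoc x (h x))).
  move=> ah; apply: an_comp aE _; apply: row_mxP; first exact: an_coord.
  exact: const_mxP.
have aG0 : an 1 (fun x => G x 0).
  apply/an_scale/an_add => //; apply: an_weak (asnoc _ (an_zero _ 1)) => //.
have [s0 [s00 hs0]] := an_small aG0 (divr_gt0 rho0 (ltr0n R 4)).
pose s := Num.min s0 rho.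
have sp : 0 < s by rewrite lt_min s00.
have sr : s <= rho by rewrite ge_min lexx orbT.
have pG0 : ps 1 s (rho / 4) (fun x => G x 0) by apply: hs0; rewrite ?ge_min ?lexx.
have Gdiff x y t : cball s x -> md y <= rho -> md t <= rho ->
    G x (y + t) - G x y = - lam^-1 * (t * D (snoc (snoc x y) t)).
  move=> xs yr tr; rewrite -hD; first by rewrite /G -mulrBr opprD addrACA subrr add0r.
  - by apply: cballW xs; apply: le_trans sr rho1.
  - exact: le_trans yr rho1.
  - exact: le_trans tr rho1.
have pstep k : ps 1 s (rho / 4 * 2^-1 ^+ k) (fun x => iterate k.+1 x - iterate k x)
    /\ ps 1 s (rho / 2 * (1 - 2^-1 ^+ k)) (iterate k).
  have half k' : 0 <= (2^-1 : R) ^+ k' <= 1.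
    by rewrite exprn_ge0 ?invr_ge0//= exprn_ile1 ?invr_ge0// invf_le1// ler1n.
  elim: k => [|k [IHd IHs]].
    rewrite !expr0 mulr1 subrr mulr0; split; last exact: ps_zero.
    by apply: ps_ext pG0 => x _; rewrite /iterate /= subr0.
  have IHs' : ps 1 s (rho / 2 * (1 - 2^-1 ^+ k.+1)) (iterate k.+1).
    have := ps_add IHs IHd.
    rewrite (_ : _ + _ = rho / 2 * (1 - 2^-1 ^+ k.+1)); last by rewrite exprS; field.
    by apply: ps_ext => x _; rewrite addrC subrK.
  split=> //; have /andP[k0 k1] := half k.
  have IHs2 : ps 1 s rho (iterate k).
    apply: ps_weak IHs => //; have : rho * (2^-1 ^+ k) >= 0 by rewrite mulr_ge0// ltW.
    lra.
  have IHd2 : ps 1 s rho (fun x => iterate k.+1 x - iterate k x).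
    apply: ps_weak IHd => //; have : rho * (2^-1 ^+ k) <= rho by rewrite ler_piMr// ltW.
    lra.
  have pDk : ps 1 s (md lam / 2) (fun x =>
      D (snoc (snoc x (iterate k x)) (iterate k.+1 x - iterate k x))).
    rewrite -[X in ps X]mul1n; apply: ps_comp pD _ => //.
    apply: row_mxP; last exact: const_mxP.
    apply: row_mxP; last exact: const_mxP.
    by move=> i; apply: ps_weak (ps_coord i sp).
  have := ps_scale (- lam^-1) (ps_mul IHd pDk).
  rewrite mdN mdV [X in ps _ _ X _](_ : _ = rho / 4 * 2^-1 ^+ k.+1); last first.
    by rewrite exprS; field; rewrite gt_eqF.
  move=> h; apply: ps_weak (_ : (1 <= 1 + 1)%N) (lexx _) _ => //.
  apply: ps_ext h => x xs.
  have := Gdiff x _ _ xs (ps_bound IHs2 xs) (ps_bound IHd2 xs).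
  by rewrite [iterate k x + _]addrC subrK => <-.
have half0 k : 0 <= (2^-1 : R) ^+ k by rewrite exprn_ge0 ?invr_ge0.
have geom : bsum (fun k => rho / 4 * 2^-1 ^+ k) (rho / 2).
  have geomN N : \sum_(k <- iota 0 N) rho / 4 * 2^-1 ^+ k = rho / 2 * (1 - 2^-1 ^+ N).
    elim: N => [|N IH]; first by rewrite big_nil expr0 subrr mulr0.
    rewrite -addn1 iotaD big_cat IH big_seq1 add0n addn1 exprS /=; by field.
  move=> u uu; pose N := (\max_(k <- u) k).+1.
  have uN : {subset u <= iota 0 N}.
    by move=> k ku; rewrite mem_iota /= add0n ltnS; exact: leq_bigmax_seq.
  have := geomN N; rewrite (sum_subset _ uu (iota_uniq _ _) uN).
  set rest := \sum_(k <- iota 0 N | _) _.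
  have : 0 <= rest by apply: sumr_ge0 => k _; rewrite mulr_ge0// divr_ge0// ltW.
  have : 0 <= rho * 2^-1 ^+ N by rewrite mulr_ge0// ltW.
  by lra.
have gx x : exists y, cball s x -> usum (fun k => iterate k.+1 x - iterate k x) y.
  have [xs|] := pselect (cball s x); last by exists 0.
  have [|y hy] := @usum_exists R _ (fun k => iterate k.+1 x - iterate k x) (rho / 2).
    by apply: bsum_le geom => k; apply: ps_bound (pstep k).1 xs.
  by exists y.
have [g hg] := choice gx.
have pg : ps 1 s (rho / 2) g by apply: (ps_family sp (fun k => (pstep k).1) geom).
have ag : an 1 g by exact: ps_an pg.
have glim x e : cball s x -> 0 < e -> exists K, forall k, (K <= k)%N ->
    md (iterate k x - g x) <= e.
  move=> xs e0; have [u hu] := hg x xs e e0.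
  exists (\max_(k <- u) k).+1 => k Kk.
  have := hu (iota 0 k) (iota_uniq _ _).
  rewrite -{2}(subn0 k) telescope_sumr// subr0; apply=> j ju.
  by rewrite mem_iota /= add0n (leq_trans _ Kk)// ltnS; exact: leq_bigmax_seq.
have contr x y y' : cball s x -> md y <= rho / 2 -> md y' <= rho / 2 ->
    md (G x y - G x y') <= md (y - y') / 2.
  move=> xs yr yr'; have yy : md (y - y') <= rho.
    by apply: le_trans (mdD _ _) _; rewrite mdN; lra.
  have yr2 : md y' <= rho by lra.
  have -> : y = y' + (y - y') by rewrite addrC subrK.
  rewrite Gdiff// addrAC subrr add0r !mdM mdN mdV mulrCA ler_wpM2l ?md_ge0//.
  rewrite mulrC ler_pdivrMr//.
  have xr : cball rho x by exact: cballW xs.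
  have := ps_bound pD (cball_snoc (cball_snoc xr yr2) yy); lra.
have iterB k x : cball s x -> md (iterate k x) <= rho / 2.
  move=> xs; apply: le_trans (ps_bound (pstep k).2 xs) _.
  have := half0 k; have := mulr_ge0 (ltW rho0) (half0 k); lra.
have gfix x : cball s x -> g x = G x (g x).
  move=> xs; apply/eqP; rewrite -subr_eq0; apply/eqP/md_small => e e0.
  have gB := ps_bound pg xs.
  have [K hK] := glim x (e / 2) xs (divr_gt0 e0 (ltr0n R 2)).
  have h1 := hK K.+1 (leqnSn K); have h2 := hK K (leqnn K).
  have h3 := contr x _ _ xs (iterB K x xs) gB.
  have := md_trans (iterate K.+1 x) (g x) (G x (g x)).
  rewrite mdB in h1; rewrite -[G x (iterate K x)]/(iterate K.+1 x) in h3.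
  by lra.
have GP x y : lam * y + L x + E (snoc x y) = 0 <-> y = G x y.
  rewrite /G; split=> h.
    have -> : L x + E (snoc x y) = - (lam * y) by apply/eqP; rewrite -addr_eq0 addrC addrA h.
    by rewrite mulNr mulrN opprK mulKf.
  by rewrite {1}h mulNr mulrN mulVKf// -addrA addNr.
exists g; split=> //.
- apply: an_ext (an_scale (- lam^-1) (asnoc g ag)) _.
  exists s; split=> // x xs; rewrite {2}gfix // /G mulrDr.
  by rewrite [X in X + _ + _]mulNr addrAC addNr add0r.
- exists (rho / 2); split; first by rewrite divr_gt0.
  exists s; split=> // x xs; split; first by apply/GP/gfix.
  move=> y yr /GP hy; apply/eqP; rewrite -subr_eq0; apply/eqP/md_small => e e0.
  have := contr x _ _ xs yr (ps_bound pg xs); rewrite -hy -gfix//.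
  have := md_ge0 (y - g x); lra.
Qed.
End ImplicitFunction.

End Germs.
Arguments nb0 : clear implicits.

(** * Unordered sums and limits of partial sums *)

Section SumsOfSeries.
Variable R : realType.
Local Notation C := R[i].
Implicit Types n d : nat.

(** Partial sums over cubes of exponents are finite subsums of the unordered sum,
    and the cubes exhaust the exponents. *)
Definition cube_index n N (a : {ffun 'I_n -> 'I_N}) : {ffun 'I_n -> nat} :=
  [ffun i => nat_of_ord (a i)].

Lemma cube_index_inj n N : injective (@cube_index n N).
Proof.
move=> a b /ffunP ab; apply/ffunP => i; apply: val_inj.
by have := ab i; rewrite !ffunE.
Qed.

Definition cube n N : seq {ffun 'I_n -> nat} :=
  [seq cube_index a | a <- enum {: {ffun 'I_n -> 'I_N}}].

Lemma cube_uniq n N : uniq (cube n N).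
Proof. by rewrite map_inj_uniq ?enum_uniq//; exact: cube_index_inj. Qed.

Lemma mem_cube n N (a : {ffun 'I_n -> nat}) : (forall i, (a i < N)%N) -> a \in cube n N.
Proof.
move=> aN; apply/mapP; exists [ffun i => Ordinal (aN i)]; first by rewrite mem_enum.
by apply/ffunP => i; rewrite !ffunE.
Qed.

Lemma partial_sumE n c (x : 'rV[C]_n) N :
  partial_sum c x N = \sum_(a <- cube n N) c a * monomial a x.
Proof. by rewrite /partial_sum /cube big_map big_enum. Qed.

Lemma cube_exhaust n (s : seq {ffun 'I_n -> nat}) :
  exists N0, forall N, (N0 <= N)%N -> {subset s <= cube n N}.
Proof.
exists (\max_(a <- s) \max_i a i).+1 => N N0N a as_; apply: mem_cube => i.
apply: leq_trans N0N; rewrite ltnS.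
by apply: leq_trans (leq_bigmax_seq _ as_ isT); exact: leq_bigmax.
Qed.

Lemma cvgC_md (u : nat -> C) l : u @ \oo --> l <->
  forall e : R, 0 < e -> \forall N \near \oo, md (u N - l) <= e.
Proof.
split=> [/cvgrPdist_le h e e0|h].
  have e0' : (0 : C) < e%:C%C by rewrite ltcR.
  have := h _ e0'; apply: filterS => N; by rewrite distrC -mdE lecR.
apply/cvgrPdist_le => e e0.
have eE : e = (complex.Re e)%:C%C by rewrite RRe_real// gtr0_real.
rewrite eE ltcR in e0; have := h _ e0; apply: filterS => N.
by rewrite distrC eE -mdE lecR.
Qed.

Lemma usum_partial_sum n c (x : 'rV[C]_n) l :
  usum (fun a => c a * monomial a x) l -> partial_sum c x @ \oo --> l.
Proof.
move=> h; apply/cvgC_md => e e0; have [s hs] := h e e0.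
have [N0 hN] := cube_exhaust s; near=> N; rewrite partial_sumE.
by apply: hs; rewrite ?cube_uniq//; apply: hN; near: N; exact: nbhs_infty_ge.
Unshelve. all: by end_near. Qed.

Lemma abs_summableP n (c : {ffun 'I_n -> nat} -> C) r : 0 <= r ->
  abs_summable_at c r <-> exists B, bsum (fun a => md (c a) * r ^+ degree a) B.
Proof.
move=> r0; rewrite /abs_summable_at /summable.
have t0 a : (0 <= (complex.Re `|c a| * r ^+ degree a)%:E)%E.
  by rewrite lee_fin mulr_ge0 ?exprn_ge0// -/(md (c a)) md_ge0.
under eq_esum do rewrite gee0_abs//.
split=> [fin|[B hB]].
  exists (fine (esum [set: {ffun 'I_n -> nat}]
     (fun a => (complex.Re `|c a| * r ^+ degree a)%:E))) => s us.
  rewrite -lee_fin fineK; last by rewrite ge0_fin_numE// esum_ge0.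
  rewrite -sumEFin fsbig_seq//; apply: esum_ge; exists [set` s] => //.
  by split=> //; exact: finite_seq.
apply: (@le_lt_trans _ _ B%:E); last exact: ltry.
apply: ge_ereal_sup => _ [X [finX _] <-].
by rewrite fsbig_finite//= sumEFin lee_fin; apply: hB; exact: finmap.fset_uniq.
Qed.

Lemma ps_is_sum n d r B f : @ps R n d r B f ->
  exists c, is_sum_on c r f /\ forall a, c a != 0 -> (d <= degree a)%N.
Proof.
move=> [r0 [c [cB cd cf]]]; exists c; split=> //; split=> //.
  by apply/(abs_summableP _ (ltW r0)); exists B.
move=> x xr; apply/usum_partial_sum/cf => i.
by rewrite ltW// -ltc_md.
Qed.

Lemma is_sum_ps n c r (f : 'rV[C]_n -> C) : is_sum_on c r f ->
  exists B, ps 0 (r / 2) B f.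
Proof.
move=> [r0 /(abs_summableP _ (ltW r0))[B cB] cf].
have r2 : 0 < r / 2 by rewrite divr_gt0.
have rr : r / 2 < r by lra.
exists B; split=> //; exists c; split=> //.
  apply: bsum_le cB => a; rewrite ler_wpM2l ?md_ge0// lerXn2r ?nnegrE; lra.
move=> x xr; have xr' : cball r x by apply: cballW xr; lra.
have [|l hl] := @usum_exists R _ (fun a => c a * monomial a x) B.
  apply: bsum_le cB => a; rewrite mdM ler_wpM2l ?md_ge0//; exact: md_monomial.
have xp : polydisc r x by move=> i; rewrite ltc_md; apply: le_lt_trans (xr i) rr.
suff -> : f x = l by [].
apply: (cvg_unique _ (cf x xp) (usum_partial_sum hl)).
exact: norm_hausdorff.
Qed.

(** A series can be recentered at every point of the open polydisc. *)
Lemma ps_holomorphic n d f (p : 'rV[C]_n) r B : @ps R n d r B f ->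
  (forall i, md (p 0 i) < r) -> holomorphic_at f p.
Proof.
move=> pf pr; have r0 := ps_gt0 pf.
pose s := \big[Num.min/r]_i (r - md (p 0 i)).
have s0 : 0 < s by apply: lt_bigmin => // i _; rewrite subr_gt0.
have ps' := @ps_recenter R n d r s B f p pf s0.
have [|c [hc _]] := ps_is_sum (ps' _).
  by move=> i; have := bigmin_le r i (fun i => r - md (p 0 i)); rewrite -/s; lra.
by exists c, s.
Qed.

Lemma real_analytic_an n (f : 'rV[C]_n -> C) : real_analytic_at f 0 ->
  exists2 F, an 0 F & \forall x \near nb0 R n, f x = F (row_mx x (conj_mx x)).
Proof.
move=> [c [r [F [hF fF]]]]; have r0 : 0 < r by case: hF.
have [B pF] := is_sum_ps hF; exists F; first exact: ps_an pF.
exists (r / 2); split; first by rewrite divr_gt0.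
move=> x xr; rewrite -fF ?add0r// => i; rewrite ltc_md.
by apply: le_lt_trans (xr i) _; lra.
Qed.

End SumsOfSeries.

(** * Explicit coordinates and division by variables *)

Section ComplexParts.
Variable R : realType.

Lemma md_ReC (z : R[i]) : md ('Re z) <= md z.
Proof.
rewrite -lecR !mdE ReE normrM normfV normr_nat ler_pdivrMr ?ltr0n//.
by apply: le_trans (ler_normD _ _) _; rewrite norm_conjC mulr_natr mulr2n.
Qed.

Lemma md_ImC (z : R[i]) : md ('Im z) <= md z.
Proof.
rewrite -lecR !mdE ImE !normrM normCi mul1r normfV normr_nat ler_pdivrMr ?ltr0n//.
by apply: le_trans (ler_normB _ _) _; rewrite norm_conjC mulr_natr mulr2n.
Qed.
End ComplexParts.

Section Coordinates.
Variable R : realType.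
Local Notation C := R[i].
Implicit Types n d : nat.

Definition vec n (s : seq C) : 'rV[C]_n := \row_(k < n) s`_k.

(** Coordinates indexed by natural numbers, 0 out of range: explicit lists of
    coordinates can then be handled without building ordinals. *)
Definition co n (x : 'rV[C]_n) (k : nat) : C :=
  if insub k is Some i then x 0 i else 0.

Lemma coE n (x : 'rV[C]_n) (i : 'I_n) : co x i = x 0 i.
Proof. by rewrite /co valK. Qed.

Lemma co_vec n s k : (k < n)%N -> co (vec n s) k = s`_k.
Proof. by move=> kn; rewrite (coE _ (Ordinal kn)) mxE. Qed.

Lemma vec_co n (x : 'rV[C]_n) : vec n (mkseq (co x) n) = x.
Proof. by apply/rowP => i; rewrite mxE nth_mkseq ?coE. Qed.

Lemma co_snocr n (x : 'rV[C]_n) y : co (snoc x y) n = y.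
Proof.
have := coE (snoc x y) (rshift n 0); rewrite /= addn0 => ->.
by rewrite row_mxEr mxE.
Qed.

Lemma snoc_sub n (X : 'rV[C]_(n + 1)) : snoc (lsubmx X) (rsubmx X 0 0) = X.
Proof.
rewrite -[RHS]hsubmxK; congr row_mx; apply/rowP => i.
by rewrite (ord1 i) !mxE.
Qed.

Lemma conj_vec n s : conj_mx (vec n s) = vec n [seq z^* | z <- s].
Proof.
apply/rowP => i; rewrite !mxE; have [lt|ge] := ltnP i (size s).
  by rewrite (nth_map 0).
by rewrite !nth_default ?size_map// rmorph0.
Qed.

Lemma an_co n k : an 1 (fun x : 'rV[C]_n => co x k).
Proof.
rewrite /co; case: insubP => [i _ _|_]; [exact: an_coord | exact: an_zero].
Qed.

Lemma an_vec m n d (s : 'rV[C]_m -> seq C) :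
  (forall k, (k < n)%N -> an d (fun x => (s x)`_k)) ->
  forall i, an d (fun x => vec n (s x) 0 i).
Proof.
by move=> h i; apply: an_eq (h i (ltn_ord i)) => x; rewrite mxE.
Qed.

(** Besides germs, conjugates of germs, which are not germs, are substituted into
    statements that hold near 0; only smallness matters there. *)
Definition vanishing n (h : 'rV[C]_n -> C) : Prop :=
  forall e : R, 0 < e -> \forall x \near nb0 R n, md (h x) <= e.

Lemma an_vanishing n h : @an R n 1 h -> vanishing h.
Proof. by move=> ah e; exact: an_near. Qed.

Lemma vanishing_conj n (h : 'rV[C]_n -> C) : vanishing h -> vanishing (fun x => (h x)^*).
Proof. by move=> hh e e0; apply: filterS (hh e e0) => x; rewrite md_conj. Qed.

Lemma vanishing_le n (h k : 'rV[C]_n -> C) : (forall x, md (h x) <= md (k x)) ->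
  vanishing k -> vanishing h.
Proof.
move=> hk kk e e0; apply: filterS (kk e e0) => x; exact: le_trans.
Qed.

Lemma near_vec m n (P : set 'rV[C]_n) (s : 'rV[C]_m -> seq C) :
  (\forall X \near nb0 R n, P X) ->
  (forall k, (k < n)%N -> vanishing (fun x => (s x)`_k)) ->
  \forall x \near nb0 R m, P (vec n (s x)).
Proof.
move=> [r [r0 hP]] hs.
have : \forall x \near nb0 R m, forall k : 'I_n, md (s x)`_k <= r.
  by apply: filter_forall => k; exact: hs.
by apply: filterS => x hx; apply: hP => i; rewrite mxE.
Qed.

Definition zero_on n (s : seq 'I_n) (x : 'rV[C]_n) : 'rV[C]_n :=
  \row_j (if j \in s then 0 else x 0 j).

(** The variables of s are set to 0 one after the other, and each step is divisible
    by the variable concerned. *)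
Lemma an_hadamard n d (s : seq 'I_n) f : uniq s -> @an R n d.+1 f ->
  exists G : 'I_n -> 'rV[C]_n -> C, (forall i, an d (G i)) /\
    \forall x \near nb0 R n, f x - f (zero_on s x) = \sum_(i <- s) x 0 i * G i x.
Proof.
elim: s f => [|i s IH] f /= => [_|/andP[ins us]] af.
  exists (fun _ _ => 0); split=> [i|]; first exact: an_zero.
  apply: filterE => x; rewrite big_nil (_ : zero_on [::] x = x) ?subrr//.
  by apply/rowP => j; rewrite mxE.
have [g ag fg] := an_div i af.
have az j : an 1 (fun x : 'rV[C]_n => zero_at i x 0 j).
  have [->|ji] := eqVneq j i.
    by apply: an_eq (an_zero _ _ _) => x; rewrite mxE eqxx.
  by apply: an_eq (an_coord _ j) => x; rewrite mxE (negbTE ji).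
have [G [aG hG]] := IH _ us (an_comp af az).
exists (fun j => if j == i then g else G j); split=> [j|]; first by case: ifP.
apply: filterS2 fg hG => x h1 h2.
rewrite big_cons eqxx -h1.
have -> : \sum_(j <- s) x 0 j * (if j == i then g else G j) x =
    \sum_(j <- s) x 0 j * G j x.
  rewrite big_seq [RHS]big_seq; apply: eq_bigr => j js.
  by case: eqP js ins => // -> ->.
rewrite -h2 addrA subrK; congr (_ - f _).
by apply/rowP => j; rewrite !mxE inE; case: (j == i).
Qed.

(** The increment of E from X to X + T is a germ in (X, T) that vanishes with T, so
    it is divisible by the variables T. *)
Lemma an_increments n d E : @an R n d.+1 E ->
  exists G : 'I_n -> 'rV[C]_(n + n) -> C, (forall i, an d (G i)) /\
    \forall Z \near nb0 R (n + n),
      E (lsubmx Z + rsubmx Z) - E (lsubmx Z) = \sum_i rsubmx Z 0 i * G i Z.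
Proof.
move=> aE; pose H (Z : 'rV[C]_(n + n)) := E (lsubmx Z + rsubmx Z).
have aH : an d.+1 H.
  apply: an_comp aE _ => i.
  apply: an_eq (an_add (an_coord _ (lshift n i)) (an_coord _ (rshift n i))) => Z.
  by rewrite !mxE.
pose s := [seq rshift n i | i <- enum 'I_n].
have us : uniq s by rewrite map_inj_uniq ?enum_uniq//; exact: rshift_inj.
have [G [aG hG]] := an_hadamard us aH.
exists (fun i => G (rshift n i)); split=> //; apply: filterS hG => Z.
rewrite {2}/s big_map big_enum /= => hZ.
have -> : \sum_i rsubmx Z 0 i * G (rshift n i) Z =
    \sum_i Z 0 (rshift n i) * G (rshift n i) Z by apply: eq_bigr => i _; rewrite mxE.
rewrite -hZ /H; congr (_ - E _); apply/rowP => j; rewrite !mxE.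
rewrite [rshift _ _ \in _](_ : _ = true) ?addr0; last first.
  by apply/mapP; exists j; rewrite ?mem_enum.
by case: ifP => // /mapP[k _ /eqP]; rewrite eq_lrshift.
Qed.

(** Replacing the argument of a germ of order d+1 by one that agrees with it to
    order e changes the value to order e+d. *)
Lemma an_increment_comp m n d e E (g h : 'rV[C]_m -> 'rV[C]_n) :
  an d.+1 E -> (forall i, an 1 (fun x => h x 0 i)) ->
  (forall i, an e.+1 (fun x => g x 0 i - h x 0 i)) ->
  an (e.+1 + d) (fun x => E (g x) - E (h x)).
Proof.
move=> aE ah agh; have [G [aG hG]] := an_increments aE.
pose Z x := row_mx (h x) (g x - h x).
have aZ : forall i, an 1 (fun x => Z x 0 i).
  apply: row_mxP => // i; apply: an_eq (an_weak (ltn0Sn e) (agh i)) => x.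
  by rewrite !mxE.
have := near_comp aZ hG => hZ.
have aS : an (e.+1 + d) (fun x => \sum_i (g x 0 i - h x 0 i) * G i (Z x)).
  by apply: an_sum => i _; apply: an_mul => //; exact: an_comp.
apply: an_ext aS _; apply: filterS hZ => x.
have hl : lsubmx (Z x) = h x by exact: row_mxKl.
have hr : rsubmx (Z x) = g x - h x by exact: row_mxKr.
rewrite hl hr [h x + _]addrC subrK => ->.
by apply: eq_bigr => i _; rewrite !mxE.
Qed.

Lemma lsubmx_vec n (X : 'rV[C]_(n + 1)) : lsubmx X = vec n (mkseq (co X) n).
Proof. by apply/rowP => i; rewrite !mxE nth_mkseq// -(coE X). Qed.

(** The solution is described by an equivalence, so that it also proves uniqueness:
    most identities below identify two solutions of one equation. *)
Lemma implicit_germ n lam (L : 'rV[C]_n -> C) (F : 'rV[C]_(n + 1) -> C) :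
  lam != 0 -> an 1 L ->
  an 2 (fun X => F X - (lam * co X n + L (vec n (mkseq (co X) n)))) ->
  exists g, [/\ an 1 g, an 2 (fun x => g x + lam^-1 * L x) &
    \forall X \near nb0 R (n + 1),
      F X = 0 <-> co X n = g (vec n (mkseq (co X) n))].
Proof.
move=> lam0 aL aF'.
have aF : an 2 (fun X => F X - (lam * co X n + L (lsubmx X))).
  by apply: an_eq aF' => X; rewrite lsubmx_vec.
have [g [ag ag2 [s [s0 [r [r0 hg]]]]]] := implicit_function lam0 aL aF.
exists g; split=> //; exists (Num.min r s); split; first by rewrite lt_min r0.
move=> X Xr; rewrite -lsubmx_vec; have [|h1 h2] := hg (lsubmx X).
  by move=> i; rewrite mxE; apply: le_trans (Xr _) _; rewrite ge_min lexx.
have cE : co X n = rsubmx X 0 0 by rewrite -{1}(snoc_sub X) co_snocr.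
have cs : md (co X n) <= s.
  by rewrite cE mxE; apply: le_trans (Xr _) _; rewrite ge_min lexx orbT.
have FE y : lam * y + L (lsubmx X) + (F (snoc (lsubmx X) y) -
    (lam * co (snoc (lsubmx X) y) n + L (lsubmx (snoc (lsubmx X) y)))) =
    F (snoc (lsubmx X) y).
  by rewrite co_snocr row_mxKl; ring.
rewrite FE in h1; split=> [FX|cX]; last by rewrite -(snoc_sub X) -cE cX.
by apply: h2 => //; rewrite FE cE snoc_sub.
Qed.

End Coordinates.

(** * Coordinates adapted to the Segre varieties *)

(* Runs through the entries of an explicit list of length at most 6. *)
Ltac nth_cases := move=> [|[|[|[|[|[|?]]]]]] //= _.
Ltac an1 := repeat first [exact: an_zero | exact: an_co | eassumption |
  apply: an_add | apply: an_opp | apply: an_scale].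

Section NormalForm.
Variable R : realType.
Local Notation C := R[i].
(* The six variables are z1, z2, w and, independent of them, zeta1, zeta2, omega,
   which become the conjugates of the former on the real points. *)
Variables (N : 'rV[C]_6 -> C) (eps : C).
Let N6 (a b c d e f : C) := N (vec 6 [:: a; b; c; d; e; f]).
Hypothesis Nherm : forall a b c d e f : C,
  N6 d^* e^* f^* a^* b^* c^* = (N6 a b c d e f)^*.
Let E (X : 'rV[C]_6) := N X - 'i / 2 * (co X 2 - co X 5).
Hypothesis aE : an 2 E.
Hypothesis Nmix : an 3 (fun x : 'rV[C]_4 =>
  N6 (co x 0) (co x 1) 0 (co x 2) (co x 3) 0 - N6 (co x 0) (co x 1) 0 0 0 0
  - N6 0 0 0 (co x 2) (co x 3) 0 - (co x 0 * co x 2 + eps * (co x 1 * co x 3))).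

Let NE a b c d e f : N6 a b c d e f = 'i / 2 * (c - f) + E (vec 6 [:: a; b; c; d; e; f]).
Proof. by rewrite /E !co_vec//= /N6 addrC subrK. Qed.

Let aEv m (s : 'rV[C]_m -> seq C) :
  (forall k, (k < 6)%N -> an 1 (fun x => (s x)`_k)) ->
  an 2 (fun x => E (vec 6 (s x))).
Proof. by move=> h; apply: an_comp aE _; exact: an_vec. Qed.

Let i2 : 'i / 2 * (2 * 'i) = -1 :> C.
Proof. by rewrite mulrA divfK ?pnatr_eq0// -expr2 sqrCi. Qed.

Let Nconj0 a b c d e f : N6 a b c d e f = 0 -> N6 d^* e^* f^* a^* b^* c^* = 0.
Proof. by rewrite Nherm => ->; rewrite rmorph0. Qed.

(** At w = t + i v, omega = t - i v the linear part of the equation is - v, so the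
    equation on the line z = 0 can be solved for v = psi t. *)
Lemma axis : exists psi : C -> C, [/\ an 2 (fun x : 'rV[C]_1 => psi (co x 0)) &
  \forall X \near nb0 R 2, N6 0 0 (co X 0 + 'i * co X 1) 0 0 (co X 0 - 'i * co X 1) = 0
    <-> co X 1 = psi (co X 0)].
Proof.
pose F (X : 'rV[C]_(1 + 1)) := N6 0 0 (co X 0 + 'i * co X 1) 0 0 (co X 0 - 'i * co X 1).
have [|||g [ag ag2 hg]] := @implicit_germ R 1 (-1) (fun=> 0) F.
- by rewrite oppr_eq0 oner_eq0.
- exact: an_zero.
- have h : an 2 (fun X : 'rV[C]_(1 + 1) => E (vec 6 [:: 0; 0; co X 0 + 'i * co X 1;
      0; 0; co X 0 - 'i * co X 1])).
    by apply: aEv; nth_cases; an1.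
  apply: an_eq h => X; rewrite /F NE addr0.
  rewrite (_ : _ + 'i * _ - _ = 2 * 'i * co X 1); last by ring.
  by rewrite mulrA i2; ring.
exists (fun t => g (vec 1 [:: t])); split; last exact: hg.
by apply: an_eq ag2 => x; rewrite mulr0 addr0 -{1}(vec_co x).
Qed.

Variable psi : C -> C.
Hypothesis apsi : an 2 (fun x : 'rV[C]_1 => psi (co x 0)).
Hypothesis hpsi : \forall X \near nb0 R 2,
  N6 0 0 (co X 0 + 'i * co X 1) 0 0 (co X 0 - 'i * co X 1) = 0
    <-> co X 1 = psi (co X 0).

(* On the real points gam t is the point of the curve and gamb t its conjugate. *)
Let gam t := t + 'i * psi t.
Let gamb t := t - 'i * psi t.

Let apsi_comp m d (h : 'rV[C]_m -> C) : (d <= 2)%N -> an 1 h -> an d (fun x => psi (h x)).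
Proof.
move=> d2 ah; apply: (an_weak d2).
apply: an_eq (an_comp (g := fun x => vec 1 [:: h x]) apsi _) => [x|].
  by rewrite co_vec.
by apply: an_vec; nth_cases.
Qed.

(** The Segre varieties of the points of the curve are graphs w = W (z, t), since
    the equation has nonzero derivative in w. *)
Lemma segre_solution : exists W : C -> C -> C -> C,
  [/\ an 2 (fun x : 'rV[C]_3 => W (co x 0) (co x 1) (co x 2) - co x 2) &
  \forall X \near nb0 R 4,
    N6 (co X 0) (co X 1) (co X 3) 0 0 (gamb (co X 2)) = 0
    <-> co X 3 = W (co X 0) (co X 1) (co X 2)].
Proof.
pose F (X : 'rV[C]_(3 + 1)) := N6 (co X 0) (co X 1) (co X 3) 0 0 (gamb (co X 2)).
pose L (x : 'rV[C]_3) := - ('i / 2) * co x 2.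
have l0 : 'i / 2 != 0 :> C by rewrite mulf_neq0 ?neq0Ci ?invr_eq0 ?pnatr_eq0.
have [||g [ag ag2 hg]] := @implicit_germ R 3 ('i / 2) L F l0.
- by rewrite /L; an1.
- have h : an 2 (fun X : 'rV[C]_(3 + 1) => - 2^-1 * psi (co X 2) + E (vec 6 [:: co X 0; co X 1; co X 3;
      0; 0; gamb (co X 2)])).
    apply: an_add; first by apply/an_scale/apsi_comp => //; an1.
    apply: aEv; nth_cases; rewrite /gamb; an1.
    by apply: apsi_comp => //; an1.
  apply: an_eq h => X; rewrite /F NE /L co_vec//= /gamb.
  have -> : - (2^-1) = 'i ^+ 2 / 2 :> C by rewrite sqrCi mulN1r.
  by rewrite expr2; ring.
exists (fun a b c => g (vec 3 [:: a; b; c])); split; last exact: hg.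
apply: an_eq ag2 => x; rewrite /L mulrA mulrN mulVf// mulN1r.
by rewrite -{1}(vec_co x).
Qed.

(** The same equation solved for t: the Segre variety through a given point. *)
Lemma segre_coordinate : exists V : C -> C -> C -> C,
  [/\ an 2 (fun x : 'rV[C]_3 => V (co x 0) (co x 1) (co x 2) - co x 2) &
  \forall X \near nb0 R 4,
    N6 (co X 0) (co X 1) (co X 2) 0 0 (gamb (co X 3)) = 0
    <-> co X 3 = V (co X 0) (co X 1) (co X 2)].
Proof.
pose F (X : 'rV[C]_(3 + 1)) := N6 (co X 0) (co X 1) (co X 2) 0 0 (gamb (co X 3)).
pose L (x : 'rV[C]_3) := ('i / 2) * co x 2.
have l0 : - ('i / 2) != 0 :> C.
  by rewrite oppr_eq0 mulf_neq0 ?neq0Ci ?invr_eq0 ?pnatr_eq0.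
have [||g [ag ag2 hg]] := @implicit_germ R 3 (- ('i / 2)) L F l0.
- by rewrite /L; an1.
- have h : an 2 (fun X : 'rV[C]_(3 + 1) => - 2^-1 * psi (co X 3) + E (vec 6 [:: co X 0; co X 1; co X 2;
      0; 0; gamb (co X 3)])).
    apply: an_add; first by apply/an_scale/apsi_comp => //; an1.
    apply: aEv; nth_cases; rewrite /gamb; an1.
    by apply: apsi_comp => //; an1.
  apply: an_eq h => X; rewrite /F NE /L co_vec//= /gamb.
  have -> : - (2^-1) = 'i ^+ 2 / 2 :> C by rewrite sqrCi mulN1r.
  by rewrite expr2; ring.
exists (fun a b c => g (vec 3 [:: a; b; c])); split; last exact: hg.
apply: an_eq ag2 => x; rewrite /L mulrA invrN mulNr mulVf ?mulN1r.
  by rewrite -{1}(vec_co x).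
by rewrite -oppr_eq0.
Qed.

Variable W : C -> C -> C -> C.
Hypothesis aW : an 2 (fun x : 'rV[C]_3 => W (co x 0) (co x 1) (co x 2) - co x 2).
Hypothesis hW : \forall X \near nb0 R 4,
    N6 (co X 0) (co X 1) (co X 3) 0 0 (gamb (co X 2)) = 0
    <-> co X 3 = W (co X 0) (co X 1) (co X 2).

(* The conjugate series of W. *)
Let Wb a b c := (W a^* b^* c^*)^*.

Let aWb : an 2 (fun x : 'rV[C]_3 => Wb (co x 0) (co x 1) (co x 2) - co x 2).
Proof.
apply: an_eq (an_conj aW) => x; rewrite /Wb -{1 2 3 4 }(vec_co x) conj_vec /=.
by rewrite !co_vec//= rmorphB /= conjCK.
Qed.

Let aW3 m (s : 'rV[C]_m -> seq C) : (forall k, (k < 3)%N -> an 1 (fun x => (s x)`_k)) ->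
  an 2 (fun x => W (s x)`_0 (s x)`_1 (s x)`_2 - (s x)`_2).
Proof.
move=> h; apply: an_eq (an_comp aW (an_vec h)) => x.
by rewrite !co_vec.
Qed.

Let aWb3 m (s : 'rV[C]_m -> seq C) : (forall k, (k < 3)%N -> an 1 (fun x => (s x)`_k)) ->
  an 2 (fun x => Wb (s x)`_0 (s x)`_1 (s x)`_2 - (s x)`_2).
Proof.
move=> h; apply: an_eq (an_comp aWb (an_vec h)) => x.
by rewrite !co_vec.
Qed.

Let aWc m (f g h : 'rV[C]_m -> C) : an 1 f -> an 1 g -> an 1 h ->
  an 1 (fun x => W (f x) (g x) (h x)).
Proof.
move=> af ag ah.
have := an_weak (ltnW (ltnSn 1)) (@aW3 m (fun x => [:: f x; g x; h x]) _).
move=> H; apply: an_eq (an_add (H _) ah) => [x|]; first by rewrite /= subrK.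
by nth_cases.
Qed.

Let aWbc m (f g h : 'rV[C]_m -> C) : an 1 f -> an 1 g -> an 1 h ->
  an 1 (fun x => Wb (f x) (g x) (h x)).
Proof.
move=> af ag ah.
have := an_weak (ltnW (ltnSn 1)) (@aWb3 m (fun x => [:: f x; g x; h x]) _).
move=> H; apply: an_eq (an_add (H _) ah) => [x|]; first by rewrite /= subrK.
by nth_cases.
Qed.

(** The curve is symmetric under conjugation because its equation is. *)
Lemma psi_conj : \forall x \near nb0 R 1, psi (co x 0)^* = (psi (co x 0))^*.
Proof.
have v1 : vanishing (fun x : 'rV[C]_1 => co x 0) by apply/an_vanishing/an_co.
have v2 : vanishing (fun x : 'rV[C]_1 => psi (co x 0)).
  by apply/an_vanishing/(an_weak _ apsi).
have h1 := near_vec (s := fun x : 'rV[C]_1 => [:: co x 0; psi (co x 0)]) hpsi.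
have h2 := near_vec (s := fun x : 'rV[C]_1 => [:: (co x 0)^*; (psi (co x 0))^*]) hpsi.
have := h1 _; have := h2 _; move=> {}h2 {}h1.
apply: filterS2 (h1 _) (h2 _) => [x||].
- rewrite !co_vec//= => -[_ /(_ erefl) e1] [e2 _].
  apply/esym/e2; move: (Nconj0 e1).
  by rewrite !(rmorph0, rmorphD, rmorphN, rmorphM) /= conjCi !mulNr opprK.
- by nth_cases.
- by nth_cases; apply: vanishing_conj.
Qed.

(** Each Segre variety of the family meets the line z = 0 in the point of the curve
    it comes from, as this point satisfies the complexified equation. *)
Lemma W_axis : \forall x \near nb0 R 1, W 0 0 (co x 0) = gam (co x 0).
Proof.
have a0 := an_co R 1 0.
have apsi0 : an 1 (fun x : 'rV[C]_1 => psi (co x 0)) by exact: an_weak apsi.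
have h1 := near_vec (s := fun x : 'rV[C]_1 => [:: co x 0; psi (co x 0)]) hpsi.
have h2 := near_vec (s := fun x : 'rV[C]_1 => [:: 0; 0; co x 0; gam (co x 0)]) hW.
have := h1 _; have := h2 _; move=> {}h2 {}h1.
apply: filterS2 (h1 _) (h2 _) => [x||].
- rewrite !co_vec//= => -[_ /(_ erefl) e1] [e2 _].
  by apply/esym/e2.
- by nth_cases; apply: an_vanishing.
- by nth_cases; apply: an_vanishing; rewrite /gam; an1.
Qed.

Lemma Wb_axis : \forall x \near nb0 R 1, Wb 0 0 (co x 0) = gamb (co x 0).
Proof.
have v1 : vanishing (fun x : 'rV[C]_1 => co x 0) by apply/an_vanishing/an_co.
have h := near_vec (s := fun x : 'rV[C]_1 => [:: (co x 0)^*]) W_axis.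
apply: filterS2 psi_conj (h _) => [x e|].
  rewrite co_vec//= /Wb rmorph0 => ->; rewrite /gam e.
  by rewrite rmorphD rmorphM /= !conjCK conjCi mulNr.
by nth_cases; apply: vanishing_conj.
Qed.

(** The complexified equation, written in the new transversal coordinates u + i v
    and u - i v, again has linear part - v and is solved for v. *)
Lemma defining_function : exists phi : C -> C -> C -> C -> C -> C,
  [/\ an 2 (fun x : 'rV[C]_5 => phi (co x 0) (co x 1) (co x 2) (co x 3) (co x 4)) &
  \forall X \near nb0 R 6,
    N6 (co X 0) (co X 1) (W (co X 0) (co X 1) (co X 4 + 'i * co X 5))
       (co X 2) (co X 3) (Wb (co X 2) (co X 3) (co X 4 - 'i * co X 5)) = 0
    <-> co X 5 = phi (co X 0) (co X 1) (co X 2) (co X 3) (co X 4)].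
Proof.
pose F (X : 'rV[C]_(5 + 1)) :=
  N6 (co X 0) (co X 1) (W (co X 0) (co X 1) (co X 4 + 'i * co X 5))
     (co X 2) (co X 3) (Wb (co X 2) (co X 3) (co X 4 - 'i * co X 5)).
have [|||g [ag ag2 hg]] := @implicit_germ R 5 (-1) (fun=> 0) F.
- by rewrite oppr_eq0 oner_eq0.
- exact: an_zero.
- have h : an 2 (fun X : 'rV[C]_(5 + 1) =>
      'i / 2 * ((W (co X 0) (co X 1) (co X 4 + 'i * co X 5) - (co X 4 + 'i * co X 5))
       - (Wb (co X 2) (co X 3) (co X 4 - 'i * co X 5) - (co X 4 - 'i * co X 5)))
      + E (vec 6 [:: co X 0; co X 1; W (co X 0) (co X 1) (co X 4 + 'i * co X 5);
        co X 2; co X 3; Wb (co X 2) (co X 3) (co X 4 - 'i * co X 5)])).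
    apply: an_add.
      apply/an_scale/an_sub.
        apply: (@aW3 _ (fun X => [:: co X 0; co X 1; co X 4 + 'i * co X 5])).
        by nth_cases; an1.
      apply: (@aWb3 _ (fun X => [:: co X 2; co X 3; co X 4 - 'i * co X 5])).
      by nth_cases; an1.
    by apply: aEv; nth_cases; an1; [apply: aWc|apply: aWbc]; an1.
  apply: an_eq h => X; rewrite /F NE addr0.
  have := i2; set w := W _ _ _; set wb := Wb _ _ _; set e := E _ => i2'.
  rewrite [X in _ = X](_ : _ = 'i / 2 * (w - wb) + e - 'i / 2 * (2 * 'i) * co X 5).
    by ring.
  by rewrite i2'.
exists (fun a b c d e => g (vec 5 [:: a; b; c; d; e])); split; last exact: hg.
by apply: an_eq ag2 => x; rewrite mulr0 addr0 -{1}(vec_co x).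
Qed.

Variable V : C -> C -> C -> C.
Hypothesis aV : an 2 (fun x : 'rV[C]_3 => V (co x 0) (co x 1) (co x 2) - co x 2).
Hypothesis hV : \forall X \near nb0 R 4,
    N6 (co X 0) (co X 1) (co X 2) 0 0 (gamb (co X 3)) = 0
    <-> co X 3 = V (co X 0) (co X 1) (co X 2).

Let avan m (h : 'rV[C]_m -> C) : an 1 h -> vanishing h.
Proof. exact: an_vanishing. Qed.

Let aV1 : an 1 (fun x : 'rV[C]_3 => V (co x 0) (co x 1) (co x 2)).
Proof.
by apply: an_eq (an_add (an_weak (ltnW (ltnSn 1)) aV) (an_co _ _ 2)) => x; rewrite subrK.
Qed.

Lemma W_solves : \forall x \near nb0 R 3,
  N6 (co x 0) (co x 1) (W (co x 0) (co x 1) (co x 2)) 0 0 (gamb (co x 2)) = 0.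
Proof.
have h := near_vec (s := fun x : 'rV[C]_3 =>
  [:: co x 0; co x 1; co x 2; W (co x 0) (co x 1) (co x 2)]) hW.
apply: filterS (h _) => [x|]; first by rewrite !co_vec//= => ->.
by nth_cases; apply: avan; an1; apply: aWc; an1.
Qed.

Lemma V_solves : \forall x \near nb0 R 3,
  N6 (co x 0) (co x 1) (co x 2) 0 0 (gamb (V (co x 0) (co x 1) (co x 2))) = 0.
Proof.
have h := near_vec (s := fun x : 'rV[C]_3 =>
  [:: co x 0; co x 1; co x 2; V (co x 0) (co x 1) (co x 2)]) hV.
apply: filterS (h _) => [x|]; first by rewrite !co_vec//= => ->.
by nth_cases; apply: avan; an1.
Qed.

(** W (z, _) and V (z, _) solve one equation for either of its variables, so they
    are inverse to each other. *)
Lemma WK : \forall x \near nb0 R 3,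
  V (co x 0) (co x 1) (W (co x 0) (co x 1) (co x 2)) = co x 2.
Proof.
have h := near_vec (s := fun x : 'rV[C]_3 =>
  [:: co x 0; co x 1; W (co x 0) (co x 1) (co x 2); co x 2]) hV.
apply: filterS2 W_solves (h _) => [x e|]; first by rewrite !co_vec//= => -[/(_ e) <-].
by nth_cases; apply: avan; an1; apply: aWc; an1.
Qed.

Lemma VK : \forall x \near nb0 R 3,
  W (co x 0) (co x 1) (V (co x 0) (co x 1) (co x 2)) = co x 2.
Proof.
have h := near_vec (s := fun x : 'rV[C]_3 =>
  [:: co x 0; co x 1; V (co x 0) (co x 1) (co x 2); co x 2]) hW.
apply: filterS2 V_solves (h _) => [x e|]; first by rewrite !co_vec//= => -[/(_ e) <-].
by nth_cases; apply: avan; an1.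
Qed.

Variable phi : C -> C -> C -> C -> C -> C.
Hypothesis aphi : an 2 (fun x : 'rV[C]_5 =>
  phi (co x 0) (co x 1) (co x 2) (co x 3) (co x 4)).
Hypothesis hphi : \forall X \near nb0 R 6,
    N6 (co X 0) (co X 1) (W (co X 0) (co X 1) (co X 4 + 'i * co X 5))
       (co X 2) (co X 3) (Wb (co X 2) (co X 3) (co X 4 - 'i * co X 5)) = 0
    <-> co X 5 = phi (co X 0) (co X 1) (co X 2) (co X 3) (co X 4).

Let vco m k : vanishing (fun x : 'rV[C]_m => co x k).
Proof. exact/avan/an_co. Qed.

(** The conjugate of a solution solves the conjugate equation; uniqueness gives the
    symmetry. *)
Lemma phi_conj : \forall x \near nb0 R 5,
  phi (co x 2)^* (co x 3)^* (co x 0)^* (co x 1)^* (co x 4)^* =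
  (phi (co x 0) (co x 1) (co x 2) (co x 3) (co x 4))^*.
Proof.
pose f (x : 'rV[C]_5) := phi (co x 0) (co x 1) (co x 2) (co x 3) (co x 4).
have vf : vanishing f by apply/avan/(an_weak _ aphi).
have h1 := near_vec (s := fun x : 'rV[C]_5 =>
  [:: co x 0; co x 1; co x 2; co x 3; co x 4; f x]) hphi.
have h2 := near_vec (s := fun x : 'rV[C]_5 =>
  [:: (co x 2)^*; (co x 3)^*; (co x 0)^*; (co x 1)^*; (co x 4)^*; (f x)^*]) hphi.
apply: filterS2 (h1 _) (h2 _) => [x||].
- rewrite !co_vec//= => -[_ /(_ erefl) e1] [e2 _].
  apply/esym/e2; move: (Nconj0 e1); rewrite /Wb !conjCK.
  by rewrite !(rmorphD, rmorphN, rmorphM) /= !conjCK conjCi !mulNr !opprK.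
- by nth_cases.
- by nth_cases; apply: vanishing_conj.
Qed.

(** With zeta = 0 and v = 0 the equation says that (z, W (z, u)) lies on the Segre
    variety with parameter u, so v = 0 is the solution. *)
Lemma phi_pure : \forall x \near nb0 R 3, phi (co x 0) (co x 1) 0 0 (co x 2) = 0.
Proof.
have h1 := near_vec (s := fun x : 'rV[C]_3 =>
  [:: co x 0; co x 1; 0; 0; co x 2; 0]) hphi.
have h2 := near_vec (s := fun x : 'rV[C]_3 => [:: co x 2]) Wb_axis.
apply: filterS3 (h1 _) (h2 _) W_solves => [x||].
- rewrite !co_vec//= mulr0 addr0 subr0 => -[e _] eW eN.
  by apply/esym/e; rewrite eW.
- by nth_cases; apply: avan; an1.
- by nth_cases.
Qed.

Lemma phi_pure_conj : \forall x \near nb0 R 3, phi 0 0 (co x 0) (co x 1) (co x 2) = 0.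
Proof.
have h1 := near_vec (s := fun x : 'rV[C]_3 =>
  [:: (co x 0)^*; (co x 1)^*; (co x 2)^*]) phi_pure.
have h2 := near_vec (s := fun x : 'rV[C]_3 =>
  [:: (co x 0)^*; (co x 1)^*; 0; 0; (co x 2)^*]) phi_conj.
apply: filterS2 (h1 _) (h2 _) => [x||].
- by rewrite !co_vec//= !rmorph0 !conjCK => -> ->; rewrite rmorph0.
- by nth_cases; apply: vanishing_conj.
- by nth_cases; try apply: vanishing_conj => //; apply/avan/an_zero.
Qed.

(** At conjugate points the arguments u + i v and u - i v are H and its conjugate,
    and W (z, H) is the original coordinate w. *)
Lemma graph_equation : \forall x \near nb0 R 3,
  let H := V (co x 0) (co x 1) (co x 2) in
  N6 (co x 0) (co x 1) (co x 2) (co x 0)^* (co x 1)^* (co x 2)^* = 0 <->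
  'Im H = phi (co x 0) (co x 1) (co x 0)^* (co x 1)^* ('Re H).
Proof.
pose H (x : 'rV[C]_3) := V (co x 0) (co x 1) (co x 2).
have h := near_vec (s := fun x : 'rV[C]_3 =>
  [:: co x 0; co x 1; (co x 0)^*; (co x 1)^*; 'Re (H x); 'Im (H x)]) hphi.
apply: filterS2 VK (h _) => [x e|].
  rewrite !co_vec//= -Crect.
  rewrite -conjC_rect ?Creal_Re ?Creal_Im// -Crect /Wb !conjCK e.
  by [].
have vH : vanishing H by exact: avan.
nth_cases; try exact: vanishing_conj => //.
  by apply: vanishing_le vH => y; exact: md_ReC.
by apply: vanishing_le vH => y; exact: md_ImC.
Qed.

(** On u = 0 the function phi has order 2, so W and Wb have order 2 there, and they
    change E, which has order 2, only by terms of order 3.  The equations defining W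
    and Wb cancel the pure terms of E, and what remains of the equation for phi is
    the mixed part of N. *)
Lemma phi_second_order : an 3 (fun x : 'rV[C]_4 =>
  phi (co x 0) (co x 1) (co x 2) (co x 3) 0
  - (co x 0 * co x 2 + eps * (co x 1 * co x 3))).
Proof.
pose f (x : 'rV[C]_4) := phi (co x 0) (co x 1) (co x 2) (co x 3) 0.
have af : an 2 f.
  apply: an_eq (an_comp (g := fun x : 'rV[C]_4 => vec 5 [:: co x 0; co x 1; co x 2; co x 3; 0])
    aphi _) => [x|]; first by rewrite !co_vec.
  by apply: an_vec; nth_cases; an1.
have af1 : an 1 f by exact: an_weak af.
pose w1 x := W (co x 0) (co x 1) (0 + 'i * f x).
pose w2 x := Wb (co x 2) (co x 3) (0 - 'i * f x).
pose w10 (x : 'rV[C]_4) := W (co x 0) (co x 1) 0.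
pose w20 (x : 'rV[C]_4) := Wb (co x 2) (co x 3) 0.
have aw1 : an 1 w1 by apply: aWc; an1.
have aw2 : an 1 w2 by apply: aWbc; an1.
have aw10 : an 2 w10.
  have := @aW3 4 (fun x => [:: co x 0; co x 1; 0]); rewrite /w10.
  move=> /(_ _) H; apply: an_eq (H _) => [x|]; first by rewrite /= subr0.
  by nth_cases; an1.
have aw20 : an 2 w20.
  have := @aWb3 4 (fun x => [:: co x 2; co x 3; 0]); rewrite /w20.
  move=> /(_ _) H; apply: an_eq (H _) => [x|]; first by rewrite /= subr0.
  by nth_cases; an1.
(* eT1 and eT2: when the last argument of W or Wb moves by a multiple of f, which has
   order 2, the value moves by the same amount up to order 3. *)
have eT1 : an 3 (fun x => (w1 x - (0 + 'i * f x)) - (w10 x - 0)).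
  have := @an_increment_comp R 4 3 1 1 _
    (fun x => vec 3 [:: co x 0; co x 1; 0 + 'i * f x])
    (fun x => vec 3 [:: co x 0; co x 1; 0]) aW.
  move=> H; apply: an_eq (H _ _) => [x||].
  - by rewrite !co_vec.
  - by apply: an_vec; nth_cases; an1.
  - move=> i; apply: an_eq (_ : an 2 (fun x => vec 3 [:: 0; 0; 'i * f x] 0 i)) => [x|].
      by rewrite !mxE; case: i => -[|[|[|]]]//= _; ring.
    by apply: an_vec; nth_cases; an1.
have eT2 : an 3 (fun x => (w2 x - (0 - 'i * f x)) - (w20 x - 0)).
  have := @an_increment_comp R 4 3 1 1 _
    (fun x => vec 3 [:: co x 2; co x 3; 0 - 'i * f x])
    (fun x => vec 3 [:: co x 2; co x 3; 0]) aWb.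
  move=> H; apply: an_eq (H _ _) => [x||].
  - by rewrite !co_vec.
  - by apply: an_vec; nth_cases; an1.
  - move=> i; apply: an_eq (_ : an 2 (fun x => vec 3 [:: 0; 0; - ('i * f x)] 0 i)) => [x|].
      by rewrite !mxE; case: i => -[|[|[|]]]//= _; ring.
    by apply: an_vec; nth_cases; an1.
(* eD: the w and omega arguments of E have order 2 and can be dropped. *)
have eD (u v : 'rV[C]_4 -> C) (a b c d : 'rV[C]_4 -> C) : an 2 u -> an 2 v ->
    an 1 a -> an 1 b -> an 1 c -> an 1 d ->
    an 3 (fun x => E (vec 6 [:: a x; b x; u x; c x; d x; v x])
                 - E (vec 6 [:: a x; b x; 0; c x; d x; 0])).
  move=> au av aa ab ac ad.
  apply: (@an_increment_comp R 4 6 1 1 _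
    (fun x => vec 6 [:: a x; b x; u x; c x; d x; v x])
    (fun x => vec 6 [:: a x; b x; 0; c x; d x; 0]) aE).
  - by apply: an_vec; nth_cases; an1.
  - move=> i; apply: an_eq (_ : an 2 (fun x => vec 6 [:: 0; 0; u x; 0; 0; v x] 0 i)) => [x|].
      by rewrite !mxE; case: i => -[|[|[|[|[|[|]]]]]]//= _; ring.
    by apply: an_vec; nth_cases; an1.
have aw1' : an 2 w1.
  have := @aW3 4 (fun x => [:: co x 0; co x 1; 0 + 'i * f x]) _ => H.
  apply: an_eq (an_add (H _) (an_scale 'i af)) => [x|]; first by rewrite /w1 /w2 /= !add0r subrK.
  by nth_cases; an1.
have aw2' : an 2 w2.
  have := @aWb3 4 (fun x => [:: co x 2; co x 3; 0 - 'i * f x]) _ => H.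
  apply: an_eq (an_add (H _) (an_opp (an_scale 'i af))) => [x|]; first by rewrite /w1 /w2 /= !add0r subrK.
  by nth_cases; an1.
have psi0 : psi 0 = 0.
  by have := an_at0 apsi; rewrite /co; case: insubP => // i _ _; rewrite mxE.
have h1 := near_vec (s := fun x : 'rV[C]_4 =>
  [:: co x 0; co x 1; co x 2; co x 3; 0; f x]) hphi.
have h2 := near_vec (s := fun x : 'rV[C]_4 => [:: co x 0; co x 1; 0]) W_solves.
have h3 := near_vec (s := fun x : 'rV[C]_4 => [:: (co x 2)^*; (co x 3)^*; 0]) W_solves.
pose E1 x := E (vec 6 [:: co x 0; co x 1; w1 x; co x 2; co x 3; w2 x])
  - E (vec 6 [:: co x 0; co x 1; 0; co x 2; co x 3; 0]).
pose E2 (x : 'rV[C]_4) := E (vec 6 [:: co x 0; co x 1; w10 x; 0; 0; 0])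
  - E (vec 6 [:: co x 0; co x 1; 0; 0; 0; 0]).
pose E3 (x : 'rV[C]_4) := E (vec 6 [:: 0; 0; 0; co x 2; co x 3; w20 x])
  - E (vec 6 [:: 0; 0; 0; co x 2; co x 3; 0]).
have aE1 : an 3 E1 by apply: eD => //; an1.
have aE2 : an 3 E2 by apply: (eD w10 (fun=> 0)) => //; an1.
have aE3 : an 3 E3 by apply: (eD (fun=> 0) w20) => //; an1.
have total := an_add (an_add (an_scale ('i / 2) (an_sub eT1 eT2))
  (an_sub (an_sub aE1 aE2) aE3)) Nmix.
apply: an_ext total _; apply: filterS3 (h1 _) (h2 _) (h3 _) => [x|||].
- rewrite !co_vec//= => -[_ /(_ erefl)]; rewrite -/(w1 x) -/(w2 x) => e1 e2 /Nconj0 e3.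
  move: e1 e2 e3; rewrite /gamb psi0 mulr0 subr0 !rmorph0 !conjCK.
  rewrite -[W (co x 0) (co x 1) 0]/(w10 x).
  have -> : (W (co x 2)^* (co x 3)^* 0)^* = w20 x by rewrite /w20 /Wb rmorph0.
  rewrite !NE /E1 /E2 /E3 -/(f x).
  move: (E (vec 6 [:: co x 0; co x 1; w1 x; co x 2; co x 3; w2 x])) => e1.
  move: (E (vec 6 [:: co x 0; co x 1; w10 x; 0; 0; 0])) => e2.
  move: (E (vec 6 [:: 0; 0; 0; co x 2; co x 3; w20 x])) => e3.
  move=> /eqP; rewrite addr_eq0 => /eqP q1 /eqP; rewrite addr_eq0 => /eqP q2.
  move=> /eqP; rewrite addr_eq0 => /eqP q3.
  have {}q1 : e1 = - ('i / 2 * (w1 x - w2 x)) by rewrite q1 opprK.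
  have {}q2 : e2 = - ('i / 2 * (w10 x - 0)) by rewrite q2 opprK.
  have {}q3 : e3 = - ('i / 2 * (0 - w20 x)) by rewrite q3 opprK.
  rewrite q1 q2 q3.
  transitivity (- ('i / 2 * (2 * 'i)) * f x - (co x 0 * co x 2 + eps * (co x 1 * co x 3))).
    by ring.
  by rewrite i2 opprK mul1r.
- by nth_cases; apply: avan; an1.
- by nth_cases; apply: avan; an1.
- by nth_cases; try (by apply: vanishing_conj); apply: avan; an1.
Qed.
End NormalForm.

Section MixedTerms.
Variable R : realType.
Local Notation C := R[i].

Lemma an_zero_on n (s : seq 'I_n) i : an 1 (fun x : 'rV[C]_n => zero_on s x 0 i).
Proof.
have [is_|ins] := boolP (i \in s).
  by apply: an_eq (an_zero _ _ _) => x; rewrite mxE is_.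
by apply: an_eq (an_coord _ i) => x; rewrite mxE (negbTE ins).
Qed.

Lemma co_zero_on n (s : seq 'I_n) (x : 'rV[C]_n) k :
  co (zero_on s x) k = if k \in [seq val i | i <- s] then 0 else co x k.
Proof.
rewrite /co; case: insubP => [i _ <-|nk]; last by case: ifP.
by rewrite mxE (mem_map val_inj).
Qed.

(** Division by the variables of s, then of the quotients by those of t; replacing
    the last quotients by their values at 0 leaves an error of order 3. *)
Lemma an_mixed n (s t : seq 'I_n) f : uniq s -> uniq t ->
  (forall i, i \in s -> i \notin t) -> an 2 f ->
  (\forall x \near nb0 R n, f (zero_on s x) = 0) ->
  (\forall x \near nb0 R n, f (zero_on t x) = 0) ->
  exists h : 'I_n -> 'I_n -> C,
    an 3 (fun x => f x - \sum_(i <- s) \sum_(j <- t) h i j * (x 0 i * x 0 j)).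
Proof.
move=> us ut st af fs ft.
have [G [aG hG]] := an_hadamard us af.
have /choice[G2 hG2] i := an_hadamard ut (aG i).
exists (fun i j => G2 i j 0).
have a3 : an 3 (fun x => \sum_(i <- s) \sum_(j <- t)
    x 0 i * (x 0 j * (G2 i j x - G2 i j 0))).
  apply: an_sum => i _; apply: an_sum => j _.
  apply: (an_mul (d := 1) (d' := 2)); first exact: an_coord.
  apply: (an_mul (d := 1) (d' := 1)); first exact: an_coord.
  by apply: an_sub0; exact: (hG2 i).1.
apply: an_ext a3 _.
have ht : \forall x \near nb0 R n,
    f (zero_on t x) - f (zero_on s (zero_on t x)) =
    \sum_(i <- s) zero_on t x 0 i * G i (zero_on t x).
  exact: near_comp (@an_zero_on n t) hG.
have fst' : \forall x \near nb0 R n, f (zero_on s (zero_on t x)) = 0.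
  exact: near_comp (@an_zero_on n t) fs.
have h2 : \forall x \near nb0 R n, forall i,
    G i x - G i (zero_on t x) = \sum_(j <- t) x 0 j * G2 i j x.
  by apply: filter_forall => i; exact: (hG2 i).2.
have nI := @filterI _ (nbhs (nb0 R n)) (nb0_filter R n).
have all_near := nI _ _ hG (nI _ _ fs (nI _ _ ft (nI _ _ ht (nI _ _ fst' h2)))).
apply: filterS all_near => x [q1 [q2 [q3 [q4 [q5 q6]]]]].
have e1 : f x = \sum_(i <- s) x 0 i * G i x by rewrite -q1 q2 subr0.
have e2 : \sum_(i <- s) x 0 i * G i (zero_on t x) = 0.
  apply/esym; transitivity (\sum_(i <- s) zero_on t x 0 i * G i (zero_on t x)).
    by rewrite -q4 q5 q3 subr0.
  rewrite big_seq [RHS]big_seq; apply: eq_bigr => i /st.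
  by rewrite mxE => /negbTE ->.
have -> : f x = \sum_(i <- s) \sum_(j <- t) x 0 i * (x 0 j * G2 i j x).
  rewrite e1 -[LHS]subr0 -[X in _ - X = _]e2 -sumrB; apply: eq_bigr => i _.
  by rewrite -mulrBr q6 mulr_sumr.
rewrite -sumrB; apply: eq_bigr => i _; rewrite -sumrB; apply: eq_bigr => j _.
by ring.
Qed.

(** On the polydisc of radius t a germ of order d+1 is O(t ^+ d.+1), which leaves no
    room for a nonzero multiple of t ^+ d. *)
Lemma order_coef n d (f : 'rV[C]_n -> C) v c : an d.+1 f -> cball 1 v ->
  (exists2 r : R, 0 < r & forall t : R, 0 < t -> t <= r ->
    f (t%:C%C *: v) = t%:C%C ^+ d * c) -> c = 0.
Proof.
move=> /an_bound[K [r [K0 r0 hK]]] v1 [r' r'0 fc]; apply: md_small => e e0.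
have K1 : 0 < K + 1 by lra.
pose t := Num.min (Num.min r r') (e / (K + 1)).
have t0 : 0 < t by rewrite !lt_min r0 r'0 divr_gt0.
have tr : t <= r by rewrite !ge_min lexx.
have tr' : t <= r' by rewrite !ge_min lexx orbT.
have te : t <= e / (K + 1) by rewrite ge_min lexx orbT.
have tv : cball t (t%:C%C *: v).
  by move=> i; rewrite mxE mdM md_real gtr0_norm// ler_piMr ?(ltW t0)//; exact: v1.
have := hK t _ t0 tr tv; rewrite fc// mdM mdX md_real gtr0_norm// exprS.
have t2 : 0 < t ^+ d by rewrite exprn_gt0.
have -> : K * (t * t ^+ d) = t ^+ d * (t * K) by ring.
rewrite ler_pM2l// => /le_trans; apply.
move: te; rewrite ler_pdivlMr// mulrDr mulr1; lra.
Qed.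

End MixedTerms.

Section NormalFormTheorem.
Variable R : realType.
Local Notation C := R[i].

(** Removing the Hermitian part from the graphing function leaves a remainder of
    order 3: the function vanishes for z = 0 and for zeta = 0, hence contains no
    other monomial of degree at most 2 than z_j zeta_k. *)
Lemma remainder_order3 (phi : C -> C -> C -> C -> C -> C) (eps : C) :
  an 2 (fun x : 'rV[C]_5 => phi (co x 0) (co x 1) (co x 2) (co x 3) (co x 4)) ->
  (\forall x \near nb0 R 3, phi (co x 0) (co x 1) 0 0 (co x 2) = 0) ->
  (\forall x \near nb0 R 3, phi 0 0 (co x 0) (co x 1) (co x 2) = 0) ->
  an 3 (fun x : 'rV[C]_4 => phi (co x 0) (co x 1) (co x 2) (co x 3) 0
    - (co x 0 * co x 2 + eps * (co x 1 * co x 3))) ->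
  an 3 (fun x : 'rV[C]_5 => phi (co x 0) (co x 1) (co x 2) (co x 3) (co x 4)
    - (co x 0 * co x 2 + eps * (co x 1 * co x 3))).
Proof.
move=> aphi pure pure' second.
pose o k (lt : (k < 5)%N) := Ordinal lt.
pose s := [:: @o 0%N isT; @o 1%N isT]; pose t := [:: @o 2%N isT; @o 3%N isT].
pose f (x : 'rV[C]_5) := phi (co x 0) (co x 1) (co x 2) (co x 3) (co x 4).
have cx (x : 'rV[C]_5) k (lt : (k < 5)%N) : x 0 (o k lt) = co x k by rewrite -coE.
have [|||h ah] := @an_mixed R 5 s t f isT isT _ aphi.
- by move=> i; rewrite !inE => /orP[] /eqP ->.
- have hn := near_vec (s := fun x : 'rV[C]_5 => [:: co x 2; co x 3; co x 4]) pure'.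
  apply: filterS (hn _) => [x|].
    by rewrite !co_vec//= /f !co_zero_on.
  by nth_cases; apply: an_vanishing; an1.
- have hn := near_vec (s := fun x : 'rV[C]_5 => [:: co x 0; co x 1; co x 4]) pure.
  apply: filterS (hn _) => [x|].
    by rewrite !co_vec//= /f !co_zero_on.
  by nth_cases; apply: an_vanishing; an1.
have {}ah : an 3 (fun x => f x - (h (o 0%N isT) (o 2%N isT) * (co x 0 * co x 2)
   + h (o 0%N isT) (o 3%N isT) * (co x 0 * co x 3)
   + h (o 1%N isT) (o 2%N isT) * (co x 1 * co x 2)
   + h (o 1%N isT) (o 3%N isT) * (co x 1 * co x 3))).
  apply: an_eq ah => x; rewrite /s /t !big_cons !big_nil !cx.
  by ring.
move: (h _ _) (h _ _) (h _ _) (h _ _) ah => h13 h12 h03 h02 ah.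
have arestr : forall i, an 1 (fun x : 'rV[C]_4 =>
    vec 5 [:: co x 0; co x 1; co x 2; co x 3; 0] 0 i).
  by apply: an_vec; nth_cases; an1.
have abil : an 3 (fun x : 'rV[C]_4 => (1 - h02) * (co x 0 * co x 2)
   - h03 * (co x 0 * co x 3) - h12 * (co x 1 * co x 2)
   + (eps - h13) * (co x 1 * co x 3)).
  apply: an_eq (an_sub (an_comp ah arestr) second) => x.
  by rewrite /f !co_vec//=; ring.
have coZ n (k : C) (x : 'rV[C]_n) j : co (k *: x) j = k * co x j.
  by rewrite /co; case: insubP => [i _ _|_]; rewrite ?mxE ?mulr0.
(* The coefficients of the quadratic form abil are read off at the basis vectors. *)
have coef (a b c d : C) v : md a <= 1 -> md b <= 1 -> md c <= 1 -> md d <= 1 ->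
    v = (1 - h02) * (a * c) - h03 * (a * d) - h12 * (b * c) + (eps - h13) * (b * d) ->
    v = 0.
  move=> a1 b1 c1 d1 ->; apply: (order_coef (v := vec 4 [:: a; b; c; d]) abil).
    by move=> i; rewrite mxE; case: i => -[|[|[|[|]]]].
  by exists 1 => // u _ _; rewrite !coZ !co_vec//=; ring.
have m0 : md 0 <= 1 :> R by rewrite md0.
have m1 : md 1 <= 1 :> R by rewrite md1.
have q02 : 1 - h02 = 0 by apply: (coef 1 0 1 0) => //; ring.
have q03 : h03 = 0 by apply/eqP; rewrite -oppr_eq0; apply/eqP/(coef 1 0 0 1) => //; ring.
have q12 : h12 = 0 by apply/eqP; rewrite -oppr_eq0; apply/eqP/(coef 0 1 1 0) => //; ring.
have q13 : eps - h13 = 0 by apply: (coef 0 1 0 1) => //; ring.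
apply: an_eq ah => x; rewrite q03 q12 -(subr0_eq q02) -(subr0_eq q13) /f.
by ring.
Qed.

(** Normal coordinates for a hypersurface given by a Hermitian equation whose
    linear part is - Im w.  W and V are inverse changes of the transversal
    variable, and phi is the graphing function in the new coordinates. *)
Theorem normal_form (N : 'rV[C]_6 -> C) (eps : C) :
  (forall a b c d e f : C,
    N (vec 6 [:: d^*; e^*; f^*; a^*; b^*; c^*]) = (N (vec 6 [:: a; b; c; d; e; f]))^*) ->
  an 2 (fun X => N X - 'i / 2 * (co X 2 - co X 5)) ->
  an 3 (fun x : 'rV[C]_4 =>
    N (vec 6 [:: co x 0; co x 1; 0; co x 2; co x 3; 0])
    - N (vec 6 [:: co x 0; co x 1; 0; 0; 0; 0])
    - N (vec 6 [:: 0; 0; 0; co x 2; co x 3; 0])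
    - (co x 0 * co x 2 + eps * (co x 1 * co x 3))) ->
  exists (W V : C -> C -> C -> C) (phi : C -> C -> C -> C -> C -> C),
  [/\ [/\ an 1 (fun x : 'rV[C]_3 => W (co x 0) (co x 1) (co x 2)),
      an 1 (fun x : 'rV[C]_3 => V (co x 0) (co x 1) (co x 2)),
      \forall x \near nb0 R 3, V (co x 0) (co x 1) (W (co x 0) (co x 1) (co x 2)) = co x 2 &
      \forall x \near nb0 R 3, W (co x 0) (co x 1) (V (co x 0) (co x 1) (co x 2)) = co x 2],
    [/\ an 3 (fun x : 'rV[C]_5 => phi (co x 0) (co x 1) (co x 2) (co x 3) (co x 4)
          - (co x 0 * co x 2 + eps * (co x 1 * co x 3))),
      \forall x \near nb0 R 5, phi (co x 2)^* (co x 3)^* (co x 0)^* (co x 1)^* (co x 4)^* =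
        (phi (co x 0) (co x 1) (co x 2) (co x 3) (co x 4))^*,
      \forall x \near nb0 R 3, phi (co x 0) (co x 1) 0 0 (co x 2) = 0 &
      \forall x \near nb0 R 3, phi 0 0 (co x 0) (co x 1) (co x 2) = 0] &
    \forall x \near nb0 R 3, let H := V (co x 0) (co x 1) (co x 2) in
      N (vec 6 [:: co x 0; co x 1; co x 2; (co x 0)^*; (co x 1)^*; (co x 2)^*]) = 0 <->
      'Im H = phi (co x 0) (co x 1) (co x 0)^* (co x 1)^* ('Re H)].
Proof.
move=> Nherm aE Nmix.
have [psi [apsi hpsi]] := axis aE.
have [W [aW hW]] := segre_solution aE apsi.
have [V [aV hV]] := segre_coordinate aE apsi.
have [phi [aphi hphi]] := defining_function aE aW.
have drop (F : C -> C -> C -> C) :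
    an 2 (fun x : 'rV[C]_3 => F (co x 0) (co x 1) (co x 2) - co x 2) ->
    an 1 (fun x : 'rV[C]_3 => F (co x 0) (co x 1) (co x 2)).
  move=> aF; apply: an_eq (an_add (an_weak (ltnW (ltnSn 1)) aF) (an_co _ _ 2)) => x.
  by rewrite subrK.
have pure := phi_pure Nherm apsi hpsi aW hW hphi.
have pure' := phi_pure_conj Nherm apsi hpsi aW hW aphi hphi.
exists W, V, phi; split; [split|split|].
- exact: drop.
- exact: drop.
- exact: (@WK R N psi W aW hW V hV).
- exact: (@VK R N psi W hW V aV hV).
- apply: remainder_order3 => //.
  exact: (@phi_second_order R N eps Nherm aE Nmix psi apsi W aW hW phi aphi hphi).
- exact: (@phi_conj R N Nherm W phi aphi hphi).
- exact: pure.
- exact: pure'.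
- exact: (@graph_equation R N psi W hW V aV hV phi hphi).
Qed.
End NormalFormTheorem.

(** * First and second order jets *)

Section Jets.
Variable R : realType.
Local Notation C := R[i].

Definition linear_form n (b : 'I_n -> C) (X : 'rV[C]_n) : C := \sum_i b i * X 0 i.

Lemma an_linear n (b : 'I_n -> C) : an 1 (linear_form b).
Proof. by apply: an_sum => i _; apply/an_scale/an_coord. Qed.

(** The value c and the differential b of f at 0. *)
Definition jet1 n (f : 'rV[C]_n -> C) (c : C) (b : 'I_n -> C) : Prop :=
  an 2 (fun X => f X - (c + linear_form b X)).

Lemma hadamard_full n d (f : 'rV[C]_n -> C) : an d.+1 f ->
  exists G : 'I_n -> 'rV[C]_n -> C, (forall i, an d (G i)) /\
    \forall x \near nb0 R n, f x = \sum_i x 0 i * G i x.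
Proof.
move=> af; have [G [aG hG]] := an_hadamard (enum_uniq 'I_n) af.
exists G; split=> //; apply: filterS hG => x.
rewrite big_enum /= => <-; rewrite (_ : zero_on _ x = 0) ?(an_at0 af) ?subr0//.
by apply/rowP => j; rewrite !mxE mem_enum.
Qed.

Lemma jet1_exists n (f : 'rV[C]_n -> C) : an 0 f -> exists b, jet1 f (f 0) b.
Proof.
move=> af; have [G [aG hG]] := hadamard_full (an_sub0 af).
exists (fun i => G i 0).
have : an 2 (fun x => \sum_i x 0 i * (G i x - G i 0)).
  apply: an_sum => i _; apply: (an_mul (d := 1) (d' := 1)); first exact: an_coord.
  exact: an_sub0.
move=> h; apply: an_ext h _; apply: filterS hG => x hx.
rewrite opprD addrA hx /linear_form -sumrB; apply: eq_bigr => i _; ring.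
Qed.

Lemma jet1_val n (f : 'rV[C]_n -> C) c b : jet1 f c b -> f 0 = c.
Proof.
move=> /an_at0; rewrite (_ : linear_form b 0 = 0) ?addr0; first by move/subr0_eq.
by rewrite /linear_form big1// => i _; rewrite mxE mulr0.
Qed.

Lemma jet1_an n (f : 'rV[C]_n -> C) c b : jet1 f c b -> an 0 f.
Proof.
move=> h; have := an_add (an_weak (leq0n 2) h) (an_add (an_const n c)
  (an_weak (leq0n 1) (an_linear b))).
by apply: an_eq => x; rewrite subrK.
Qed.

Lemma jet1_mul n (f g : 'rV[C]_n -> C) c d b b' : jet1 f c b -> jet1 g d b' ->
  jet1 (fun X => f X * g X) (c * d) (fun i => b i * d + c * b' i).
Proof.
move=> jf jg; have ag := jet1_an jg.
have a1 := an_mul jf ag; have a2 := an_scale c jg.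
have a3 := an_mul (an_linear b) (an_add (an_weak (ltnW (ltnSn 1)) jg) (an_linear b')).
apply: an_eq (an_add (an_add a1 a2) a3) => X.
have -> : linear_form (fun i => b i * d + c * b' i) X =
    linear_form b X * d + c * linear_form b' X.
  rewrite /linear_form mulr_suml mulr_sumr -big_split /=; apply: eq_bigr => i _.
  ring.
ring.
Qed.

Lemma jet1_sum n (I : finType) (f : I -> 'rV[C]_n -> C) c b :
  (forall k, jet1 (f k) (c k) (b k)) ->
  jet1 (fun X => \sum_k f k X) (\sum_k c k) (fun i => \sum_k b k i).
Proof.
move=> jf.
have h : an 2 (fun X => \sum_k (f k X - (c k + linear_form (b k) X))).
  by apply: an_sum => k _; exact: jf.
apply: an_eq h => X.
rewrite sumrB big_split /=; congr (_ - (_ + _)).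
rewrite /linear_form exchange_big /=; apply: eq_bigr => i _.
by rewrite mulr_suml.
Qed.

(** Taylor expansion of order 2, together with an expansion of the first
    derivatives that is uniform in the base point Y.  Both are read off from the
    expansion of the polynomial part and from the increments of the part of
    order 3. *)
Lemma second_jet n (F : 'rV[C]_n -> C) (l : 'I_n -> C) (e : 'I_n -> 'I_n -> C) :
  an 3 (fun X => F X - (linear_form l X + \sum_i \sum_j e i j * (X 0 i * X 0 j))) ->
  exists dF : 'I_n -> 'rV[C]_n -> C,
    (forall i, jet1 (dF i) (l i) (fun j => e i j + e j i)) /\
    exists K r : R, [/\ 0 <= K, 0 < r & forall Y X s, cball r Y -> cball s X ->
      0 < s -> s <= r ->
      md (F (Y + X) - F Y - \sum_i X 0 i * dF i Y) <= K * s ^+ 2].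
Proof.
set T := fun X => _ => aT.
have [G [aG hG]] := an_increments aT.
pose s := [seq rshift n i | i <- enum 'I_n].
have us : uniq s by rewrite map_inj_uniq ?enum_uniq//; exact: rshift_inj.
have /choice[G2 hG2] i := an_hadamard us (aG i).
pose dT i (Y : 'rV[C]_n) := G i (row_mx Y 0).
have adT i : an 2 (dT i).
  apply: an_comp (aG i) _; apply: row_mxP; first exact: an_coord.
  by move=> j; apply: an_eq (an_zero _ _ _) => x; rewrite mxE.
exists (fun i (Y : 'rV[C]_n) => l i + \sum_j (e i j + e j i) * Y 0 j + dT i Y); split.
  by move=> i; apply: an_eq (adT i) => Y; rewrite /linear_form addrC addKr.
(* M is the bounded germ with F (Y + X) - F Y - dF Y X = \sum X_i X_j M i j (Y, X). *)
pose M i j (Z : 'rV[C]_(n + n)) := e i j + G2 i (rshift n j) Z.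
have aM i j : an 0 (M i j).
  by apply: an_add; [exact: an_const|exact: an_weak (leq0n 1) ((hG2 i).1 _)].
have bM : exists K r : R, [/\ 0 <= K, 0 < r & forall Z, cball r Z -> forall i j, md (M i j Z) <= K].
  have /choice[kr hkr] (p : 'I_n * 'I_n) := an_bound (aM p.1 p.2).
  have /choice[rr hrr] := hkr.
  exists (\sum_p `|kr p|), (\big[Num.min/1]_p rr p); split.
  - by apply: sumr_ge0.
  - by apply: lt_bigmin => // p _; case: (hrr p).
  - move=> Z Zr i j; have [k0 r0 h] := hrr (i, j).
    apply: (@le_trans _ _ `|kr (i, j)|); last first.
      by rewrite (bigD1 (i, j))//= lerDl sumr_ge0.
    have := h (rr (i, j)) Z r0 (lexx _); rewrite expr0 mulr1 => h2.
    apply: le_trans (h2 _) (ler_norm _); apply: cballW Zr; exact: bigmin_le.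
have [K [r1 [K0 r10 hK]]] := bM.
have /(@filter_forall _ _ _ _ _)[r2 [r20 h2]] i := (hG2 i).2.
have [r3 [r30 h3]] := hG.
exists ((n * n)%:R * K), (Num.min r1 (Num.min r2 r3)); split.
- by rewrite mulr_ge0.
- by rewrite !lt_min r10 r20.
move=> Y X u Yr Xu u0 ur.
have Zr : cball (Num.min r1 (Num.min r2 r3)) (row_mx Y X).
  move=> i; case: (split_ordP i) => j ->; rewrite ?row_mxEl ?row_mxEr//.
  exact: le_trans (Xu j) ur.
have Zr1 : cball r1 (row_mx Y X) by apply: cballW Zr; rewrite ge_min lexx.
have Zr2 : cball r2 (row_mx Y X) by apply: cballW Zr; rewrite !ge_min lexx orbT.
have Zr3 : cball r3 (row_mx Y X) by apply: cballW Zr; rewrite !ge_min lexx !orbT.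
have e3 := h3 _ Zr3; have e2 := h2 _ Zr2; rewrite row_mxKl row_mxKr in e3.
have z0 : zero_on s (row_mx Y X) = row_mx Y 0.
  apply/rowP => i; rewrite mxE; case: (split_ordP i) => j ->.
    rewrite !row_mxEl; case: ifP => // /mapP[k _ /eqP].
    by rewrite eq_lrshift.
  by rewrite !row_mxEr mxE map_f ?mem_enum.
have key : F (Y + X) - F Y - \sum_i X 0 i * (l i + \sum_j (e i j + e j i) * Y 0 j + dT i Y)
    = \sum_i \sum_j X 0 i * X 0 j * M i j (row_mx Y X).
  have FE W : F W = linear_form l W + \sum_i \sum_j e i j * (W 0 i * W 0 j) + T W.
    by rewrite /T addrC subrK.
  have linD : linear_form l (Y + X) = linear_form l Y + linear_form l X.
    by rewrite -big_split /=; apply: eq_bigr => i _; rewrite mxE mulrDr.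
  pose A := \sum_i \sum_j e i j * (X 0 i * Y 0 j).
  pose B := \sum_i \sum_j e j i * (X 0 i * Y 0 j).
  pose D := \sum_i \sum_j e i j * (X 0 i * X 0 j).
  have BE : B = \sum_i \sum_j e i j * (Y 0 i * X 0 j).
    rewrite /B exchange_big /=; apply: eq_bigr => i _; apply: eq_bigr => j _.
    by rewrite [X 0 j * _]mulrC.
  have quadD : \sum_i \sum_j e i j * ((Y + X) 0 i * (Y + X) 0 j) =
      \sum_i \sum_j e i j * (Y 0 i * Y 0 j) + A + B + D.
    rewrite BE /A /D -!big_split /=; apply: eq_bigr => i _.
    by rewrite -!big_split /=; apply: eq_bigr => j _; rewrite !mxE; ring.
  have gradE : \sum_i X 0 i * (l i + \sum_j (e i j + e j i) * Y 0 j + dT i Y) =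
      linear_form l X + A + B + \sum_i X 0 i * dT i Y.
    rewrite /linear_form /A /B -!big_split /=; apply: eq_bigr => i _.
    rewrite !mulrDr [X 0 i * l i]mulrC -!addrA; congr (_ + _); rewrite addrA.
    congr (_ + _); rewrite mulr_sumr -big_split /=; apply: eq_bigr => j _.
    ring.
  have rhsE : \sum_i \sum_j X 0 i * X 0 j * M i j (row_mx Y X) =
      D + \sum_i X 0 i * (G i (row_mx Y X) - dT i Y).
    rewrite /D -big_split /=; apply: eq_bigr => i _.
    rewrite /dT -z0 e2 /s big_map big_enum /= mulr_sumr -big_split /=.
    apply: eq_bigr => j _; rewrite row_mxEr /M; ring.
  have TE : T (Y + X) = T Y + \sum_i X 0 i * G i (row_mx Y X) by rewrite -e3 [RHS]addrC subrK.
  have GE : \sum_i X 0 i * (G i (row_mx Y X) - dT i Y) =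
      \sum_i X 0 i * G i (row_mx Y X) - \sum_i X 0 i * dT i Y.
    by rewrite -sumrB; apply: eq_bigr => i _; rewrite mulrBr.
  rewrite rhsE GE gradE !FE linD quadD TE; ring.
rewrite key; apply: le_trans (md_sum _ _ _) _.
apply: (@le_trans _ _ (\sum_(i < n) \sum_(j < n) K * u ^+ 2)); last first.
  by rewrite !sumr_const !card_ord -mulrnA -mulrA mulr_natl.
apply: ler_sum => i _; apply: le_trans (md_sum _ _ _) _; apply: ler_sum => j _.
rewrite !mdM mulrC; apply: ler_pM; rewrite ?mulr_ge0 ?md_ge0//.
  exact: hK.
by rewrite expr2; apply: ler_pM; rewrite ?md_ge0.
Qed.
End Jets.

(** * Wirtinger derivatives and complexification *)

Section RealDerivatives.
Variable R : realType.
Local Notation C := R[i].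
Local Notation C3 := 'rV[C]_3.

Lemma derive1_expansion (h : R -> R) a K r : 0 < r ->
  (forall t : R, `|t| <= r -> `|h t - h 0 - t * a| <= K * `|t| ^+ 2) -> derive1 h 0 = a.
Proof.
move=> r0 hh; rewrite /derive1; apply/cvg_lim => //; apply/cvgrPdist_le => e e0.
have K1 : 0 < `|K| + 1 by have := normr_ge0 K; lra.
pose d := Num.min r (e / (`|K| + 1)).
have d0 : 0 < d by rewrite lt_min r0 divr_gt0.
exists d => //= t; rewrite /= sub0r normrN => td t0.
have tr : `|t| <= r by apply: le_trans (ltW td) _; rewrite ge_min lexx.
have te : `|t| <= e / (`|K| + 1) by apply: le_trans (ltW td) _; rewrite ge_min lexx orbT.
have tp : 0 < `|t| by rewrite normr_gt0.
rewrite addr0 -[_ *: _]/(_ * _) -(ler_pM2l tp) -normrM mulrBr mulVKf// distrC.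
apply: le_trans (hh t tr) _; rewrite expr2 mulrCA ler_pM2l//.
move: te; rewrite ler_pdivlMr// => te.
have : K * `|t| <= `|K| * `|t| by rewrite ler_wpM2r// ler_norm.
lra.
Qed.

Lemma conj_real_complex (t : R) : (t%:C%C)^* = t%:C%C.
Proof. by apply: conj_Creal; apply/complex_realP; exists t. Qed.

(** The points of C^6 whose last three coordinates are conjugate to the first
    three; germs on C^6 restricted to them are the real analytic germs on C^3. *)
Definition real_vec (x : C3) : 'rV[C]_(3 + 3) := row_mx x (conj_mx x).

Lemma real_derivative_expansion (f : C3 -> C) (p v : C3) (a : C) K r : 0 < r ->
  (forall t : R, `|t| <= r -> md (f (p + t%:C%C *: v) - f p - t%:C%C * a) <= K * `|t| ^+ 2) ->
  real_derivative f v p = a.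
Proof.
move=> r0 h; rewrite /real_derivative [RHS](_ : a = Complex (complex.Re a) (complex.Im a)); last by case: a {h}.
have p0 : p + 0%:C%C *: v = p by rewrite scale0r addr0.
congr Complex; apply: (@derive1_expansion _ _ K r r0) => t tr; rewrite p0;
  apply: le_trans (h t tr); move: (f (p + _)) (f p) => [x1 x2] [y1 y2].
  apply: le_trans (md_Re _); rewrite le_eqVlt; apply/orP; left; apply/eqP; congr `|_|.
  by case: a {h} => a1 a2 /=; ring.
apply: le_trans (md_Im _); rewrite le_eqVlt; apply/orP; left; apply/eqP; congr `|_|.
by case: a {h} => a1 a2 /=; ring.
Qed.

(** The expansion is evaluated along the real and imaginary coordinate directions,
    and the Wirtinger combinations separate the two halves of b. *)
Lemma differential_expansion (f : C3 -> C) (p : C3) (b : 'I_(3 + 3) -> C) K r :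
  0 < r -> (forall x s, cball s x -> 0 < s -> s <= r ->
    md (f (p + x) - f p - linear_form b (real_vec x)) <= K * s ^+ 2) ->
  differential f p = \col_i b i.
Proof.
move=> r0 h.
have rd v : cball 1 v -> real_derivative f v p = linear_form b (real_vec v).
  move=> v1; apply: (@real_derivative_expansion _ _ _ _ K r r0) => t tr.
  have -> : t%:C%C * linear_form b (real_vec v) = linear_form b (real_vec (t%:C%C *: v)).
    rewrite /linear_form mulr_sumr; apply: eq_bigr => i _; rewrite /real_vec.
    case: (split_ordP i) => j ->; rewrite ?row_mxEl ?row_mxEr !mxE ?rmorphM /=.
      by ring.
    by rewrite conj_real_complex; ring.
  have [->|t0] := eqVneq t 0.
    rewrite scale0r addr0 subrr normr0 expr0n mulr0 /linear_form big1 ?subr0 ?md0// => i _.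
    by rewrite /real_vec; case: (split_ordP i) => j ->; rewrite ?row_mxEl ?row_mxEr !mxE ?rmorph0 mulr0.
  apply: h => //; last by rewrite normr_gt0.
  by move=> i; rewrite mxE mdM md_real ler_piMr//; exact: v1.
have lf (v : C3) j k : v = k *: delta_mx 0 j ->
    linear_form b (real_vec v) = k * b (lshift 3 j) + k^* * b (rshift 3 j).
  move=> ->; rewrite /linear_form big_split_ord /=; congr (_ + _).
    rewrite (bigD1 j)//= big1 => [|i ij]; rewrite row_mxEl !mxE eqxx ?eqxx /=.
      by rewrite addr0 mulr1 mulrC.
    by rewrite (negbTE ij) !mulr0.
  rewrite (bigD1 j)//= big1 => [|i ij]; rewrite row_mxEr !mxE eqxx ?eqxx /=.
    by rewrite addr0 mulr1 mulrC.
  by rewrite (negbTE ij) mulr0 rmorph0 mulr0.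
have d1 j : cball 1 (delta_mx 0 j : C3).
  by move=> i; rewrite mxE; case: (_ && _); rewrite ?md1 ?md0.
have di j : cball 1 ('i *: delta_mx 0 j : C3).
  by move=> i; rewrite mxE mdM md_i mul1r; exact: d1.
have r1 j : real_derivative f (delta_mx 0 j) p = b (lshift 3 j) + b (rshift 3 j).
  by rewrite rd// (@lf _ j 1) ?scale1r// rmorph1 !mul1r.
have ri j : real_derivative f ('i *: delta_mx 0 j) p = 'i * b (lshift 3 j) - 'i * b (rshift 3 j).
  by rewrite rd// (@lf _ j 'i)// conjCi mulNr.
have two : 2 != 0 :> C by rewrite pnatr_eq0.
have ii (y z : C) : 'i * ('i * y - 'i * z) = z - y.
  by rewrite -mulrBr mulrA -expr2 sqrCi mulN1r opprB.
apply/colP => i; rewrite /differential; case: (split_ordP i) => j ->.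
  rewrite col_mxEu !mxE /d_z r1 ri ii.
  by field.
rewrite col_mxEd !mxE /d_zbar r1 ri ii.
by field.
Qed.
End RealDerivatives.

Section Complexification.
Variable R : realType.
Local Notation C := R[i].
Local Notation C3 := 'rV[C]_3.
Local Notation C6 := 'rV[C]_(3 + 3).

Lemma near_at0 n (P : set 'rV[C]_n) : (\forall x \near nb0 R n, P x) -> P 0.
Proof. by move=> [r [r0]]; apply=> i; rewrite mxE md0 ltW. Qed.

Lemma cball_real_vec s (x : C3) : cball s x -> cball s (real_vec x).
Proof.
move=> xs i; case: (split_ordP i) => j ->; rewrite ?row_mxEl ?row_mxEr//.
by rewrite mxE md_conj.
Qed.

Lemma real_vecD (x y : C3) : real_vec (x + y) = real_vec x + real_vec y.
Proof.
rewrite /real_vec add_row_mx; congr row_mx; apply/rowP => i.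
by rewrite !mxE rmorphD.
Qed.

Lemma real_vec0 : real_vec (0 : C3) = 0.
Proof.
rewrite /real_vec (_ : conj_mx 0 = 0) ?row_mx0//; apply/rowP => i.
by rewrite !mxE rmorph0.
Qed.

(** Exchange of the coordinates with their conjugates, on indices. *)
Definition tau (i : 'I_(3 + 3)) : 'I_(3 + 3) :=
  match fintype.split i with inl j => rshift 3 j | inr j => lshift 3 j end.

Lemma tau_l (j : 'I_3) : tau (lshift 3 j) = rshift 3 j.
Proof. by rewrite /tau (unsplitK (inl j)). Qed.

Lemma tau_r (j : 'I_3) : tau (rshift 3 j) = lshift 3 j.
Proof. by rewrite /tau (unsplitK (inr j)). Qed.

Lemma tauK : involutive tau.
Proof. by move=> i; case: (split_ordP i) => j ->; rewrite ?(tau_l, tau_r). Qed.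

Lemma conj_vectorE (X : C6) i : conj_vector X 0 i = (X 0 (tau i))^*.
Proof.
rewrite /conj_vector; case: (split_ordP i) => j ->.
  by rewrite row_mxEl tau_l !mxE.
by rewrite row_mxEr tau_r !mxE.
Qed.

Lemma conj_vectorK : involutive (@conj_vector R).
Proof. by move=> X; apply/rowP => i; rewrite !conj_vectorE tauK conjCK. Qed.

Lemma conj_vectorD (X Y : C6) : conj_vector (X + Y) = conj_vector X + conj_vector Y.
Proof. by apply/rowP => i; rewrite [RHS]mxE !conj_vectorE mxE rmorphD. Qed.

Lemma conj_vectorZ k (X : C6) : conj_vector (k *: X) = k^* *: conj_vector X.
Proof. by apply/rowP => i; rewrite [RHS]mxE !conj_vectorE mxE rmorphM. Qed.

Lemma conj_real_vec (x : C3) : conj_vector (real_vec x) = real_vec x.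
Proof.
apply/rowP => i; rewrite conj_vectorE /real_vec; case: (split_ordP i) => j ->.
  by rewrite tau_l row_mxEr row_mxEl mxE conjCK.
by rewrite tau_r row_mxEl row_mxEr mxE.
Qed.

Lemma real_vecP (V : C6) : conj_vector V = V -> V = real_vec (lsubmx V).
Proof.
move=> VV; rewrite -[LHS]hsubmxK /real_vec; congr row_mx; apply/rowP => j.
by rewrite -[in LHS]VV /conj_vector row_mxKr.
Qed.

Lemma linear_formD n (b : 'I_n -> C) X Y :
  linear_form b (X + Y) = linear_form b X + linear_form b Y.
Proof. by rewrite -big_split /=; apply: eq_bigr => i _; rewrite mxE mulrDr. Qed.

Lemma linear_formZ n (b : 'I_n -> C) k X : linear_form b (k *: X) = k * linear_form b X.
Proof. by rewrite mulr_sumr; apply: eq_bigr => i _; rewrite mxE mulrCA. Qed.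

Lemma linear_form_conj (b : 'I_(3 + 3) -> C) X : (forall i, b (tau i) = (b i)^*) ->
  linear_form b (conj_vector X) = (linear_form b X)^*.
Proof.
move=> bt; rewrite /linear_form rmorph_sum /= (reindex_inj (inv_inj tauK)) /=.
by apply: eq_bigr => i _; rewrite conj_vectorE tauK bt rmorphM.
Qed.

Lemma an_conj_vector d (F : C6 -> C) : an d F -> an d (fun X => (F (conj_vector X))^*).
Proof.
move=> aF; pose sw (X : C6) : C6 := row_mx (rsubmx X) (lsubmx X).
have asw i : an 1 (fun X => sw X 0 i).
  apply: row_mxP => j.
    by apply: an_eq (an_coord _ (rshift 3 j)) => X; rewrite mxE.
  by apply: an_eq (an_coord _ (lshift 3 j)) => X; rewrite mxE.
apply: an_eq (an_comp (an_conj aF) asw) => X; congr (F _)^*.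
apply/rowP => i; rewrite conj_vectorE /sw mxE; case: (split_ordP i) => j ->.
  by rewrite tau_l row_mxEl mxE.
by rewrite tau_r row_mxEr mxE.
Qed.

Definition quadratic n (e : 'I_n -> 'I_n -> C) (X : 'rV[C]_n) : C :=
  \sum_i \sum_j e i j * (X 0 i * X 0 j).

Lemma an_quadratic n (e : 'I_n -> 'I_n -> C) : an 2 (quadratic e).
Proof.
apply: an_sum => i _; apply: an_sum => j _; apply: an_scale.
by apply: (an_mul (d := 1) (d' := 1)); exact: an_coord.
Qed.

(** The power series in x and its conjugate is averaged with its image under
    conjugation, which has the same values at the points real_vec x since f is
    real. *)
Lemma hermitian_extension (f : C3 -> C) : real_analytic_at f 0 -> f 0 = 0 ->
  (forall x, (f x)^* = f x) ->
  exists P l e, [/\ \forall x \near nb0 R 3, f x = P (real_vec x),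
    forall X, P (conj_vector X) = (P X)^*,
    an 3 (fun X => P X - (linear_form l X + quadratic e X)),
    forall i, l (tau i) = (l i)^* &
    forall i j, e (tau i) (tau j) = (e i j)^*].
Proof.
move=> /real_analytic_an[P0 aP0 fP0] f0 fr.
pose P X := 2^-1 * (P0 X + (P0 (conj_vector X))^*).
have two : 2 != 0 :> C by rewrite pnatr_eq0.
have c2 : (2^-1 : C)^* = 2^-1 by rewrite fmorphV rmorph_nat.
have Ph X : P (conj_vector X) = (P X)^*.
  by rewrite /P conj_vectorK rmorphM rmorphD /= conjCK c2 [P0 _ + _]addrC.
have fP : \forall x \near nb0 R 3, f x = P (real_vec x).
  apply: filterS fP0 => x hx; rewrite /P conj_real_vec -hx fr.
  by field.
have aP : an 0 P by apply/an_scale/an_add => //; exact: an_conj_vector.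
have P0z : P 0 = 0 by rewrite -real_vec0 -(near_at0 fP).
have aP1 : an 1 P.
  by apply: an_eq (an_sub0 aP) => X; rewrite P0z subr0.
have [G [aG hG]] := hadamard_full aP1.
have /choice[G2 hG2] i := hadamard_full (an_sub0 (aG i)).
have near2 : \forall x \near nb0 R (3 + 3), forall i, G i x - G i 0 = \sum_j x 0 j * G2 i j x.
  by apply: filter_forall => i; exact: (hG2 i).2.
have a3 : an 3 (fun X : C6 => \sum_i \sum_j X 0 i * (X 0 j * (G2 i j X - G2 i j 0))).
  apply: an_sum => i _; apply: an_sum => j _.
  apply: (an_mul (d := 1) (d' := 2)); first exact: an_coord.
  apply: (an_mul (d := 1) (d' := 1)); first exact: an_coord.
  by apply: an_sub0; exact: (hG2 i).1.
pose l i := G i 0; pose e i j := G2 i j 0.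
have aT : an 3 (fun X => P X - (linear_form l X + quadratic e X)).
  apply: an_ext a3 _; apply: filterS2 hG near2 => X -> h2.
  rewrite opprD addrA /linear_form /quadratic -!sumrB; apply: eq_bigr => i _.
  have -> : X 0 i * G i X - l i * X 0 i = \sum_j X 0 i * (X 0 j * G2 i j X).
    by rewrite -mulr_sumr -h2 /l; ring.
  by rewrite -sumrB; apply: eq_bigr => j _; rewrite /e; ring.
pose l' i := 2^-1 * (l i + (l (tau i))^*).
pose e' i j := 2^-1 * (e i j + (e (tau i) (tau j))^*).
exists P, l', e'; split=> //.
- apply: an_eq (an_scale 2^-1 (an_add aT (an_conj_vector aT))) => X.
  rewrite Ph rmorphB rmorphD /= conjCK.
  have -> : (linear_form l (conj_vector X))^* = linear_form (fun i => (l (tau i))^*) X.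
    rewrite /linear_form rmorph_sum /= (reindex_inj (inv_inj tauK)) /=.
    by apply: eq_bigr => i _; rewrite rmorphM /= conj_vectorE tauK conjCK.
  have -> : (quadratic e (conj_vector X))^* = quadratic (fun i j => (e (tau i) (tau j))^*) X.
    rewrite /quadratic rmorph_sum /= (reindex_inj (inv_inj tauK)) /=.
    apply: eq_bigr => i _; rewrite rmorph_sum /= (reindex_inj (inv_inj tauK)) /=.
    by apply: eq_bigr => j _; rewrite !rmorphM /= !conj_vectorE !tauK !conjCK.
  have -> : linear_form l' X = 2^-1 * (linear_form l X + linear_form (fun i => (l (tau i))^*) X).
    rewrite /linear_form -big_split mulr_sumr /=; apply: eq_bigr => i _; rewrite /l'; ring.
  have -> : quadratic e' X = 2^-1 * (quadratic e X + quadratic (fun i j => (e (tau i) (tau j))^*) X).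
    rewrite /quadratic -big_split mulr_sumr /=; apply: eq_bigr => i _.
    rewrite -big_split mulr_sumr /=; apply: eq_bigr => j _; rewrite /e'; ring.
  by field.
- by move=> i; rewrite /l' tauK rmorphM rmorphD /= conjCK c2 [X in _ = _ * X]addrC.
- by move=> i j; rewrite /e' !tauK rmorphM rmorphD /= conjCK c2 [X in _ = _ * X]addrC.
Qed.

(** The Wirtinger derivatives of a real analytic germ are the derivatives of its
    complexification. *)
Lemma differential_jet (f : C3 -> C) (G : C6 -> C) c b :
  (\forall x \near nb0 R 3, f x = G (real_vec x)) -> jet1 G c b ->
  differential f 0 = \col_i b i.
Proof.
move=> fG jG; have [K [r1 [K0 r10 hK]]] := an_bound jG.
have [r2 [r20 h2]] := fG.
have f0 : f 0 = c by rewrite (near_at0 fG) real_vec0 (jet1_val jG).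
apply: (@differential_expansion _ _ _ _ K (Num.min r1 r2)).
  by rewrite lt_min r10.
move=> x s xs s0 sr; have s1 : s <= r1 by apply: le_trans sr _; rewrite ge_min lexx.
have s2 : s <= r2 by apply: le_trans sr _; rewrite ge_min lexx orbT.
rewrite add0r f0 h2; last exact: cballW xs.
by rewrite -addrA -opprD; apply: hK => //; exact: cball_real_vec.
Qed.

End Complexification.

(** * Derivatives tangential to a hypersurface *)

Section TangentialDerivatives.
Variable R : realType.
Local Notation C := R[i].
Local Notation C3 := 'rV[C]_3.
Local Notation C6 := 'rV[C]_(3 + 3).

Variables (M : set C3) (P : C6 -> C) (l : 'I_(3 + 3) -> C) (e : 'I_(3 + 3) -> 'I_(3 + 3) -> C).
Hypothesis MP : \forall x \near nb0 R 3, M x <-> P (real_vec x) = 0.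
Hypothesis Ph : forall X, P (conj_vector X) = (P X)^*.
Hypothesis Pjet : an 3 (fun X => P X - (linear_form l X + quadratic e X)).
Hypothesis lh : forall i, l (tau i) = (l i)^*.

Let Plin : an 2 (fun X => P X - linear_form l X).
Proof.
apply: an_eq (an_add (an_weak (ltnW (ltnSn 2)) Pjet) (an_quadratic e)) => X.
by rewrite opprD addrA subrK.
Qed.

Section Transversal.
Variable i0 : 'I_(3 + 3).
Hypothesis li0 : l i0 != 0.

(* The gradient, a real direction in which the derivative of the equation does not
   vanish: curves in M are sought as t V + y(t) n0. *)
Let n0 : C3 := \row_j (l (lshift 3 j))^*.
Let lam := linear_form l (real_vec n0).

Let lam0 : lam != 0.
Proof.
have lamE : lam = 2 * \sum_j `|l (lshift 3 j)| ^+ 2.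
  rewrite /lam /linear_form big_split_ord /= mulr_natl mulr2n; congr (_ + _).
    by apply: eq_bigr => j _; rewrite row_mxEl mxE normCK.
  apply: eq_bigr => j _; rewrite row_mxEr !mxE conjCK -tau_l lh normCK mulrC.
  by [].
rewrite lamE mulf_neq0 ?pnatr_eq0// psumr_neq0//.
have [j lj] : exists j, l (lshift 3 j) != 0.
  case: (split_ordP i0) => j ij; first by exists j; rewrite -ij.
  by exists j; move: li0; rewrite ij -tau_l lh conjC_eq0.
apply/hasP; exists j; rewrite ?mem_index_enum//=.
by rewrite exprn_gt0// normr_gt0.
Qed.

(* For real V tangent to M there is a curve in M with tangent V at 0, obtained by
   solving the equation for the multiple of n0; the derivative of G along it
   vanishes. *)
Let vanish_real G c b (V : C6) : jet1 G c b ->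
  (\forall x \near nb0 R 3, M x -> G (real_vec x) = 0) ->
  conj_vector V = V -> cball 1 V -> linear_form l V = 0 -> linear_form b V = 0.
Proof.
move=> jG GM VV V1 lV; pose n := real_vec n0.
pose F (Z : 'rV[C]_(1 + 1)) := P (co Z 0 *: V + co Z 1 *: n).
have [||g [ag ag2 hg]] := @implicit_germ R 1 lam (fun=> 0) F lam0.
- exact: an_zero.
- have aVn i : an 1 (fun Z : 'rV[C]_(1 + 1) => (co Z 0 *: V + co Z 1 *: n) 0 i).
    apply: an_eq (an_add (an_scale (V 0 i) (an_co _ _ 0)) (an_scale (n 0 i) (an_co _ _ 1))) => Z.
    by rewrite !mxE; congr (_ + _); rewrite mulrC.
  apply: an_eq (an_comp Plin aVn) => Z.
  rewrite linear_formD !linear_formZ lV mulr0 add0r addr0 -/lam /F.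
  by rewrite [co Z 1 * _]mulrC.
pose y (t : C) := g (vec 1 [:: t]).
have {}hg : \forall Z \near nb0 R 2, F Z = 0 <-> co Z 1 = y (co Z 0) by exact: hg.
pose X t := t *: V + y t *: n.
have ay2 : an 2 (fun x : 'rV[C]_1 => y (co x 0)).
  by apply: an_eq ag2 => x; rewrite mulr0 addr0 /y -{1}(vec_co x).
have ay : an 1 (fun x : 'rV[C]_1 => y (co x 0)) by exact: an_weak ay2.
have aX i : an 1 (fun x : 'rV[C]_1 => X (co x 0) 0 i).
  apply: an_eq (an_add (an_scale (V 0 i) (an_co _ _ 0)) (an_scale (n 0 i) ay)) => Z.
  by rewrite !mxE; congr (_ + _); rewrite mulrC.
have h1 := near_vec (s := fun x : 'rV[C]_1 => [:: co x 0; y (co x 0)]) hg.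
have h2 := near_vec (s := fun x : 'rV[C]_1 => [:: co x 0; (y (co x 0))^*]) hg.
have h3 : \forall x \near nb0 R 1, forall v : C3, real_vec v = X (co x 0) ->
    M v -> G (X (co x 0)) = 0.
  have [r [r0 hr]] := GM.
  have : \forall x \near nb0 R 1, forall i, md (X (co x 0) 0 i) <= r.
    by apply: filter_forall => i; exact: an_near (aX i) r0.
  apply: filterS => x hx v vX; rewrite -vX; apply: hr => i.
  by have := hx (lshift 3 i); rewrite -vX row_mxEl.
have h4 : \forall x \near nb0 R 1, forall v : C3, real_vec v = X (co x 0) ->
    P (real_vec v) = 0 -> M v.
  have [r [r0 hr]] := MP.
  have : \forall x \near nb0 R 1, forall i, md (X (co x 0) 0 i) <= r.
    by apply: filter_forall => i; exact: an_near (aX i) r0.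
  apply: filterS => x hx v vX Pv; apply: (hr v _).2 => // i.
  by have := hx (lshift 3 i); rewrite -vX row_mxEl.
have c0 : c = 0.
  have M0 : M 0 by apply/(near_at0 MP); rewrite real_vec0 -[RHS](an_at0 Plin)
    /linear_form big1 ?subr0// => i _; rewrite mxE mulr0.
  by rewrite -(jet1_val jG) -real_vec0; exact: (near_at0 GM).
have GX : \forall x \near nb0 R 1, (co x 0)^* = co x 0 -> G (X (co x 0)) = 0.
  have all4 := filterI (filterI (h1 _) (h2 _)) (filterI h3 h4).
  apply: filterS (all4 _ _ _ _ _) => [x [[k1 k2] [k3 k4]] tr||].
  - move: k1 k2; rewrite /F !co_vec//= => -[_ /(_ erefl) e1] [e2 _].
    have yr : (y (co x 0))^* = y (co x 0).
      apply: e2; have := Ph (co x 0 *: V + y (co x 0) *: n).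
      rewrite e1 rmorph0 conj_vectorD !conj_vectorZ VV /n conj_real_vec tr.
      by [].
    have XX : conj_vector (X (co x 0)) = X (co x 0).
      by rewrite conj_vectorD !conj_vectorZ VV /n conj_real_vec tr yr.
    have vE := esym (real_vecP XX).
    by apply: (k3 _ vE); apply: (k4 _ vE); rewrite vE.
  - by nth_cases; apply: an_vanishing; an1.
  - by nth_cases; [|apply: vanishing_conj]; apply: an_vanishing; an1.
have aH : an 2 (fun x : 'rV[C]_1 => G (X (co x 0)) - co x 0 * linear_form b V).
  apply: an_eq (an_add (an_comp jG aX) (an_scale (linear_form b n) ay2)) => x.
  by rewrite c0 add0r linear_formD !linear_formZ; ring.
have [r [r0 hr]] := GX.
apply/eqP; rewrite -oppr_eq0; apply/eqP.
apply: (order_coef (v := vec 1 [:: 1]) aH).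
  by move=> i; rewrite mxE (ord1 i) md1.
exists r => // t t0 tr.
have ct : co (t%:C%C *: vec 1 [:: 1] : 'rV[C]_1) 0 = t%:C%C.
  by rewrite -[0%N]/(nat_of_ord (0 : 'I_1)) coE !mxE mulr1.
rewrite -{1}ct hr ?ct ?conj_real_complex// ?sub0r ?expr1 ?mulrN//.
by move=> i; rewrite !mxE (ord1 i) mulr1 md_real gtr0_norm.
Qed.

(** Differentiating along curves in M, and extending by linearity: a function
    vanishing on M is annihilated by the complexified tangent space of M. *)
Lemma tangential_derivative G c b : jet1 G c b ->
  (\forall x \near nb0 R 3, M x -> G (real_vec x) = 0) ->
  forall X, linear_form l X = 0 -> linear_form b X = 0.
Proof.
move=> jG GM.
have real V : conj_vector V = V -> linear_form l V = 0 -> linear_form b V = 0.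
  move=> VV lV; pose k : R := \sum_i md (V 0 i) + 1.
  have k0 : 0 < k by rewrite ltr_wpDl// sumr_ge0// => i _; exact: md_ge0.
  have kC : (k^-1)%:C%C != 0 :> C by rewrite -md_eq0 md_real normr_eq0 invr_eq0 gt_eqF.
  have := @vanish_real G c b ((k^-1)%:C%C *: V) jG GM.
  rewrite conj_vectorZ conj_real_complex VV !linear_formZ lV mulr0.
  move=> /(_ erefl) h; apply/eqP; have : (k^-1)%:C%C * linear_form b V = 0.
    apply: h => // i; rewrite mxE mdM md_real gtr0_norm ?invr_gt0//.
    rewrite mulrC ler_pdivrMr// mul1r /k (bigD1 i)//= -addrA lerDl addr_ge0// sumr_ge0// => j _.
    exact: md_ge0.
  by move/eqP; rewrite mulf_eq0 (negbTE kC).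
move=> X lX.
have lcX : linear_form l (conj_vector X) = 0 by rewrite linear_form_conj// lX rmorph0.
have two : 2 != 0 :> C by rewrite pnatr_eq0.
have XE Y : X = 2^-1 *: ((X + Y) + 'i *: (- 'i *: X + 'i *: Y)).
  apply/rowP => i; rewrite !mxE.
  have -> : 'i * (- 'i * X 0 i + 'i * Y 0 i) = X 0 i - Y 0 i.
    by rewrite mulrDr !mulrA mulrN -expr2 sqrCi opprK mul1r mulN1r.
  by field.
rewrite [X in linear_form b X = _](XE (conj_vector X)) {XE}.
rewrite linear_formZ linear_formD linear_formZ.
rewrite [linear_form b (X + _)]real; last 2 first.
- by rewrite conj_vectorD conj_vectorK addrC.
- by rewrite linear_formD lX lcX addr0.
rewrite [linear_form b (- 'i *: X + _)]real ?mulr0 ?addr0 ?mulr0//.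
- by rewrite conj_vectorD !conj_vectorZ conj_vectorK rmorphN /= conjCi opprK addrC.
- by rewrite linear_formD !linear_formZ lX lcX !mulr0 addr0.
Qed.
End Transversal.
End TangentialDerivatives.

(** * The Levi form and the second derivatives *)

Section LeviForm.
Variable R : realType.
Local Notation C := R[i].
Local Notation C3 := 'rV[C]_3.
Local Notation C6 := 'rV[C]_(3 + 3).

Lemma open_near0 n (U : set 'rV[C]_n) : open U -> U 0 -> \forall x \near nb0 R n, U x.
Proof.
move=> oU U0; have : nbhs (0 : 'rV[C]_n) U by exact: open_nbhs_nbhs.
move=> /nbhs_ballP[e /= e0 h]; pose r := complex.Re e / 2.
have eE : e = (complex.Re e)%:C%C by rewrite RRe_real// gtr0_real.
have re0 : 0 < complex.Re e by move: e0; rewrite eE ltcR.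
exists r; split; first by rewrite divr_gt0.
move=> x xr; apply: h; split=> // i j.
rewrite (ord1 i) /ball /= mxE sub0r normrN eE ltc_md; apply: le_lt_trans (xr j) _.
by rewrite /r; lra.
Qed.

Lemma pairing_col (X : C6) (b : 'I_(3 + 3) -> C) : pairing X (\col_i b i) = linear_form b X.
Proof. by rewrite /pairing mxE; apply: eq_bigr => i _; rewrite mxE mulrC. Qed.

Lemma pairingE (X : C6) (w : 'cV[C]_(3 + 3)) : pairing X w = linear_form (fun i => w i 0) X.
Proof. by rewrite /pairing mxE; apply: eq_bigr => i _; rewrite mulrC. Qed.

Lemma mem_T10_ambient (X : C6) : (X \in T10_ambient R) = (rsubmx X == 0).
Proof. by rewrite memv_ker lfunE. Qed.

Lemma mem_CTM rho p (X : C6) :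
  (X \in CTM rho p) = (pairing X (differential (@to_complex R rho) p) == 0).
Proof.
rewrite memv_ker lfunE /= /pairing; apply/eqP/eqP => [-> |h]; first by rewrite mxE.
by apply/matrixP => i j; rewrite !ord1 h mxE.
Qed.

Lemma mem_T10M rho p (X : C6) : (X \in T10M rho p) = (rsubmx X == 0) && (X \in CTM rho p).
Proof. by rewrite /T10M memv_cap; congr (_ && _); exact: mem_T10_ambient. Qed.

Lemma conj_to_complex (rho : C3 -> R) x : (to_complex rho x)^* = to_complex rho x.
Proof. exact: conj_real_complex. Qed.

Lemma d_zbar_real (rho : C3 -> R) j p :
  d_zbar j (to_complex rho) p = (d_z j (to_complex rho) p)^*.
Proof.
have real v : (real_derivative (to_complex rho) v p)^* = real_derivative (to_complex rho) v p.
  rewrite /real_derivative /to_complex /= derive1_cst.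
  exact: conj_real_complex.
rewrite /d_zbar /d_z; move: (real (delta_mx 0 j)) (real ('i *: delta_mx 0 j)).
move: (real_derivative _ _ _) (real_derivative _ _ _) => a b ra rb.
rewrite rmorphM rmorphB rmorphM /= ra rb conjCi mulNr opprK.
by rewrite fmorphV rmorph_nat.
Qed.

Variables (U : set C3) (rho : C3 -> R).
Let f := to_complex rho.
Let M := hypersurface U rho.
Variables (P : C6 -> C) (l : 'I_(3 + 3) -> C) (e : 'I_(3 + 3) -> 'I_(3 + 3) -> C).
Hypothesis oU : open U.
Hypothesis M0 : M 0.
Hypothesis fP : \forall x \near nb0 R 3, f x = P (real_vec x).
Hypothesis Ph : forall X, P (conj_vector X) = (P X)^*.
Hypothesis Pjet : an 3 (fun X => P X - (linear_form l X + quadratic e X)).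
Hypothesis lh : forall i, l (tau i) = (l i)^*.

Lemma hypersurface_near : \forall x \near nb0 R 3, M x <-> P (real_vec x) = 0.
Proof.
apply: filterS2 (open_near0 oU M0.1) fP => x Ux <-.
split=> [[_ /= r0]|/complexI r0]; last by split.
by rewrite /f /to_complex r0.
Qed.

Let S i j := e i j + e j i.

Lemma differential_near : exists dP : 'I_(3 + 3) -> C6 -> C,
  (forall i, jet1 (dP i) (l i) (S i)) /\
  \forall p \near nb0 R 3, differential f p = \col_i dP i (real_vec p).
Proof.
have [dP [jdP [K [r [K0 r0 h]]]]] := second_jet Pjet.
exists dP; split=> //; have [r1 [r10 h1]] := fP.
exists (Num.min r (r1 / 2)); split; first by rewrite lt_min r0 divr_gt0.
move=> p pr; apply: (@differential_expansion _ _ _ _ K (Num.min r (r1 / 2))).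
  by rewrite lt_min r0 divr_gt0.
have pr1 : cball (r1 / 2) p by apply: cballW pr; rewrite ge_min lexx orbT.
move=> x s xs s0 sr.
have xr1 : cball (r1 / 2) x.
  by apply: cballW xs; apply: le_trans sr _; rewrite ge_min lexx orbT.
rewrite !h1; last 2 first.
- by apply: cballW pr1; lra.
- move=> i; rewrite mxE; apply: le_trans (mdD _ _) _.
  by have := pr1 i; have := xr1 i; lra.
rewrite real_vecD /linear_form; under eq_bigr do rewrite mulrC.
apply: h => //.
- by apply: cball_real_vec; apply: cballW pr; rewrite ge_min lexx.
- exact: cball_real_vec.
- by apply: le_trans sr _; rewrite ge_min lexx.
Qed.

(** A field of (1, 0)-vectors tangent to M whose coefficients are real analytic at
    0; the coefficients are kept as restrictions of germs in six variables. *)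
Definition T10_field (L : C3 -> C6) : Prop :=
  (forall k, exists2 G, an 0 G & \forall x \near nb0 R 3, L x 0 k = G (real_vec x)) /\
  (forall p, M p -> L p \in T10M rho p).

Hypothesis lnz : exists i, l i != 0.

Lemma differential0 : differential f 0 = \col_i l i.
Proof.
have [dP [jdP hdP]] := differential_near.
rewrite (near_at0 hdP) real_vec0; apply/colP => i.
by rewrite !mxE (jet1_val (jdP i)).
Qed.

Lemma mem_CTM0 (X : C6) : (X \in CTM rho 0) = (linear_form l X == 0).
Proof. by rewrite mem_CTM -/f differential0 pairing_col. Qed.

Let tangential G c b X : jet1 G c b ->
  (\forall x \near nb0 R 3, M x -> G (real_vec x) = 0) ->
  linear_form l X = 0 -> linear_form b X = 0.
Proof.
move=> jG GM; have [i0 li0] := lnz.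
exact: (@tangential_derivative R M P l e hypersurface_near Ph Pjet lh i0 li0 G c b jG GM).
Qed.

Lemma T10_field_jets L : T10_field L -> exists G b, forall k,
  jet1 (G k) (L 0 0 k) (b k) /\ \forall x \near nb0 R 3, L x 0 k = G k (real_vec x).
Proof.
move=> [hL _].
have /choice[Gb hGb] k : exists Gb : (C6 -> C) * ('I_(3 + 3) -> C),
    jet1 Gb.1 (L 0 0 k) Gb.2 /\ \forall x \near nb0 R 3, L x 0 k = Gb.1 (real_vec x).
  have [G aG hG] := hL k; have [b jb] := jet1_exists aG.
  exists (G, b); split=> //=; rewrite (near_at0 hG) real_vec0; exact: jb.
by exists (fun k => (Gb k).1), (fun k => (Gb k).2).
Qed.

Lemma T10_field_tangent L p : T10_field L -> M p ->
  (forall m, L p 0 (rshift 3 m) = 0) /\ pairing (L p) (differential f p) = 0.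
Proof.
move=> [_ tL] Mp; have := tL p Mp; rewrite mem_T10M => /andP[/eqP r0 ctm].
split=> [m|]; last by move: ctm; rewrite mem_CTM => /eqP.
by have := congr1 (fun A : C3 => A 0 m) r0; rewrite !mxE.
Qed.

Lemma conj_fieldE (L : C3 -> C6) q i : conj_field L q 0 i = (L q 0 (tau i))^*.
Proof. exact: conj_vectorE. Qed.

(** For sections L, L' of T10, the component of the bracket transversal to
    T10 + T01 is the Hermitian part of the second derivative of the defining
    function: differentiating L rho = 0 along conj L', which is tangent to M,
    exchanges derivatives of the coefficients of L with second derivatives of
    rho. *)
Lemma levi_bracket L L' : T10_field L -> T10_field L' ->
  let V := lie_bracket L (conj_field L') 0 in
  \sum_m l (lshift 3 m) * V 0 (lshift 3 m) =
    \sum_m \sum_j S (lshift 3 m) (rshift 3 j) *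
       (L 0 0 (lshift 3 m) * (L' 0 0 (lshift 3 j))^*)
  /\ linear_form l V = 0.
Proof.
move=> fL fL' V.
have [GL [bL jL]] := T10_field_jets fL; have [GL' [bL' jL']] := T10_field_jets fL'.
pose GY i (X : C6) := (GL' (tau i) (conj_vector X))^*.
pose bY i j := (bL' (tau i) (tau j))^*.
have jY i : jet1 (GY i) (L' 0 0 (tau i))^* (bY i) /\
    \forall x \near nb0 R 3, conj_field L' x 0 i = GY i (real_vec x).
  split; last first.
    by apply: filterS (jL' (tau i)).2 => x; rewrite conj_fieldE /GY conj_real_vec => ->.
  apply: an_eq (an_conj_vector (jL' (tau i)).1) => X.
  rewrite rmorphB rmorphD /= /GY; congr (_ - (_ + _)).
  rewrite /linear_form rmorph_sum /= (reindex_inj (inv_inj tauK)) /=.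
  by apply: eq_bigr => j _; rewrite rmorphM /= conj_vectorE tauK conjCK.
have VE i : V 0 i = linear_form (bY i) (L 0) - linear_form (bL i) (conj_field L' 0).
  rewrite mxE (differential_jet (jY i).2 (jY i).1) pairing_col.
  by rewrite (differential_jet (jL i).2 (jL i).1) pairing_col.
have [L0r L0t] := T10_field_tangent fL M0; have [L0r' L0t'] := T10_field_tangent fL' M0.
have lL : linear_form l (L 0) = 0 by rewrite -[RHS]L0t differential0 pairing_col.
have lY : linear_form l (conj_field L' 0) = 0.
  rewrite /conj_field linear_form_conj//.
  have -> : linear_form l (L' 0) = 0 by rewrite -[RHS]L0t' differential0 pairing_col.
  by rewrite rmorph0.
(* The (0, 1)-components of L and the (1, 0)-components of conj L' vanish on M, so
   their derivatives along tangent fields vanish too. *)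
have T1 m : linear_form (bY (lshift 3 m)) (L 0) = 0.
  apply: tangential (jY _).1 _ lL; apply: filterS (jY (lshift 3 m)).2 => x <- Mx.
  by rewrite conj_fieldE tau_l (T10_field_tangent fL' Mx).1 rmorph0.
have T2 m : linear_form (bL (rshift 3 m)) (conj_field L' 0) = 0.
  apply: tangential (jL _).1 _ lY; apply: filterS (jL (rshift 3 m)).2 => x <- Mx.
  by rewrite (T10_field_tangent fL Mx).1.
have [dP [jdP hdP]] := differential_near.
have lin_sum (A D' : 'I_3 -> 'I_(3 + 3) -> C) (B D : 'I_3 -> C) Y :
    linear_form (fun i => \sum_k (A k i * B k + D k * D' k i)) Y =
    \sum_k (linear_form (A k) Y * B k + D k * linear_form (D' k) Y).
  rewrite /linear_form; under eq_bigr do rewrite mulr_suml.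
  rewrite exchange_big /=; apply: eq_bigr => k _.
  rewrite mulr_suml mulr_sumr -big_split /=; apply: eq_bigr => i _; ring.
have pairE (Z : C3 -> C6) x : (forall m, Z x 0 (rshift 3 m) = 0) ->
    differential f x = \col_i dP i (real_vec x) ->
    pairing (Z x) (differential f x) =
    \sum_k Z x 0 (lshift 3 k) * dP (lshift 3 k) (real_vec x).
  move=> Z0 ->; rewrite pairing_col /linear_form big_split_ord /= [X in _ + X]big1 ?addr0.
    by apply: eq_bigr => k _; rewrite mulrC.
  by move=> k _; rewrite Z0 mulr0.
(* Differentiating L rho = 0 along conj L', then conj L' rho = 0 along L. *)
have T3 : \sum_m l (lshift 3 m) * linear_form (bL (lshift 3 m)) (conj_field L' 0) =
   - \sum_m \sum_j S (lshift 3 m) (rshift 3 j) *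
       (L 0 0 (lshift 3 m) * (L' 0 0 (lshift 3 j))^*).
  have jT := jet1_sum (fun m => jet1_mul (jL (lshift 3 m)).1 (jdP (lshift 3 m))).
  have := tangential jT _ lY; rewrite lin_sum big_split /= => H.
  have -> : \sum_m l (lshift 3 m) * linear_form (bL (lshift 3 m)) (conj_field L' 0) =
      \sum_m linear_form (bL (lshift 3 m)) (conj_field L' 0) * l (lshift 3 m).
    by apply: eq_bigr => m _; rewrite mulrC.
  apply/eqP; rewrite -addr_eq0 -[X in _ == X]H; last first.
    have hL : \forall x \near nb0 R 3, forall k, L x 0 (lshift 3 k) = GL (lshift 3 k) (real_vec x).
      by apply: filter_forall => k; exact: (jL _).2.
    apply: filterS2 hL hdP => x h1 h2 Mx; have [z0 z1] := T10_field_tangent fL Mx.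
    by rewrite -[RHS]z1 pairE//; apply: eq_bigr => k _; rewrite h1.
  apply/eqP; congr (_ + _); apply: eq_bigr => m _.
  rewrite /linear_form big_split_ord /= [X in _ * (X + _)]big1 => [|j _]; last first.
    by rewrite conj_fieldE tau_l L0r' rmorph0 mulr0.
  rewrite add0r mulr_sumr; apply: eq_bigr => j _.
  by rewrite conj_fieldE tau_r mulrCA.
have T4 : \sum_m l (rshift 3 m) * linear_form (bY (rshift 3 m)) (L 0) =
   - \sum_m \sum_j S (lshift 3 m) (rshift 3 j) *
       (L 0 0 (lshift 3 m) * (L' 0 0 (lshift 3 j))^*).
  have jT := jet1_sum (fun m => jet1_mul (jY (rshift 3 m)).1 (jdP (rshift 3 m))).
  have := tangential jT _ lL; rewrite lin_sum big_split /= => H.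
  have -> : \sum_m l (rshift 3 m) * linear_form (bY (rshift 3 m)) (L 0) =
      \sum_m linear_form (bY (rshift 3 m)) (L 0) * l (rshift 3 m).
    by apply: eq_bigr => m _; rewrite mulrC.
  apply/eqP; rewrite -addr_eq0 -[X in _ == X]H; last first.
    have hY : \forall x \near nb0 R 3, forall k,
        conj_field L' x 0 (rshift 3 k) = GY (rshift 3 k) (real_vec x).
      by apply: filter_forall => k; exact: (jY _).2.
    apply: filterS2 hY hdP => x h1 h2 Mx; have [z0 z1] := T10_field_tangent fL' Mx.
    transitivity ((pairing (L' x) (differential f x))^*); last by rewrite z1 rmorph0.
    rewrite pairE// rmorph_sum.
    apply: eq_bigr => k _; rewrite -h1 conj_fieldE tau_r rmorphM; congr (_ * _).
    have := congr1 (fun A : 'cV[C]_(3 + 3) => A (rshift 3 k) 0) h2.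
    have := congr1 (fun A : 'cV[C]_(3 + 3) => A (lshift 3 k) 0) h2.
    by rewrite /= col_mxEu col_mxEd !mxE d_zbar_real => <- <-.
  apply/eqP; congr (_ + _); rewrite exchange_big /=; apply: eq_bigr => m _.
  rewrite /linear_form big_split_ord /= [X in _ + X]big1 => [|j _]; last first.
    by rewrite L0r mulr0.
  rewrite addr0 mulr_sumr; apply: eq_bigr => j _.
  by rewrite tau_r /S [e (rshift 3 m) _ + _]addrC; ring.
have V1 : \sum_m l (lshift 3 m) * V 0 (lshift 3 m) =
    \sum_m \sum_j S (lshift 3 m) (rshift 3 j) *
       (L 0 0 (lshift 3 m) * (L' 0 0 (lshift 3 j))^*).
  rewrite -[RHS]opprK -T3 -sumrN; apply: eq_bigr => m _.
  by rewrite VE T1 sub0r mulrN.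
split=> //; rewrite /linear_form big_split_ord /= V1.
have -> : \sum_m l (rshift 3 m) * V 0 (rshift 3 m) =
    \sum_m l (rshift 3 m) * linear_form (bY (rshift 3 m)) (L 0).
  by apply: eq_bigr => m _; rewrite VE T2 subr0.
by rewrite T4 subrr.
Qed.

Variables (L1 L2 : C3 -> C6) (rho0 : C3 -> 'cV[C]_(3 + 3)).
Hypothesis hL : local_generators U rho L1 L2.
Hypothesis hrho0 : levi_one_form U rho rho0.
Hypothesis hlevi : \rank (levi_matrix rho0 L1 L2 0) = 2%N.

Lemma generators_T10 : T10_field L1 /\ T10_field L2.
Proof.
have [hra hb] := hL.
by split; (split=> [k|p Mp]; [apply: real_analytic_an; have [h1 h2] := hra k 0 M0.1 |
  apply: (basis_mem (hb p Mp)); rewrite !inE eqxx ?orbT]).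
Qed.

Lemma T10M_generated X : X \in T10M rho 0 -> exists c1 c2, X = c1 *: L1 0 + c2 *: L2 0.
Proof.
have /andP[/eqP <- _] := hL.2 0 M0; rewrite span_cons span_seq1.
by move=> /memv_addP[u /vlineP[c1 ->] [v /vlineP[c2 ->] ->]]; exists c1, c2.
Qed.

Definition holomorphic_part (a : C3) : C6 := row_mx a 0.

Lemma T10M_holomorphic (a : C3) : \sum_m l (lshift 3 m) * a 0 m = 0 ->
  holomorphic_part a \in T10M rho 0.
Proof.
move=> la; rewrite mem_T10M row_mxKr eqxx mem_CTM0 /linear_form big_split_ord /=.
rewrite [X in _ + X]big1 ?addr0 => [|m _]; last by rewrite row_mxEr mxE mulr0.
by under eq_bigr do rewrite row_mxEl; rewrite la.
Qed.

(** The Hermitian part of the second derivatives of the defining function is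
    nondegenerate on the complex tangent space, since a degenerate direction
    would give a relation between the rows of the Levi matrix. *)
Lemma levi_nondegenerate (a : C3) : \sum_m l (lshift 3 m) * a 0 m = 0 ->
  (forall b : C3, \sum_m l (lshift 3 m) * b 0 m = 0 ->
    \sum_m \sum_j S (lshift 3 m) (rshift 3 j) * (a 0 m * (b 0 j)^*) = 0) ->
  a = 0.
Proof.
move=> la sa; have [f1 f2] := generators_T10.
have [c1 [c2 aE]] := T10M_generated (T10M_holomorphic la).
pose L (j : 'I_2) := tnth [tuple L1; L2] j.
have fL j : T10_field (L j) by case: j => -[|[|]].
pose c : 'rV[C]_2 := \row_j (if j == 0 then c1 else c2).
have aL m : a 0 m = \sum_j c 0 j * L j 0 0 (lshift 3 m).
  have := congr1 (fun A : C6 => A 0 (lshift 3 m)) aE.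
  rewrite /holomorphic_part row_mxEl => ->.
  by rewrite big_ord_recl big_ord1 !mxE.
(* V k is the bracket of the constant combination of L1, L2 with value a at 0 with
   the conjugate of the k-th generator; degeneracy of S makes it an element of
   T10 + T01, which rho0 annihilates. *)
pose V k : C6 := \sum_j c 0 j *: lie_bracket (L j) (conj_field (L k)) 0.
have VE k i : V k 0 i = \sum_j c 0 j * lie_bracket (L j) (conj_field (L k)) 0 0 i.
  by rewrite /V summxE; apply: eq_bigr => j _; rewrite mxE.
have Vl k : linear_form l (V k) = 0.
  rewrite /linear_form; under eq_bigr do rewrite VE mulr_sumr.
  rewrite exchange_big big1 //= => j _.
  have [_ /= b0] := levi_bracket (fL j) (fL k).
  transitivity (c 0 j * linear_form l (lie_bracket (L j) (conj_field (L k)) 0)).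
    by rewrite /linear_form mulr_sumr; apply: eq_bigr => i _; rewrite mulrCA.
  by rewrite b0 mulr0.
have Vh k : \sum_m l (lshift 3 m) * V k 0 (lshift 3 m) = 0.
  under eq_bigr do rewrite VE mulr_sumr.
  rewrite exchange_big /=.
  have lLk : \sum_m l (lshift 3 m) * (lsubmx (L k 0)) 0 m = 0.
    have [z0 z1] := T10_field_tangent (fL k) M0.
    rewrite -[RHS]z1 differential0 pairing_col /linear_form big_split_ord /=.
    rewrite [X in _ + X]big1 ?addr0 => [|m _]; last by rewrite z0 mulr0.
    by apply: eq_bigr => m _; rewrite mxE.
  rewrite -[RHS](sa _ lLk).
  transitivity (\sum_j c 0 j * \sum_m l (lshift 3 m) *
      lie_bracket (L j) (conj_field (L k)) 0 0 (lshift 3 m)).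
    by apply: eq_bigr => j _; rewrite mulr_sumr; apply: eq_bigr => m _; rewrite mulrCA.
  under eq_bigr => j _ do rewrite (levi_bracket (fL j) (fL k)).1 mulr_sumr.
  rewrite exchange_big /=; apply: eq_bigr => m _.
  under eq_bigr do rewrite mulr_sumr.
  rewrite exchange_big /=; apply: eq_bigr => j _.
  rewrite aL mulr_suml mulr_sumr; apply: eq_bigr => i _.
  by rewrite [lsubmx _ 0 j]mxE; ring.
have V0 k : pairing (V k) (rho0 0) = 0.
  have [_ _ h] := hrho0 M0; apply/h; first by rewrite mem_CTM0 Vl.
  pose b := conj_mx (rsubmx (V k)).
  exists (holomorphic_part (lsubmx (V k))), (holomorphic_part b); split.
  - by apply: T10M_holomorphic; under eq_bigr do rewrite mxE.
  - apply: T10M_holomorphic; apply: (can_inj (@conjCK C)); rewrite rmorph0.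
    move: (Vl k); rewrite /linear_form big_split_ord /= Vh add0r => vr.
    rewrite rmorph_sum -[RHS]vr; apply: eq_bigr => m _.
    by rewrite rmorphM /= !mxE conjCK -lh tau_l.
  - rewrite /conj_vector row_mxKl row_mxKr add_row_mx.
    rewrite (_ : conj_mx 0 = 0) ?addr0 ?add0r; last by apply/rowP => i; rewrite !mxE rmorph0.
    rewrite (_ : conj_mx b = rsubmx (V k)) ?hsubmxK//.
    by apply/rowP => i; rewrite !mxE conjCK.
have cL0 : c *m levi_matrix rho0 L1 L2 0 = 0.
  apply/rowP => k; rewrite !mxE.
  transitivity ('i * pairing (V k) (rho0 0)); last by rewrite V0 mulr0.
  rewrite pairingE /linear_form mulr_sumr.
  under [RHS]eq_bigr do rewrite VE mulr_sumr mulr_sumr.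
  rewrite exchange_big /=; apply: eq_bigr => j _.
  rewrite [levi_matrix _ _ _ _ _ _]mxE /levi_form pairingE linear_formZ /linear_form !mulr_sumr.
  by apply: eq_bigr => i _; ring.
have fr : row_free (levi_matrix rho0 L1 L2 0) by rewrite /row_free hlevi.
have c0 : c = 0.
  by apply: (row_free_inj fr); rewrite /= cL0 mul0mx.
by apply/rowP => m; rewrite aL mxE big1 // => j _; rewrite c0 mxE mul0r.
Qed.

(** The values of the generators at 0, seen in C^3. *)
Lemma tangent_pair : exists a1 a2 : C3,
  [/\ \sum_m l (lshift 3 m) * a1 0 m = 0, \sum_m l (lshift 3 m) * a2 0 m = 0 &
  forall c1 c2, c1 *: a1 + c2 *: a2 = 0 -> c1 = 0 /\ c2 = 0].
Proof.
have [f1 f2] := generators_T10.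
have tang L : T10_field L -> \sum_m l (lshift 3 m) * (lsubmx (L 0)) 0 m = 0
    /\ L 0 = row_mx (lsubmx (L 0)) 0.
  move=> fL; have [z0 z1] := T10_field_tangent fL M0; split.
    rewrite -[RHS]z1 differential0 pairing_col /linear_form big_split_ord /=.
    rewrite [X in _ + X]big1 ?addr0 => [|m _]; last by rewrite z0 mulr0.
    by apply: eq_bigr => m _; rewrite mxE.
  rewrite -[LHS]hsubmxK; congr row_mx; apply/rowP => m.
  by rewrite !mxE z0.
have [t1 e1] := tang _ f1; have [t2 e2] := tang _ f2.
exists (lsubmx (L1 0)), (lsubmx (L2 0)); split=> // c1 c2 c0.
have cL : c1 *: L1 0 + c2 *: L2 0 = 0.
  by rewrite e1 e2 !scale_row_mx add_row_mx c0 !scaler0 addr0 row_mx0.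
have := basis_free (hL.2 0 M0); rewrite free_cons seq1_free span_seq1 => /andP[n1 n2].
have [c1z|c1n] := eqVneq c1 0.
  split=> //; move: cL; rewrite c1z scale0r add0r => /eqP.
  by rewrite scaler_eq0 (negbTE n2) orbF => /eqP.
exfalso; move/negP: n1; apply; apply/vlineP; exists (- (c2 / c1)).
apply: (scalerI c1n); rewrite scalerA mulrN mulrC divfK// scaleNr.
by apply/eqP; rewrite -addr_eq0 cL.
Qed.
End LeviForm.

(** * Hermitian forms on a plane *)

Section HermitianForms.
Variable R : realType.
Local Notation C := R[i].
Variables (n : nat) (H : 'I_n -> 'I_n -> C).
Hypothesis Hh : forall i j, (H i j)^* = H j i.
Implicit Types a b : 'rV[C]_n.

Definition hform a b : C := \sum_i \sum_j H i j * (a 0 i * (b 0 j)^*).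

Lemma hformDl a a' b : hform (a + a') b = hform a b + hform a' b.
Proof.
rewrite /hform -big_split /=; apply: eq_bigr => i _; rewrite -big_split /=.
by apply: eq_bigr => j _; rewrite mxE; ring.
Qed.

Lemma hformZl k a b : hform (k *: a) b = k * hform a b.
Proof.
rewrite /hform mulr_sumr; apply: eq_bigr => i _; rewrite mulr_sumr.
by apply: eq_bigr => j _; rewrite mxE; ring.
Qed.

Lemma hformC a b : hform b a = (hform a b)^*.
Proof.
rewrite /hform rmorph_sum exchange_big /=; apply: eq_bigr => i _; rewrite rmorph_sum.
by apply: eq_bigr => j _; rewrite !rmorphM /= conjCK Hh; ring.
Qed.

Lemma hformDr a b b' : hform a (b + b') = hform a b + hform a b'.
Proof. by rewrite hformC hformDl rmorphD /= -!hformC. Qed.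

Lemma hformZr k a b : hform a (k *: b) = k^* * hform a b.
Proof. by rewrite hformC hformZl rmorphM /= -hformC. Qed.

(** If all vectors were isotropic, a + b and a + 'i b would be, so that both the real
    and the imaginary part of hform a b would vanish for all b. *)
Lemma nonisotropic (Q : set 'rV[C]_n) a :
  (forall k b b', Q b -> Q b' -> Q (b + k *: b')) -> Q a -> a != 0 ->
  ((forall b, Q b -> hform a b = 0) -> a = 0) -> exists2 b, Q b & hform b b != 0.
Proof.
move=> Qlin Qa a0 nd; apply: contrapT => none.
have iso b : Q b -> hform b b = 0.
  move=> Qb; apply/eqP; apply: contrapT => /negP h; apply: none; exists b => //.
move/negP: a0; apply; apply/eqP/nd => b Qb.
have h1 := iso _ (Qlin 1 _ _ Qa Qb); have h2 := iso _ (Qlin 'i _ _ Qa Qb).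
move: h1 h2; rewrite !(hformDl, hformDr, hformZl, hformZr) !iso// conjCi rmorph1.
move: (hform a b) (hform b a) => x y; rewrite !mulr0 !add0r !addr0 !mul1r mulNr => h1 h2.
have yx : y = - x by apply/eqP; rewrite -addr_eq0 addrC h1.
move: h2; rewrite yx mulrN -opprD => /eqP; rewrite oppr_eq0 -mulr2n -mulr_natl mulf_eq0.
by rewrite pnatr_eq0 mulf_eq0 (negbTE (neq0Ci C)) /= => /eqP.
Qed.

(** Division by the square root of the absolute value. *)
Lemma normalize b : hform b b != 0 ->
  exists (k : C) (s : bool), k != 0 /\ hform (k *: b) (k *: b) = (-1) ^+ s.
Proof.
move=> b0; have hr : hform b b \is Num.real by rewrite CrealE -hformC.
pose x := complex.Re (hform b b); have hx : hform b b = x%:C%C by rewrite /x RRe_real.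
have x0 : x != 0 by move: b0; rewrite hx -md_eq0 md_real normr_eq0.
pose t := (Num.sqrt `|x|)^-1.
have t0 : t != 0 by rewrite invr_eq0 sqrtr_eq0 -ltNge normr_gt0.
exists t%:C%C, (x < 0); split; first by rewrite -md_eq0 md_real normr_eq0.
rewrite hformZl hformZr conj_real_complex hx -!rmorphM /=.
have -> : t * (t * x) = (-1) ^+ (x < 0)%R.
  rewrite mulrA -invfM -expr2 sqr_sqrtr// {2}[x]numEsign mulrCA mulVf ?mulr1//.
  by rewrite normr_eq0.
by rewrite rmorphXn rmorphN rmorph1.
Qed.

(** A non-isotropic vector is normalized, and the second vector is found in the same
    way in its orthogonal complement, on which the form is again nondegenerate. *)
Lemma orthonormal_pair (K : set 'rV[C]_n) a1 a2 :
  (forall k b b', K b -> K b' -> K (b + k *: b')) -> K a1 -> K a2 ->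
  (forall c1 c2, c1 *: a1 + c2 *: a2 = 0 -> c1 = 0 /\ c2 = 0) ->
  (forall a, K a -> (forall b, K b -> hform a b = 0) -> a = 0) ->
  exists e1 e2 (s1 s2 : bool), [/\ K e1, K e2, hform e1 e2 = 0,
    hform e1 e1 = (-1) ^+ s1 & hform e2 e2 = (-1) ^+ s2].
Proof.
move=> Klin K1 K2 ind nd.
have K0 : K 0 by have := Klin (-1) _ _ K1 K1; rewrite scaleN1r subrr.
have KZ k b : K b -> K (k *: b) by move=> Kb; have := Klin k _ _ K0 Kb; rewrite add0r.
have a10 : a1 != 0.
  apply/eqP => a1z; have [] := ind 1 0; first by rewrite a1z scaler0 scale0r addr0.
  by move/eqP; rewrite oner_eq0.
have [e Ke ee] := nonisotropic Klin K1 a10 (nd a1 K1).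
have [k [s1 [k0 hs1]]] := normalize ee.
pose e1 := k *: e; have Ke1 : K e1 by exact: KZ.
have s1n0 (s : bool) : (-1) ^+ s != 0 :> C by rewrite signr_eq0.
pose pr b := b + (- (hform b e1 * (-1) ^+ s1)) *: e1.
have sq (s : bool) : (-1) ^+ s * (-1) ^+ s = 1 :> C by rewrite -expr2 sqrr_sign.
have prK b : K b -> K (pr b) /\ hform (pr b) e1 = 0.
  move=> Kb; split; first exact: Klin.
  by rewrite /pr hformDl hformZl hs1 mulNr -mulrA sq mulr1 subrr.
pose Q b := K b /\ hform b e1 = 0.
have Qlin k' b b' : Q b -> Q b' -> Q (b + k' *: b').
  move=> [Kb b0] [Kb' b0']; split; first exact: Klin.
  by rewrite hformDl hformZl b0 b0' mulr0 addr0.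
(* Q is the orthogonal complement of e1 in K. *)
have [a [Qa a0]] : exists a, Q a /\ a != 0.
  have [z1|nz1] := eqVneq (pr a1) 0; last by exists (pr a1); split=> //; exact: prK.
  have [z2|nz2] := eqVneq (pr a2) 0; last by exists (pr a2); split=> //; exact: prK.
  exfalso; move: z1 z2; rewrite /pr; set t1 := - _; set t2 := - _ => z1 z2.
  have e1a1 : t1 = 0 -> False.
    by move=> t10; move: z1; rewrite t10 scale0r addr0 => /eqP; rewrite (negbTE a10).
  have [] := ind t2 (- t1); last by move=> _ /eqP; rewrite oppr_eq0 => /eqP.
  have -> : a1 = - t1 *: e1 by apply/eqP; rewrite scaleNr -addr_eq0 z1.
  have -> : a2 = - t2 *: e1 by apply/eqP; rewrite scaleNr -addr_eq0 z2.
  by rewrite !scalerA -scalerDl; apply/eqP; rewrite scaler_eq0; apply/orP; left; apply/eqP; ring.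
have [e' [Ke' e'1] ee'] : exists2 b, Q b & hform b b != 0.
  apply: (nonisotropic Qlin Qa a0) => h; apply: (nd a Qa.1) => b Kb.
  have -> : b = pr b + (hform b e1 * (-1) ^+ s1) *: e1.
    by rewrite /pr -addrA -scalerDl addNr scale0r addr0.
  by rewrite hformDr hformZr Qa.2 mulr0 addr0 h//; exact: prK.
have [k' [s2 [_ hs2]]] := normalize ee'.
exists e1, (k' *: e'), s1, s2; split=> //; first exact: KZ.
by rewrite hformZr hformC e'1 rmorph0 mulr0.
Qed.
End HermitianForms.

(** * Local biholomorphisms *)

Section Assembly.
Variable R : realType.
Local Notation C := R[i].
Local Notation C3 := 'rV[C]_3.
Local Notation C6 := 'rV[C]_(3 + 3).

Lemma near_shift_nbhs n (A : set 'rV[C]_n) p :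
  (\forall x \near nb0 R n, A (p + x)) -> nbhs p A.
Proof.
move=> [r [r0 hr]]; apply/nbhs_ballP; exists r%:C%C => /=; first by rewrite ltcR.
move=> y [_ py]; rewrite -[y](subrK p) addrC; apply: hr => i.
have := py 0 i; rewrite /ball /= ltc_md => h.
by rewrite !mxE mdB ltW.
Qed.

(** Recentered at a point of the set, F moves by a germ of order 1, hence little. *)
Lemma open_preimage n m (F : 'rV[C]_n -> 'rV[C]_m) r B s : 0 < s ->
  (forall i, ps 0 r B (fun x => F x 0 i)) ->
  open [set p | polydisc r p /\ polydisc s (F p)].
Proof.
move=> s0 pF; rewrite openE => p [/= pr Fs]; apply: near_shift_nbhs.
have {}pr i : md (p 0 i) < r by rewrite -ltc_md.
have {}Fs i : md (F p 0 i) < s by rewrite -ltc_md.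
have n1 : \forall x \near nb0 R n, forall i : 'I_n, md ((x : 'rV[C]_n) 0 i) <= (r - md (p 0 i)) / 2.
  apply: filter_forall => i; apply: an_near; first exact: an_coord.
  by rewrite divr_gt0// subr_gt0.
have n2 : \forall x \near nb0 R n, forall i : 'I_m, md (F (p + x) 0 i - F p 0 i) <= (s - md (F p 0 i)) / 2.
  apply: filter_forall => i.
  have r0 := ps_gt0 (pF i).
  pose t := \big[Num.min/r]_i (r - md (p 0 i)).
  have t0 : 0 < t by apply: lt_bigmin => // j _; rewrite subr_gt0.
  have pr' : cball (r - t) p.
    by move=> j; have := bigmin_le r j (fun j => r - md (p 0 j)); rewrite -/t; lra.
  have := an_near (an_sub0 (ps_an (ps_recenter (pF i) t0 pr'))).
  by rewrite addr0; apply; rewrite divr_gt0// subr_gt0.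
apply: filterS2 n1 n2 => x h1 h2; split=> i; rewrite ltc_md.
  rewrite mxE; apply: le_lt_trans (mdD _ _) _; have := h1 i; have := pr i; lra.
rewrite -[F _ 0 i](subrK (F p 0 i)); apply: le_lt_trans (mdD _ _) _.
have := h2 i; have := Fs i; lra.
Qed.

(** The points of a small polydisc whose image lies in a small polydisc, and the
    same for the inverse: F and G exchange these two sets, and they stay in their
    domains of convergence. *)
Lemma local_biholomorphism n (F G : 'rV[C]_n -> 'rV[C]_n) (Q Q' : set 'rV[C]_n) :
  (forall i, an 1 (fun x => F x 0 i)) -> (forall i, an 1 (fun x => G x 0 i)) ->
  (\forall x \near nb0 R n, G (F x) = x) -> (\forall x \near nb0 R n, F (G x) = x) ->
  (\forall x \near nb0 R n, Q x) -> (\forall x \near nb0 R n, Q' x) ->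
  exists V W, [/\ V 0, biholomorphism V W F, forall p, V p -> Q p & forall p, V p -> Q' (F p)].
Proof.
move=> aF aG GF FG hQ hQ'.
have pick (H : 'rV[C]_n -> 'rV[C]_n) (T : set 'rV[C]_n) :
    (forall i, an 1 (fun x => H x 0 i)) -> (\forall x \near nb0 R n, T x) ->
    exists r, [/\ 0 < r, forall i, ps 1 r 1 (fun x => H x 0 i) & forall x, cball r x -> T x].
  move=> aH [r [r0 hT]]; have [s [s0 hs]] := fin_radius (fun i => an_small (aH i) ltr01).
  have m0 : 0 < Num.min r s by rewrite lt_min r0.
  exists (Num.min r s); split=> // [i|x xr].
    by apply: hs => //; rewrite ge_min lexx orbT.
  by apply: hT; apply: cballW xr; rewrite ge_min lexx.
have [r [r0 pF hr]] := pick F _ aF (filterI GF hQ).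
have [s [s0 pG hs]] := pick G _ aG (filterI FG hQ').
exists [set p | polydisc r p /\ polydisc s (F p)], [set q | polydisc s q /\ polydisc r (G q)].
have pc t (x : 'rV[C]_n) : polydisc t x -> cball t x.
  by move=> h i; rewrite ltW// -ltc_md.
have hol (H : 'rV[C]_n -> 'rV[C]_n) t i p : (forall i, ps 1 t 1 (fun x => H x 0 i)) ->
    polydisc t p -> holomorphic_at (fun q => H q 0 i) p.
  by move=> pH tp; apply: ps_holomorphic (pH i) _ => j; rewrite -ltc_md.
have F0 i : F 0 0 i = 0 by have := an_at0 (aF i).
split.
- split=> i; first by rewrite mxE ltc_md md0.
  by rewrite F0 ltc_md md0.
- split.
  + by apply: open_preimage => // i; exact: ps_weak (pF i).
  + by apply: open_preimage => // i; exact: ps_weak (pG i).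
  + by move=> i p [pr _]; exact: hol pr.
  + by move=> p [pr Fs]; split=> //; rewrite (hr p (pc _ _ pr)).1.
  + exists G; split.
    * by move=> i p [pr _]; exact: hol pr.
    * by move=> q [qs Gr]; split=> //; rewrite (hs q (pc _ _ qs)).1.
    * by move=> p [pr _]; exact: (hr p (pc _ _ pr)).1.
    * by move=> q [qs _]; exact: (hs q (pc _ _ qs)).1.
- by move=> p [pr _]; exact: (hr p (pc _ _ pr)).2.
- by move=> p [_ Fs]; exact: (hs _ (pc _ _ Fs)).2.
Qed.
End Assembly.

(** * Linear coordinates adapted to the Levi form *)

Section AdaptedCoordinates.
Variable R : realType.
Local Notation C := R[i].
Local Notation C3 := 'rV[C]_3.
Local Notation C6 := 'rV[C]_(3 + 3).

Lemma ord3P (i : 'I_3) : [\/ i = 0, i = 1 | i = 2].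
Proof.
case: i => -[|[|[|//]]] h; [apply: Or31|apply: Or32|apply: Or33]; exact: val_inj.
Qed.

Lemma sum3 (F : 'I_3 -> C) : \sum_i F i = F 0 + F 1 + F 2.
Proof.
rewrite !big_ord_recl big_ord0 addr0 addrA; congr (_ + F _ + F _); exact: val_inj.
Qed.

Variables (P : C6 -> C) (l : 'I_(3 + 3) -> C) (e : 'I_(3 + 3) -> 'I_(3 + 3) -> C).
Hypothesis Ph : forall X, P (conj_vector X) = (P X)^*.
Hypothesis Pjet : an 3 (fun X => P X - (linear_form l X + quadratic e X)).
Hypothesis lh : forall i, l (tau i) = (l i)^*.
Hypothesis eh : forall i j, e (tau i) (tau j) = (e i j)^*.

Let H (m j : 'I_3) : C := e (lshift 3 m) (rshift 3 j) + e (rshift 3 j) (lshift 3 m).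
Lemma hermitian_part m j : (H m j)^* = H j m.
Proof. by rewrite /H rmorphD /= -!eh !tau_l !tau_r addrC. Qed.

Let lam (a : C3) : C := \sum_m l (lshift 3 m) * a 0 m.

Variables (e1 e2 e3 : C3) (s1 s2 : bool).
Hypothesis lam1 : lam e1 = 0.
Hypothesis lam2 : lam e2 = 0.
Hypothesis lam3 : lam e3 = (-1) ^+ s1 * ('i / 2).
Hypothesis h12 : hform H e1 e2 = 0.
Hypothesis h11 : hform H e1 e1 = (-1) ^+ s1.
Hypothesis h22 : hform H e2 e2 = (-1) ^+ s2.

Let h21 : hform H e2 e1 = 0.
Proof. by rewrite (hformC hermitian_part) h12 rmorph0. Qed.

Let lamD a b : lam (a + b) = lam a + lam b.
Proof. by rewrite /lam -big_split /=; apply: eq_bigr => i _; rewrite mxE mulrDr. Qed.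

Let lamZ k a : lam (k *: a) = k * lam a.
Proof. by rewrite /lam mulr_sumr; apply: eq_bigr => i _; rewrite mxE mulrCA. Qed.

Definition frame_matrix : 'M[C]_3 := \matrix_(i, j) (vec 3 [:: e1 0 j; e2 0 j; e3 0 j]) 0 i.
Let B := frame_matrix.

Lemma mul_frame (x : C3) : x *m B = x 0 0 *: e1 + x 0 1 *: e2 + x 0 2 *: e3.
Proof. by apply/rowP => j; rewrite !mxE sum3 !mxE. Qed.

(** A relation between e1, e2, e3 has zero third coefficient by applying lam, then
    zero first and second ones by pairing with e1 and e2. *)
Lemma frame_unit : B \in unitmx.
Proof.
rewrite -row_free_unit; apply/row_freeP.
have inj (x : C3) : x *m B = 0 -> x = 0.
  rewrite mul_frame => x0.
  have x2 : x 0 2 = 0.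
    have := congr1 lam x0; rewrite !lamD !lamZ lam1 lam2 lam3 !mulr0 !add0r.
    rewrite [RHS]big1 => [/eqP|i _]; last by rewrite mxE mulr0.
    rewrite !mulf_eq0 signr_eq0 (negbTE (neq0Ci C)) invr_eq0 pnatr_eq0 !orbF.
    by move/eqP.
  move: x0; rewrite x2 scale0r addr0 => x0.
  have hf0 b : hform H 0 b = 0.
    by rewrite /hform big1// => i _; rewrite big1// => j _; rewrite mxE mul0r mulr0.
  have := congr1 (fun a => hform H a e1) x0; have := congr1 (fun a => hform H a e2) x0.
  rewrite !hformDl !hformZl h12 h21 h11 h22 !hf0 !mulr0 !(add0r, addr0).
  move=> /eqP; rewrite mulf_eq0 signr_eq0 orbF => /eqP x1.
  move=> /eqP; rewrite mulf_eq0 signr_eq0 orbF => /eqP x00.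
  by apply/rowP => i; rewrite [RHS]mxE; case: (ord3P i) => ->.
apply/row_freeP; rewrite -kermx_eq0; apply/eqP/row_matrixP => i.
by rewrite row0; apply: inj; rewrite -row_mul mulmx_ker row0.
Qed.

(** The complexified equation in the coordinates dual to e1, e2, e3, with the
    sign that makes the first square positive. *)
Definition straightened (X : 'rV[C]_6) : C :=
  (-1) ^+ s1 * P (row_mx (vec 3 [:: co X 0; co X 1; co X 2] *m B)
                         (vec 3 [:: co X 3; co X 4; co X 5] *m conj_mx B)).
Let N := straightened.

Lemma straightened_conj a b c d f g :
  N (vec 6 [:: d^*; f^*; g^*; a^*; b^*; c^*]) = (N (vec 6 [:: a; b; c; d; f; g]))^*.
Proof.
rewrite /N /straightened !co_vec//= rmorphM /= rmorph_sign -Ph; congr (_ * P _).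
have conj2 (x : C3) : conj_mx (x *m B) = conj_mx x *m conj_mx B by exact: map_mxM.
have conj3 (x : C3) : conj_mx (x *m conj_mx B) = conj_mx x *m B.
  rewrite [LHS]map_mxM; congr (_ *m _); apply/matrixP => i j; rewrite !mxE.
  exact: conjCK.
by rewrite /conj_vector row_mxKl row_mxKr conj2 conj3 !conj_vec.
Qed.

Lemma straightened_real (q : C3) :
  N (vec 6 [:: co q 0; co q 1; co q 2; (co q 0)^*; (co q 1)^*; (co q 2)^*]) =
  (-1) ^+ s1 * P (real_vec (q *m B)).
Proof.
rewrite /N /straightened !co_vec//=; congr (_ * P (row_mx _ _)).
  by rewrite -[X in _ = X *m _](vec_co q).
rewrite -[[:: _; _; _]]/[seq z^* | z <- mkseq (co q) 3] -conj_vec vec_co.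
exact/esym/map_mxM.
Qed.

Let an_arg (m : nat) (x1 x2 : 'rV[C]_m -> C3) :
  (forall i, an 1 (fun x => x1 x 0 i)) -> (forall i, an 1 (fun x => x2 x 0 i)) ->
  forall i, an 1 (fun x => row_mx (x1 x *m B) (x2 x *m conj_mx B) 0 i).
Proof.
move=> a1 a2 i; case: (split_ordP i) => j ->.
- have := @an_sum R m 1 _ (index_enum _) xpredT (fun k x => B k j * x1 x 0 k) (fun k _ => an_scale (B k j) (a1 k)).
  apply: an_eq => x; rewrite row_mxEl mxE.
  by apply: eq_bigr => k _; rewrite mulrC.
- have := @an_sum R m 1 _ (index_enum _) xpredT (fun k x => (conj_mx B) k j * x2 x 0 k) (fun k _ => an_scale _ (a2 k)).
  apply: an_eq => x; rewrite row_mxEr mxE.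
  by apply: eq_bigr => k _; rewrite mulrC.
Qed.

Let linear_arg (x y : C3) : linear_form l (row_mx (x *m B) (y *m conj_mx B)) =
  (-1) ^+ s1 * ('i / 2 * (x 0 2 - y 0 2)).
Proof.
have lc a : \sum_m l (rshift 3 m) * conj_mx a 0 m = (lam a)^*.
  rewrite rmorph_sum; apply: eq_bigr => m _.
  by rewrite rmorphM /= -lh tau_l mxE.
rewrite /linear_form big_split_ord /=.
have -> : \sum_m l (lshift 3 m) * row_mx (x *m B) (y *m conj_mx B) 0 (lshift 3 m) = lam (x *m B).
  by apply: eq_bigr => m _; rewrite row_mxEl.
have -> : \sum_m l (rshift 3 m) * row_mx (x *m B) (y *m conj_mx B) 0 (rshift 3 m) =
    (lam (conj_mx (y *m conj_mx B)))^*.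
  rewrite -lc; apply: eq_bigr => m _; rewrite row_mxEr; congr (_ * _).
  by rewrite [RHS]mxE [in RHS]mxE conjCK.
have -> : conj_mx (y *m conj_mx B) = conj_mx y *m B.
  rewrite [LHS]map_mxM; congr (_ *m _); apply/matrixP => i j; rewrite !mxE.
  exact: conjCK.
rewrite !mul_frame !lamD !lamZ lam1 lam2 lam3 !mxE !mulr0 !add0r.
rewrite rmorphM /= conjCK rmorphM rmorph_sign rmorphM /= fmorphV rmorph_nat conjCi.
by ring.
Qed.

Let polarization X Y : quadratic e (X + Y) =
  quadratic e X + quadratic e Y + \sum_i \sum_j (e i j + e j i) * (X 0 i * Y 0 j).
Proof.
have -> : \sum_i \sum_j (e i j + e j i) * (X 0 i * Y 0 j) =
    \sum_i \sum_j e i j * (X 0 i * Y 0 j + X 0 j * Y 0 i).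
  under eq_bigr do under eq_bigr do rewrite mulrDl.
  under [RHS]eq_bigr do under eq_bigr do rewrite mulrDr.
  under eq_bigr do rewrite big_split /=; under [RHS]eq_bigr do rewrite big_split /=.
  by rewrite !big_split /=; congr (_ + _); rewrite exchange_big.
rewrite /quadratic -!big_split; apply: eq_bigr => i _; rewrite -!big_split.
by apply: eq_bigr => j _; rewrite !mxE /=; ring.
Qed.

Let quadratic_arg (x y : C3) :
  quadratic e (row_mx x y) = quadratic e (row_mx x 0) + quadratic e (row_mx 0 y) +
    hform H x (conj_mx y).
Proof.
have {1}-> : row_mx x y = row_mx x 0 + row_mx 0 y by rewrite add_row_mx addr0 add0r.
rewrite polarization; congr (_ + _); rewrite big_split_ord /= [X in _ + X]big1 => [|m _].
  rewrite addr0; apply: eq_bigr => m _; rewrite big_split_ord /= big1 => [|j _].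
    rewrite add0r; apply: eq_bigr => j _; rewrite row_mxEl row_mxEr mxE.
    by rewrite conjCK.
  by rewrite !row_mxEl [X in _ * (_ * X)]mxE !mulr0.
rewrite big1// => j _; rewrite row_mxEr mxE mul0r mulr0.
by [].
Qed.

(** The functional lam kills e1 and e2, and its value at e3 is chosen so that the
    linear part is - Im w at the real points. *)
Lemma straightened_linear : an 2 (fun X => N X - 'i / 2 * (co X 2 - co X 5)).
Proof.
have a1 k1 k2 k3 i : an 1 (fun X : 'rV[C]_6 => vec 3 [:: co X k1; co X k2; co X k3] 0 i).
  by apply: an_vec; nth_cases; exact: an_co.
have aX := an_arg (a1 0 1 2) (a1 3 4 5).
have Pl : an 2 (fun X => P X - linear_form l X).
  apply: an_eq (an_add (an_weak (ltnW (ltnSn 2)) Pjet) (an_quadratic e)) => X.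
  by rewrite opprD addrA subrK.
apply: an_eq (an_scale ((-1) ^+ s1) (an_comp Pl aX)) => X.
rewrite linear_arg -!coE !co_vec//= mulrBr mulrA -expr2 sqrr_sign mul1r.
by [].
Qed.

(** The mixed second derivatives of P on the plane of e1 and e2 are the Hermitian
    form H, which is diagonal in this basis. *)
Lemma straightened_quadratic : an 3 (fun x : 'rV[C]_4 =>
   N (vec 6 [:: co x 0; co x 1; 0; co x 2; co x 3; 0]) -
   N (vec 6 [:: co x 0; co x 1; 0; 0; 0; 0]) -
   N (vec 6 [:: 0; 0; 0; co x 2; co x 3; 0]) -
   (co x 0 * co x 2 + (-1) ^+ (s1 (+) s2) * (co x 1 * co x 3))).
Proof.
pose E X := P X - (linear_form l X + quadratic e X).
pose z (x : 'rV[C]_4) := vec 3 [:: co x 0; co x 1; 0].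
pose t (x : 'rV[C]_4) := vec 3 [:: co x 2; co x 3; 0].
pose o (x : 'rV[C]_4) : C3 := vec 3 [:: 0; 0; 0].
have az i : an 1 (fun x => z x 0 i) by apply: an_vec; nth_cases; first [exact: an_co | exact: an_zero].
have at' i : an 1 (fun x => t x 0 i) by apply: an_vec; nth_cases; first [exact: an_co | exact: an_zero].
have ao i : an 1 (fun x => o x 0 i) by apply: an_vec; nth_cases; exact: an_zero.
have aE (y1 y2 : 'rV[C]_4 -> C3) a1 a2 := an_comp Pjet (@an_arg 4 y1 y2 a1 a2).
have := an_sub (an_sub (aE _ _ az at') (aE _ _ az ao)) (aE _ _ ao at').
move=> /(an_scale ((-1) ^+ s1)); apply: an_eq => x.
rewrite /N /straightened !co_vec//= -/(z x) -/(t x) -/(o x) !linear_arg.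
have o0 : o x = 0 by apply/rowP => i; rewrite !mxE; case: (ord3P i) => ->.
rewrite o0 !mul0mx quadratic_arg.
have -> : hform H (z x *m B) (conj_mx (t x *m conj_mx B)) =
    (-1) ^+ s1 * (co x 0 * co x 2) + (-1) ^+ s2 * (co x 1 * co x 3).
  have -> : conj_mx (t x *m conj_mx B) = conj_mx (t x) *m B.
    rewrite [LHS]map_mxM; congr (_ *m _); apply/matrixP => i j; rewrite !mxE.
    exact: conjCK.
  have z2 : z x 0 2 = 0 by rewrite mxE.
  have t2 : conj_mx (t x) 0 2 = 0 by rewrite !mxE rmorph0.
  rewrite !mul_frame z2 t2 !scale0r !addr0 !(hformDl, hformZl, hformDr hermitian_part).
  rewrite !(hformZr hermitian_part) h11 h12 h21 h22 !mxE /= !conjCK.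
  by ring.
have z0 : (0 : C3) 0 2 = 0 by rewrite mxE.
rewrite z0 -!coE /z /t !co_vec//= signr_addb.
have ss : (-1) ^+ s1 * (-1) ^+ s1 = 1 :> C by rewrite -expr2 sqrr_sign.
rewrite [in RHS](_ : co x 0 * co x 2 = (-1) ^+ s1 * (-1) ^+ s1 * (co x 0 * co x 2)).
  by ring.
by rewrite ss mul1r.
Qed.
End AdaptedCoordinates.

(** * The graph in normal coordinates *)

Section Representation.
Variable R : realType.
Local Notation C := R[i].
Local Notation C3 := 'rV[C]_3.

Lemma an_mulmx m n (A : 'M[C]_(m, n)) (g : 'rV[C]_m -> 'rV[C]_m) :
  (forall i, an 1 (fun x => g x 0 i)) -> forall j, an 1 (fun x => (g x *m A) 0 j).
Proof.
move=> ag j; have := @an_sum R m 1 _ (index_enum _) xpredT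
  (fun k x => A k j * g x 0 k) (fun k _ => an_scale (A k j) (ag k)).
by apply: an_eq => x; rewrite mxE; apply: eq_bigr => k _; rewrite mulrC.
Qed.

Variables (U : set C3) (rho : C3 -> R) (B : 'M[C]_3) (minus : bool).
Variables (W V : C -> C -> C -> C) (phi : C -> C -> C -> C -> C -> C).
Let eps : C := (-1) ^+ minus.
Hypothesis nU : \forall x \near nb0 R 3, U x.
Hypothesis Bu : B \in unitmx.
Hypothesis aW : an 1 (fun x : C3 => W (co x 0) (co x 1) (co x 2)).
Hypothesis aV : an 1 (fun x : C3 => V (co x 0) (co x 1) (co x 2)).
Hypothesis VW : \forall x \near nb0 R 3,
  V (co x 0) (co x 1) (W (co x 0) (co x 1) (co x 2)) = co x 2.
Hypothesis WV : \forall x \near nb0 R 3,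
  W (co x 0) (co x 1) (V (co x 0) (co x 1) (co x 2)) = co x 2.
Hypothesis aphi : an 3 (fun x : 'rV[C]_5 => phi (co x 0) (co x 1) (co x 2) (co x 3) (co x 4) -
  (co x 0 * co x 2 + eps * (co x 1 * co x 3))).
Hypothesis phi_conj : \forall x \near nb0 R 5,
  phi (co x 2)^* (co x 3)^* (co x 0)^* (co x 1)^* (co x 4)^* =
  (phi (co x 0) (co x 1) (co x 2) (co x 3) (co x 4))^*.
Hypothesis phi_z : \forall x \near nb0 R 3, phi (co x 0) (co x 1) 0 0 (co x 2) = 0.
Hypothesis phi_zeta : \forall x \near nb0 R 3, phi 0 0 (co x 0) (co x 1) (co x 2) = 0.
Hypothesis equation : \forall q \near nb0 R 3, let H := V (co q 0) (co q 1) (co q 2) in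
  rho (q *m B) = 0 <-> 'Im H = phi (co q 0) (co q 1) (co q 0)^* (co q 1)^* ('Re H).

(** Linear coordinates in the basis of the rows of B, then the Segre parameter V in
    place of the third one. *)
Definition normal_coordinates (p : C3) : C3 :=
  let q := p *m invmx B in vec 3 [:: co q 0; co q 1; V (co q 0) (co q 1) (co q 2)].

Let inverse_coordinates (q : C3) : C3 :=
  vec 3 [:: co q 0; co q 1; W (co q 0) (co q 1) (co q 2)] *m B.

Definition remainder (x : 'rV[C]_5) : C :=
  phi (co x 0) (co x 1) (co x 2) (co x 3) (co x 4) -
  (co x 0 * co x 2 + eps * (co x 1 * co x 3)).

Let an_old : forall i, an 1 (fun p : C3 => (p *m invmx B) 0 i).
Proof. by apply: an_mulmx => i; exact: an_coord. Qed.

Let an_new i : an 1 (fun p => normal_coordinates p 0 i).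
Proof.
have h : forall i, an 1 (fun q : C3 => vec 3 [:: co q 0; co q 1; V (co q 0) (co q 1) (co q 2)] 0 i).
  by apply: an_vec; nth_cases; first [exact: an_co | exact: aV].
exact: an_comp (h i) an_old.
Qed.

Let an_inverse : forall i, an 1 (fun q => inverse_coordinates q 0 i).
Proof.
apply: an_mulmx; apply: an_vec.
by nth_cases; first [exact: an_co | exact: aW].
Qed.

Let new_inverse : \forall q \near nb0 R 3, normal_coordinates (inverse_coordinates q) = q.
Proof.
apply: filterS VW => q VWq; rewrite /normal_coordinates /inverse_coordinates mulmxK// !co_vec//=.
by rewrite VWq -[RHS]vec_co.
Qed.

Let inverse_new : \forall p \near nb0 R 3, inverse_coordinates (normal_coordinates p) = p.
Proof.
apply: filterS (near_comp an_old WV) => p WVp.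
rewrite /inverse_coordinates /normal_coordinates !co_vec//= WVp.
by rewrite -[X in X *m B = _]/(vec 3 (mkseq (co (p *m invmx B)) 3)) vec_co mulmxKV.
Qed.

Lemma normal_coordinates_equation : \forall p \near nb0 R 3,
  let z1 := normal_coordinates p 0 0 in
  let z2 := normal_coordinates p 0 1 in
  let w := normal_coordinates p 0 2 in
  rho p = 0 <-> 'Im w = z1 * z1^* + eps * (z2 * z2^*) +
                        remainder (vec5 z1 z2 z1^* z2^* ('Re w)).
Proof.
apply: filterS (near_comp an_old equation) => p /=; rewrite mulmxKV// => ->.
rewrite /normal_coordinates !mxE /= /remainder.
set q := p *m invmx B.
rewrite -[vec5 _ _ _ _ _]/(vec 5 [:: _; _; _; _; _]) !co_vec//=.
by rewrite addrC subrK.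
Qed.

(* A common radius for the properties that hold near 0. *)
Let remainder_radius : exists r, [/\ 0 < r, is_O3 remainder r,
  forall x : 'rV[C]_5, cball r x ->
    phi (co x 2)^* (co x 3)^* (co x 0)^* (co x 1)^* (co x 4)^* =
    (phi (co x 0) (co x 1) (co x 2) (co x 3) (co x 4))^*,
  forall x : C3, cball r x -> phi (co x 0) (co x 1) 0 0 (co x 2) = 0 &
  forall x : C3, cball r x -> phi 0 0 (co x 0) (co x 1) (co x 2) = 0].
Proof.
have [r1 [r10 h1]] := phi_conj; have [r2 [r20 h2]] := phi_z; have [r3 [r30 h3]] := phi_zeta.
have [r4 [M h4]] := aphi; have r40 := ps_gt0 h4.
pose r := Num.min (Num.min r1 r2) (Num.min r3 r4).
have r0 : 0 < r by rewrite !lt_min r10 r20 r30 r40.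
have [l1 l2 l3 l4] : [/\ r <= r1, r <= r2, r <= r3 & r <= r4].
  by split; rewrite !ge_min lexx ?orbT.
exists r; split=> //.
- have [c [hc dc]] := ps_is_sum (ps_shrink r0 l4 h4).
  by exists c; split.
- by move=> x /(cballW l1)/h1.
- by move=> x /(cballW l2)/h2.
- by move=> x /(cballW l3)/h3.
Qed.

Theorem graph_representation :
  exists (V W : set C3) (Phi : C3 -> C3) (minus : bool) (Rem : 'rV[C]_5 -> C) (r : R),
    [/\ V `<=` U, V 0, biholomorphism V W Phi & Phi 0 = 0] /\
    [/\ is_O3 Rem r,
        (forall z1 z2 u : C,
           polydisc r (vec5 z1 z2 z1^* z2^* u) -> u \is Num.real ->
           Rem (vec5 z1 z2 z1^* z2^* u) \is Num.real),
        (forall zeta1 zeta2 u : C, polydisc r (vec5 0 0 zeta1 zeta2 u) ->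
           Rem (vec5 0 0 zeta1 zeta2 u) = 0) &
        (forall z1 z2 u : C, polydisc r (vec5 z1 z2 0 0 u) ->
           Rem (vec5 z1 z2 0 0 u) = 0)] /\
    (forall p, V p ->
       let z1 := Phi p 0 0 in
       let z2 := Phi p 0 1 in
       let w := Phi p 0 2 in
       polydisc r (Phi p) /\
       (rho p = 0 <->
        'Im w = z1 * z1^* + (-1) ^+ minus * (z2 * z2^*)
                + Rem (vec5 z1 z2 z1^* z2^* ('Re w)))).
Proof.
have [r [r0 O3 conj zero1 zero2]] := remainder_radius.
have npoly : \forall q \near nb0 R 3, polydisc r (q : C3).
  exists (r / 2); split=> [|q qr i]; first by rewrite divr_gt0.
  by rewrite ltc_md; have := qr i; lra.
have [V0 [W0 [V00 bih QV Q'V]]] := local_biholomorphism an_new an_inverse inverse_new new_inverse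
  (filterI nU normal_coordinates_equation) npoly.
have pc n (x : 'rV[C]_n) : polydisc r x -> cball r x.
  by move=> h i; rewrite ltW// -ltc_md.
have remE a b c d f : remainder (vec5 a b c d f) = phi a b c d f - (a * c + eps * (b * d)).
  by rewrite /remainder -[vec5 _ _ _ _ _]/(vec 5 [:: _; _; _; _; _]) !co_vec.
have sub5 (i1 i2 i3 : 'I_5) (x : 'rV[C]_5) : polydisc r x ->
    cball r (vec 3 [:: x 0 i1; x 0 i2; x 0 i3]).
  by move=> /pc h i; rewrite mxE; case: (ord3P i) => -> /=; exact: h.
exists V0, W0, normal_coordinates, minus, remainder, r; split; last split.
- split=> //; first by move=> p /QV[].
  by apply/rowP => i; rewrite [RHS]mxE; exact: an_at0 (an_new i).
- split=> //.
  + move=> z1 z2 u /pc h ur; rewrite remE.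
    have := conj _ h; rewrite -[vec5 _ _ _ _ _]/(vec 5 [:: _; _; _; _; _]) !co_vec//= !conjCK.
    move=> hc; rewrite CrealE rmorphB /= -hc (conj_Creal ur) rmorphD !rmorphM /= !conjCK.
    by rewrite /eps rmorph_sign [z1^* * _]mulrC [z2^* * _]mulrC.
  + move=> a b u h; rewrite remE !mul0r mulr0 addr0 subr0.
    by have := zero2 _ (sub5 2 3 4 _ h); rewrite !mxE /= !co_vec.
  + move=> a b u h; rewrite remE !mulr0 addr0 subr0.
    by have := zero1 _ (sub5 0 1 4 _ h); rewrite !mxE /= !co_vec.
- by move=> p Vp; split; [exact: Q'V | exact: (QV p Vp).2].
Qed.
End Representation.
Theorem mainTheorem5 (R : realType)
    (U : set 'rV[R[i]]_3) (rho : 'rV[R[i]]_3 -> R)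
    (L1 L2 : 'rV[R[i]]_3 -> 'rV[R[i]]_(3 + 3))
    (rho0 : 'rV[R[i]]_3 -> 'cV[R[i]]_(3 + 3))
    (hM : local_hypersurface U rho)
    (hL : local_generators U rho L1 L2)
    (hframe : five_frame U rho L1 L2)
    (hrho0 : levi_one_form U rho rho0)
    (hlevi : forall p, hypersurface U rho p ->
       \rank (levi_matrix rho0 L1 L2 p) = 2%N) :
  exists (V W : set 'rV[R[i]]_3) (Phi : 'rV[R[i]]_3 -> 'rV[R[i]]_3)
         (minus : bool) (Rem : 'rV[R[i]]_5 -> R[i]) (r : R),
    [/\ V `<=` U, V 0, biholomorphism V W Phi & Phi 0 = 0] /\
    [/\ is_O3 Rem r,
        (forall z1 z2 u : R[i],
           polydisc r (vec5 z1 z2 z1^* z2^* u) -> u \is Num.real ->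
           Rem (vec5 z1 z2 z1^* z2^* u) \is Num.real),
        (forall zeta1 zeta2 u : R[i], polydisc r (vec5 0 0 zeta1 zeta2 u) ->
           Rem (vec5 0 0 zeta1 zeta2 u) = 0) &
        (forall z1 z2 u : R[i], polydisc r (vec5 z1 z2 0 0 u) ->
           Rem (vec5 z1 z2 0 0 u) = 0)] /\
    (forall p, V p ->
       let z1 := Phi p 0 0 in
       let z2 := Phi p 0 1 in
       let w := Phi p 0 2 in
       polydisc r (Phi p) /\
       (rho p = 0 <->
        'Im w = z1 * z1^* + (-1) ^+ minus * (z2 * z2^*)
                + Rem (vec5 z1 z2 z1^* z2^* ('Re w)))).
Proof.
have [oU M0 ra dnz] := hM.
have f0 : to_complex rho 0 = 0 by rewrite /to_complex M0.2.
have [P [l [e [fP Ph Pjet lh eh]]]] := hermitian_extension (ra 0 M0.1) f0 (conj_to_complex rho).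
have lnz : exists i, l i != 0.
  have := dnz 0 M0; rewrite (differential0 fP Pjet) => /cV0Pn[i li].
  by exists i; move: li; rewrite mxE.
have [k lk] : exists k : 'I_3, l (lshift 3 k) != 0.
  have [i li] := lnz; case: (split_ordP i) li => k -> lk; exists k => //.
  by move: lk; rewrite -tau_l lh conjC_eq0.
pose K (a : 'rV[R[i]]_3) := \sum_m l (lshift 3 m) * a 0 m = 0.
have Klin c b b' : K b -> K b' -> K (b + c *: b').
  rewrite /K => Kb Kb'.
  transitivity (\sum_m l (lshift 3 m) * b 0 m + c * \sum_m l (lshift 3 m) * b' 0 m).
    rewrite mulr_sumr -big_split; apply: eq_bigr => m _; rewrite !mxE /=; ring.
  by rewrite Kb Kb' mulr0 addr0.
have [a1 [a2 [Ka1 Ka2 indep]]] := tangent_pair M0 fP Pjet hL.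
have nondeg := levi_nondegenerate oU M0 fP Ph Pjet lh lnz hL hrho0 (hlevi 0 M0).
have [e1 [e2 [s1 [s2 [Ke1 Ke2 h12 h11 h22]]]]] :=
  orthonormal_pair (hermitian_part eh) Klin Ka1 Ka2 indep nondeg.
(* A transversal vector, scaled to give the functional l the value required by the
   linear part of the normal form. *)
pose e3 : 'rV[R[i]]_3 := ((-1) ^+ s1 * ('i / 2) / l (lshift 3 k)) *: delta_mx 0 k.
have Ke3 : \sum_m l (lshift 3 m) * e3 0 m = (-1) ^+ s1 * ('i / 2).
  rewrite (bigD1 k)//= big1 => [|m mk]; rewrite !mxE eqxx ?(negbTE mk) ?mulr0//=.
  by rewrite eqxx addr0 mulr1 mulrCA divff// mulr1.
have [W [V [phi [[aW aV VW WV] [aphi phiC phiz phizeta] eqn]]]] := normal_form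
  (straightened_conj Ph e1 e2 e3 s1) (straightened_linear Pjet lh Ke1 Ke2 Ke3)
  (straightened_quadratic Pjet lh eh Ke1 Ke2 Ke3 h12 h11 h22).
have Bu := frame_unit eh Ke1 Ke2 Ke3 h12 h11 h22.
apply: (@graph_representation R U rho _ _ W V phi (open_near0 oU M0.1) Bu aW aV VW WV aphi phiC phiz phizeta).
have an_old : forall i, an 1 (fun q : 'rV[R[i]]_3 => (q *m frame_matrix e1 e2 e3) 0 i).
  by apply: an_mulmx => i; exact: an_coord.
apply: filterS2 eqn (near_comp an_old fP) => q /=.
rewrite straightened_real => <- <-.
split=> [r0|]; first by rewrite /to_complex r0 mulr0.
move=> /eqP; rewrite mulf_eq0 signr_eq0 /= => /eqP.
exact: complexI.
Qed.
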